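(* Let $V_0>0$ be a constant and let $f:\mathbb{R}\to\mathbb{R}$ be a $C^1$ function satisfying $(f_1)$–$(f_5)$ (with $\theta>2$ from $(f_3)$ and $p>2$, $C_p>0$ from $(f_5)$). Assume $$C_p>\left[\chi_p\frac{2\theta}{\theta-2}\right]^{(p-2)/2},$$ where $\chi_p=\inf_{u\in\mathcal{M}_{B_1(0)}}J_p(u)$, with $$J_p(u)=\frac12\int_{B_1(0)}\big(|\nabla u|^2+V_0|u|^2\big)dx-\frac1p\int_{B_1(0)}|u|^p\,dx,\quad u\in H_0^1(B_1(0)),$$ $$\mathcal{M}_{B_1(0)}=\{u\in H_0^1(B_1(0)):\ u^\pm\neq0,\ J_p'(u^\pm)u^\pm=0\}.$$ Then the autonomous problem $-\Delta u+V_0u=f(u)$ in $\mathbb{R}^2$, $u\in H^1(\mathbb{R}^2)$, does not have a least energy nodal solution; that is, the infimum $\hat c=\inf_{u\in\mathcal{M}}J(u)$ is not attained, where $J(u)=\frac12\int_{\mathbb{R}^2}(|\nabla u|^2+V_0u^2)dx-\int_{\mathbb{R}^2}F(u)dx$ on $H^1(\mathbb{R}^2)$ and $\mathcal{M}=\{u\in H^1(\mathbb{R}^2): u^\pm\neq0,\ J'(u^\pm)u^\pm=0\}$.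
   Context: Hypotheses on $f$: $(f_1)$ there is $C>0$ with $|f(s)|\le Ce^{4\pi s^2}$ for all $s\in\mathbb{R}$; $(f_2)$ $\lim_{s\to0}f(s)/s=0$; $(f_3)$ there is $\theta>2$ with $0<\theta F(s)\le sf(s)$ for all $s\neq0$, where $F(s)=\int_0^sf(t)\,dt$; $(f_4)$ $s\mapsto f(s)/|s|$ is strictly increasing on $(0,+\infty)$; $(f_5)$ there are $p>2$, $C_p>0$ with $\mathrm{sign}(s)f(s)\ge C_p|s|^{p-1}$ for all $s\neq0$. Notation: $u^+=\max\{u,0\}$, $u^-=\min\{u,0\}$. A least energy nodal solution is a $u\in\mathcal{M}$ with $J(u)=\hat c$ and $J'(u)=0$. *)

(* Defs.v *)
From HB Require Import structures.
From mathcomp Require Import all_boot all_order all_algebra.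
From mathcomp Require Import all_classical all_reals all_analysis.
Set Implicit Arguments. Unset Strict Implicit. Unset Printing Implicit Defensive.
Import Order.TTheory GRing.Theory Num.Theory.
Import numFieldNormedType.Exports.
Local Open Scope classical_set_scope.
Local Open Scope ring_scope.

Definition leb2 (R : realType) := ((@lebesgue_measure R) \x (@lebesgue_measure R))%E.

Definition partial (R : realType) (i : bool) (phi : R * R -> R) : R * R -> R :=
  fun x => if i then derive1 (fun t => phi (x.1, t)) x.2
           else derive1 (fun t => phi (t, x.2)) x.1.

Definition partial_exists (R : realType) (i : bool) (phi : R * R -> R) (x : R * R) :=
  if i then derivable (fun t => phi (x.1, t)) x.2 1
  else derivable (fun t => phi (t, x.2)) x.1 1.

Fixpoint iter_partial (R : realType) (s : seq bool) (phi : R * R -> R) :=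
  if s is i :: s' then partial i (iter_partial s' phi) else phi.

Definition smooth2 (R : realType) (phi : R * R -> R) :=
  forall s : seq bool, continuous (iter_partial s phi) /\
    forall (i : bool) (x : R * R), partial_exists i (iter_partial s phi) x.

Definition support2 (R : realType) (phi : R * R -> R) := closure [set x | phi x != 0].

Definition test_fun (R : realType) (phi : R * R -> R) :=
  smooth2 phi /\ compact (support2 phi).

Definition L2 (R : realType) (u : R * R -> R) :=
  measurable_fun setT u /\ (\int[@leb2 R]_x ((u x) ^+ 2)%:E < +oo)%E.

Definition weak_grad (R : realType) (u g1 g2 : R * R -> R) :=
  forall phi, test_fun phi ->
    (\int[@leb2 R]_x (u x * partial false phi x)%:E = - \int[@leb2 R]_x (g1 x * phi x)%:E)%E /\
    (\int[@leb2 R]_x (u x * partial true phi x)%:E = - \int[@leb2 R]_x (g2 x * phi x)%:E)%E.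

Definition H1 (R : realType) (u : R * R -> R) :=
  L2 u /\ exists g1 g2, L2 g1 /\ L2 g2 /\ weak_grad u g1 g2.

Definition ball1 (R : realType) : set (R * R) := [set x | x.1 ^+ 2 + x.2 ^+ 2 < 1].

(* H_0^1(B_1(0)): H^1-limits of test functions supported in B_1(0)
   (functions are extended by zero outside B_1(0)) *)
Definition H01_ball (R : realType) (u : R * R -> R) :=
  exists g1 g2, L2 u /\ L2 g1 /\ L2 g2 /\ weak_grad u g1 g2 /\
  exists phi : nat -> R * R -> R,
    (forall n, test_fun (phi n) /\ support2 (phi n) `<=` @ball1 R) /\
    ((fun n => \int[@leb2 R]_x ((u x - phi n x) ^+ 2
                 + (g1 x - partial false (phi n) x) ^+ 2
                 + (g2 x - partial true (phi n) x) ^+ 2)%:E)%E @ \oo --> 0%E).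

(* Dirichlet integral over D: int_D |grad u|^2 (independent of the choice of
   the weak gradient, which is unique a.e.; +oo if u has no weak gradient in L2) *)
Definition dirichlet (R : realType) (D : set (R * R)) (u : R * R -> R) : \bar R :=
  ereal_inf [set e | exists g1 g2, L2 g1 /\ L2 g2 /\ weak_grad u g1 g2 /\
     e = (\int[@leb2 R]_(x in D) ((g1 x) ^+ 2 + (g2 x) ^+ 2)%:E)%E].

Definition primitive (R : realType) (f : R -> R) (s : R) : R :=
  if 0 <= s then (\int[@lebesgue_measure R]_(t in `[0, s]) f t)%R
  else (- \int[@lebesgue_measure R]_(t in `[s, 0]) f t)%R.

Definition posp (R : realType) (u : R * R -> R) := fun x => Num.max (u x) 0.
Definition negp (R : realType) (u : R * R -> R) := fun x => Num.min (u x) 0.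

Definition J (R : realType) (V0 : R) (f : R -> R) (u : R * R -> R) : \bar R :=
  ((2^-1)%:E * (dirichlet setT u + V0%:E * \int[@leb2 R]_x ((u x) ^+ 2)%:E)
   - \int[@leb2 R]_x (primitive f (u x))%:E)%E.

Definition dJ_diag (R : realType) (V0 : R) (f : R -> R) (v : R * R -> R) : R :=
  derive1 (fun t : R => fine (J V0 f (fun x => v x + t * v x))) 0.

Definition nonzero_ae (R : realType) (u : R * R -> R) :=
  ~ {ae @leb2 R, forall x, u x = 0}.

Definition nodal_nehari (R : realType) (V0 : R) (f : R -> R) : set (R * R -> R) :=
  [set u | H1 u /\ nonzero_ae (posp u) /\ nonzero_ae (negp u) /\
           dJ_diag V0 f (posp u) = 0 /\ dJ_diag V0 f (negp u) = 0].

Definition chat (R : realType) (V0 : R) (f : R -> R) : \bar R :=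
  ereal_inf (J V0 f @` nodal_nehari V0 f).

Definition Jp (R : realType) (V0 p : R) (u : R * R -> R) : \bar R :=
  ((2^-1)%:E * (dirichlet (@ball1 R) u + V0%:E * \int[@leb2 R]_(x in @ball1 R) ((u x) ^+ 2)%:E)
   - (p^-1)%:E * \int[@leb2 R]_(x in @ball1 R) (powR `|u x| p)%:E)%E.

Definition dJp_diag (R : realType) (V0 p : R) (v : R * R -> R) : R :=
  derive1 (fun t : R => fine (Jp V0 p (fun x => v x + t * v x))) 0.

Definition nodal_nehari_ball (R : realType) (V0 p : R) : set (R * R -> R) :=
  [set u | H01_ball u /\ nonzero_ae (posp u) /\ nonzero_ae (negp u) /\
           dJp_diag V0 p (posp u) = 0 /\ dJp_diag V0 p (negp u) = 0].

Definition chi_p (R : realType) (V0 p : R) : \bar R :=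
  ereal_inf (Jp V0 p @` nodal_nehari_ball V0 p).

(* Main.v *)
(* In the plane the Dirichlet integral is dilation invariant, while the other
   terms of J scale by k^-2.  Hence every v with V0 |v|^2 < int v f(v) has a
   unique dilate on the Nehari set, of energy Q(v) = E(v) K(v) / -b(v), where E is
   the Dirichlet integral, b(v) = V0 int v^2 - int v f(v) and
   K(v) = int (v f(v) / 2 - F(v)).  Cutting off, dilating and translating apart
   gives c^ <= Q(w) + Q(z) for all w >= 0 >= z with b(w), b(z) < 0, so the positive
   part w of a minimiser u minimises Q among nonnegative functions.  Comparing w
   with max(w, e psi), psi a cut-off function, all terms other than the gradient
   change by O(e^2); hence the integral of |grad w|^2 over {w < e psi} is O(e^2).
   Letting e tend to 0 in min(w / e, 1), the indicator function of {w > 0} has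
   zero weak gradient, thus is a.e. constant, which contradicts u+ <> 0 and
   u- <> 0.

   Sobolev functions are handled through absolute continuity on almost all lines
   parallel to the axes.  Integrability of u f(u) comes from Gagliardo's
   inequality on the slices {sqrt k < u <= sqrt (k + 1)}: the measures of the
   superlevel sets {u > sqrt k} decay faster than any exponential in k. *)

Require Import Defs.
From HB Require Import structures.
From mathcomp Require Import all_boot all_order all_algebra.
From mathcomp Require Import all_classical all_reals all_analysis.
From mathcomp Require Import measurable_realfun.
From mathcomp Require Import ring lra.
Import Order.TTheory GRing.Theory Num.Theory.
Import numFieldNormedType.Exports.
Local Open Scope classical_set_scope.
Local Open Scope ring_scope.
Set Implicit Arguments. Unset Strict Implicit. Unset Printing Implicit Defensive.

(** * Integration on the line *)

(** The comparison with max(w, e psi) takes the place of the Euler-Lagrange equation and of the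
    strong maximum principle. Origin of Q: for v_k(x) = v(k x) one has J'(v_k)v_k = E + k^-2 b, so
    k^2 = -b / E, and the energy there is k^-2 K. For u^+ and u^- themselves E = -b, hence Q = K,
    and the term of the fixed part u^- cancels from both sides of the comparison. Why the order e^2
    decides: let A = E(w), K = K(w), and let P be the integral of |grad w|^2 over {w < e psi}.
    Minimality becomes K (A - O(e^2)) <= (A - P + O(e^2)) (K + O(e^2)); the products K A cancel and
    P = O(e^2) remains. This is the scale at which the gradient of min(w / e, 1), that is grad w / e
    on {w <= e}, stays bounded in L^2 of every box. Boundedness alone does not make its limit zero,
    but this gradient lives on {0 < w <= e}, and the measure of that set inside a box tends to 0;
    Young's inequality then makes its pairing with a test function vanish in the limit. The
    quadratic order itself comes from s f(s) <= C s^2 for 0 <= s <= 1. *)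

Section real_integrals.
Context d (T : measurableType d) (R : realType).
Variable mu : {measure set T -> \bar R}.
Implicit Types (D : set T) (f g : T -> R).

Lemma ae_sub (P Q : T -> Prop) : (forall x, P x -> Q x) ->
  {ae mu, forall x, P x} -> {ae mu, forall x, Q x}.
Proof. by move=> PQ; apply: filterS. Qed.

Lemma ae_sub2 (P Q S : T -> Prop) : (forall x, P x -> Q x -> S x) ->
  {ae mu, forall x, P x} -> {ae mu, forall x, Q x} -> {ae mu, forall x, S x}.
Proof. by move=> PQ; apply: filterS2. Qed.

Lemma integrable_le D f g : measurable D -> measurable_fun D f ->
  mu.-integrable D (EFin \o g) -> (forall x, D x -> `|f x| <= g x) ->
  mu.-integrable D (EFin \o f).
Proof.
move=> mD mf ig fg; apply: (le_integrable mD _ _ ig).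
  exact/measurable_EFinP.
move=> x Dx; rewrite /= lee_fin.
by apply: le_trans (fg x Dx) _; rewrite ler_norm.
Qed.

Lemma integrableD_real D f g : measurable D ->
  mu.-integrable D (EFin \o f) -> mu.-integrable D (EFin \o g) ->
  mu.-integrable D (EFin \o (fun x => f x + g x)).
Proof.
by move=> mD i1 i2; apply: eq_integrable (integrableD mD i1 i2).
Qed.

Lemma integrableB_real D f g : measurable D ->
  mu.-integrable D (EFin \o f) -> mu.-integrable D (EFin \o g) ->
  mu.-integrable D (EFin \o (fun x => f x - g x)).
Proof.
by move=> mD i1 i2; apply: eq_integrable (integrableB mD i1 i2).
Qed.

Lemma integrableZ_real D (k : R) f : measurable D ->
  mu.-integrable D (EFin \o f) -> mu.-integrable D (EFin \o (fun x => k * f x)).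
Proof.
by move=> mD i1; apply: eq_integrable (integrableZl mD k i1).
Qed.

Lemma EFin_Rintegral D f : measurable D -> mu.-integrable D (EFin \o f) ->
  (\int[mu]_(x in D) (f x)%:E)%E = (\int[mu]_(x in D) f x)%R%:E.
Proof. by move=> mD i1; rewrite /Rintegral fineK//; exact: integrable_fin_num. Qed.

Lemma integrable_measurable D f :
  mu.-integrable D (EFin \o f) -> measurable_fun D f.
Proof. by move=> /integrableP[/measurable_EFinP]. Qed.

Lemma ae_eq_Rintegral D f g : measurable D -> measurable_fun D f ->
  measurable_fun D g -> {ae mu, forall x, D x -> f x = g x} ->
  \int[mu]_(x in D) f x = \int[mu]_(x in D) g x.
Proof.
move=> mD mf mg fg; congr fine.
apply: ae_eq_integral => //; try exact/measurable_EFinP.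
by apply: filterS fg => x fg Dx; rewrite fg.
Qed.

Lemma dominated_cvg_Rintegral D (f_ : nat -> T -> R) f g : measurable D ->
  (forall n, measurable_fun D (f_ n)) ->
  (forall x, D x -> f_ ^~ x @ \oo --> f x) ->
  mu.-integrable D (EFin \o g) ->
  (forall n x, D x -> `|f_ n x| <= g x) ->
  mu.-integrable D (EFin \o f) /\
  (fun n => \int[mu]_(x in D) f_ n x) @ \oo --> \int[mu]_(x in D) f x.
Proof.
move=> mD mf_ cf ig fg.
have mf : measurable_fun D f.
  by apply: measurable_fun_cvg mf_ _; exact: cf.
have [|||||iff _ H] := @dominated_convergence _ _ _ mu D mD
  (fun n => EFin \o f_ n) (EFin \o f) (EFin \o g).
- by move=> n; exact/measurable_EFinP.
- exact/measurable_EFinP.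
- apply: aeW => x Dx; apply: cvg_EFin; last exact: cf.
  exact: nearW.
- exact: ig.
- by apply: aeW => x n Dx; rewrite /= lee_fin fg.
split => //.
by apply: fine_cvg; rewrite -EFin_Rintegral.
Qed.

End real_integrals.

Section primitive_calculus.
Context {R : realType}.
Notation mu := (@lebesgue_measure R).
Implicit Types (d U : R -> R) (a b c x : R).

Definition locint d :=
  measurable_fun setT d /\ forall a b, mu.-integrable `[a, b] (EFin \o d).

Lemma Rintegral_chasles d a c b : locint d -> a <= c -> c <= b ->
  \int[mu]_(t in `[a, b]) d t =
  \int[mu]_(t in `[a, c]) d t + \int[mu]_(t in `[c, b]) d t.
Proof.
move=> [_ id] ac cb.
have := @Rintegral_itvB R d (BLeft a) (BRight b) c (id a b).
rewrite !bnd_simp => /(_ ac cb); rewrite Rintegral_itv_obnd_cbnd.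
  by move=> <-; rewrite addrC subrK.
by apply: integrableS (id c b) => //; exact: subset_itv_oc_cc.
Qed.

Lemma primitiveB d a b : locint d -> a <= b ->
  primitive d b - primitive d a = \int[mu]_(t in `[a, b]) d t.
Proof.
move=> ld ab; rewrite /primitive.
case: (leP 0 a) => a0.
  by rewrite (le_trans a0 ab) (Rintegral_chasles ld a0 ab) addrC addKr.
case: (leP 0 b) => b0.
  by rewrite opprK addrC (Rintegral_chasles ld (ltW a0) b0).
by rewrite opprK (Rintegral_chasles ld ab (ltW b0)) addrC addrK.
Qed.

Lemma primitive0 d : primitive d 0 = 0.
Proof. by rewrite /primitive lexx set_itv1 Rintegral_set1. Qed.

(** [primitive] is defined by cases at 0. Around [x] a single formula with a base point to the left
    of [x] is available, and continuity and differentiability are read off from that one. *)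
Lemma primitive_near d x : locint d ->
  \forall y \near x, primitive d y =
    primitive d (x - 1) + \int[mu]_(t in `[x - 1, y]) d t.
Proof.
move=> ld; near=> y; rewrite -primitiveB//; first by rewrite addrC subrK.
near: y; apply: filterS (nbhsx_ballx x 1 ltr01) => y.
by rewrite /ball/= ltr_norml => /andP[_] /ltW; lra.
Unshelve. all: by end_near. Qed.

Lemma continuous_primitive d : locint d -> continuous (primitive d).
Proof.
move=> ld x.
have lx : x - 1 < x + 1 by lra.
have := parameterized_integral_continuous (ltW lx) (ld.2 (x - 1) (x + 1)).
move=> /(continuous_within_itvP _ lx)[+ _ _].
move=> /(_ x); rewrite in_itv/=.
have -> : x - 1 < x < x + 1 by apply/andP; split; lra.
move=> /(_ isT) cx.
have := primitive_near x ld => npx.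
rewrite /continuous_at (nbhs_singleton npx).
apply: (@cvg_trans _ ((fun y => primitive d (x - 1) +
    \int[mu]_(t in `[x - 1, y]) d t) @ x)).
  by apply: near_eq_cvg; apply: filterS npx => y ->.
exact: (cvgD (cvg_cst _) cx).
Qed.

Lemma is_derive_primitive d x : locint d -> {for x, continuous d} ->
  is_derive x 1 (primitive d) (d x).
Proof.
move=> ld cx.
have lx : x - 1 < x by lra.
have xl : x < x + 1 by lra.
have [dr de] := continuous_FTC1_closed xl (ld.2 (x - 1) (x + 1)) lx cx.
pose G y := primitive d (x - 1) + \int[mu]_(t in `[x - 1, y]) d t.
apply: (@near_eq_is_derive _ _ _ G).
  by apply: filterS (primitive_near x ld) => y ->.
rewrite -[d x]add0r; apply: is_deriveD.
by apply: (DeriveDef dr); rewrite -derive1E; exact: de.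
Qed.

Lemma continuous_locint d : continuous d -> locint d.
Proof.
move=> cd; split; first exact: continuous_measurable_fun.
move=> a b; apply: continuous_compact_integrable.
  exact: segment_compact.
exact: continuous_subspaceT.
Qed.

Lemma FTC2_continuous (F : R -> R) d a b : a <= b -> continuous d ->
  (forall x, is_derive x 1 F (d x)) ->
  \int[mu]_(t in `[a, b]) d t = F b - F a.
Proof.
rewrite le_eqVlt => /predU1P[<- _ _|ab cd dF].
  by rewrite set_itv1 Rintegral_set1 subrr.
have cF : continuous F.
  by move=> x; apply/differentiable_continuous/derivable1_diffP.
rewrite /Rintegral (@continuous_FTC2 _ d F)//.
- exact: continuous_subspaceT.
- split.
  + by move=> x _; have := dF x => -[].
  + exact: cvg_at_right_filter (cF a).
  + exact: cvg_at_left_filter (cF b).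
- by move=> x _; rewrite derive1E; apply: derive_val.
Qed.

Lemma locint_locally_integrable d : locint d -> locally_integrable setT d.
Proof.
move=> [md id]; split => //; first exact: openT.
move=> K _ cK.
have [M [Mr HM]] := compact_bounded cK.
pose N := `|M| + 1.
have KN : K `<=` `[- N, N].
  move=> x Kx /=; rewrite in_itv/= -ler_norml.
  by apply: (HM N) => //; rewrite /N (le_lt_trans (ler_norm M))// ltrDl.
have /integrableP[_] := id (- N) N.
apply: le_lt_trans.
apply: ge0_subset_integral => //=; first exact: compact_measurable.
by apply/measurable_EFinP; apply: measurableT_comp => //; exact: measurable_funTS.
Qed.

(** [FTC1] differentiates integrals from a fixed left endpoint, and only to the right of it. The
    endpoints -n exhaust the line, at the price of a countable union of null sets. *)
Lemma ae_is_derive_primitive d : locint d ->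
  {ae mu, forall x, is_derive x 1 (primitive d) (d x)}.
Proof.
move=> ld.
have H n : {ae mu, forall x, - n%:R < x ->
    derivable (fun x => \int[mu]_(t in `[- n%:R, x]) d t) x 1 /\
    derive1 (fun x => \int[mu]_(t in `[- n%:R, x]) d t) x = d x}.
  have := @FTC1 R d (BLeft (- n%:R)) (fun y => ld.2 _ _) (locint_locally_integrable ld).
  by apply: ae_sub => x /= Hx nx; apply: Hx; rewrite lte_fin.
have := ae_foralln H; apply: ae_sub => x Hx.
pose n := (Num.truncn `|x|).+1.
have nx : - n%:R < x.
  have : `|x| < n%:R by exact: truncnS_gt.
  by rewrite ltr_norml => /andP[].
have [dr de] := Hx n nx.
pose G y := primitive d (- n%:R) + \int[mu]_(t in `[- n%:R, y]) d t.
apply: (@near_eq_is_derive _ _ _ G).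
  near=> y; rewrite /G -primitiveB//; first by rewrite addrC subrK.
  near: y; have e0 : 0 < x + n%:R by lra.
  apply: filterS (nbhsx_ballx x _ e0) => y.
  by rewrite /ball/= ltr_norml => /andP[_] /ltW; lra.
rewrite -[d x]add0r; apply: is_deriveD.
by apply: (DeriveDef dr); rewrite -derive1E; exact: de.
Unshelve. all: by end_near. Qed.

Lemma eq_primitive_ae d d' : locint d -> locint d' ->
  primitive d =1 primitive d' -> {ae mu, forall x, d x = d' x}.
Proof.
move=> ld ld' /funext e.
have := ae_is_derive_primitive ld; rewrite e.
have := ae_is_derive_primitive ld'.
apply: ae_sub2 => x h1 h2.
by rewrite -(@derive_val _ _ _ _ _ _ _ h1) -(@derive_val _ _ _ _ _ _ _ h2).
Qed.

Lemma ae_eq_primitive d d' : measurable_fun setT d -> measurable_fun setT d' ->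
  {ae mu, forall x, d x = d' x} -> primitive d =1 primitive d'.
Proof.
move=> md md' e x; rewrite /primitive; case: ifPn => _.
  apply: ae_eq_Rintegral => //; try exact: measurable_funTS.
  by apply: ae_sub e => t ->.
congr (- _); apply: ae_eq_Rintegral => //; try exact: measurable_funTS.
by apply: ae_sub e => t ->.
Qed.

Lemma locintD d d' : locint d -> locint d' -> locint (fun x => d x + d' x).
Proof.
move=> [md id] [md' id']; split; first exact: measurable_funD.
by move=> a b; exact: integrableD_real.
Qed.

Lemma locintZ k d : locint d -> locint (fun x => k * d x).
Proof.
move=> [md id]; split; first exact: measurable_funM.
by move=> a b; exact: integrableZ_real.
Qed.

Lemma locint_le d d' : measurable_fun setT d -> locint d' ->
  (forall x, `|d x| <= d' x) -> locint d.
Proof.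
move=> md [_ id'] dd'; split => // a b.
by apply: (integrable_le _ _ (id' a b)) => //; exact: measurable_funTS.
Qed.

Lemma locint_norm d : locint d -> locint (fun x => `|d x|).
Proof.
move=> [md id]; split; first exact: measurableT_comp.
by move=> a b; have := integrable_norm (id a b).
Qed.

Lemma locint_le_norm d d' : measurable_fun setT d -> locint d' ->
  (forall x, `|d x| <= `|d' x|) -> locint d.
Proof. by move=> md ld'; apply: locint_le md (locint_norm ld'). Qed.

Lemma primitiveD d d' x : locint d -> locint d' ->
  primitive (fun x => d x + d' x) x = primitive d x + primitive d' x.
Proof.
move=> [md id] [md' id']; rewrite /primitive; case: ifPn => _.
  exact: RintegralD.
by rewrite -opprD RintegralD.
Qed.

Lemma primitiveZ k d x : locint d ->
  primitive (fun x => k * d x) x = k * primitive d x.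
Proof.
move=> [md id]; rewrite /primitive; case: ifPn => _.
  exact: RintegralZl.
by rewrite mulrN RintegralZl.
Qed.

End primitive_calculus.

Section continuous_ops.
Context {X : topologicalType} {K : numFieldType}.
Implicit Types g h : X -> K.

Lemma contD g h : continuous g -> continuous h -> continuous (fun x => g x + h x).
Proof. by move=> cg ch x; exact: (cvgD (cg x) (ch x)). Qed.

Lemma contB g h : continuous g -> continuous h -> continuous (fun x => g x - h x).
Proof. by move=> cg ch x; exact: (cvgB (cg x) (ch x)). Qed.

Lemma contM g h : continuous g -> continuous h -> continuous (fun x => g x * h x).
Proof. by move=> cg ch x; exact: (cvgM (cg x) (ch x)). Qed.

Lemma cont_cst (k : K) : continuous (fun _ : X => k).
Proof. by move=> x; exact: cvg_cst. Qed.

End continuous_ops.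

(** * Product rule for primitives of locally integrable functions *)

Section one_dimensional_rules.
Context {R : realType}.
Notation mu := (@lebesgue_measure R).
Implicit Types (d U : R -> R) (a b c x : R).

Lemma le_eps_eq (x y C : R) : 0 <= C ->
  (forall e, 0 < e -> `|x - y| <= C * e) -> x = y.
Proof.
move=> C0 H; apply/eqP; rewrite -subr_eq0 -normr_le0; apply/ler_addgt0Pr => e e0.
have C1 : 0 < C + 1 by lra.
have := H (e / (C + 1)) (divr_gt0 e0 C1); rewrite add0r => /le_trans; apply.
rewrite mulrA ler_pdivrMr// mulrC ler_wpM2l//; [exact: ltW|lra].
Qed.

Lemma mu_itv_lty a b : (mu `[a, b] < +oo)%E.
Proof.
by rewrite lebesgue_measure_itv/=; case: ifPn => _; rewrite ?ltry// -EFinB ltry.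
Qed.

Lemma Rintegral_cst_itv a b (r : R) : a <= b ->
  \int[mu]_(t in `[a, b]) r = r * (b - a).
Proof.
move=> ab; rewrite Rintegral_cst//; congr (_ * _).
have H : mu `[a, b] = (b - a)%:E.
  rewrite lebesgue_measure_itv/= lte_fin; case: ltP => // ba.
  by rewrite (le_anti (introT andP (conj ab ba))) subrr.
exact: (congr1 fine H).
Qed.

Lemma continuous_approx d a b (e : R) : locint d -> 0 < e ->
  exists k : R -> R, continuous k /\ \int[mu]_(t in `[a, b]) `|d t - k t| <= e.
Proof.
move=> ld e0.
have [||k [ck ik]] := @approximation_continuous_integrable R `[a, b] d _ _ (ld.2 a b).
- exact: measurable_itv.
- exact: mu_itv_lty.
move=> /fine_cvgP[_] /cvgrPdist_le /(_ e e0)[N _ /(_ N (leqnn N))].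
rewrite sub0r normrN => H.
exists (k N); split => //.
by apply: le_trans H; apply: le_trans (ler_norm _).
Qed.

Lemma locintB d d' : locint d -> locint d' -> locint (fun x => d x - d' x).
Proof.
move=> [md id] [md' id']; split; first exact: measurable_funB.
by move=> a b; exact: integrableB_real.
Qed.

Lemma primitive_dist_le d k a x b : locint d -> locint k -> a <= x -> x <= b ->
  `|(primitive d x - primitive d a) - (primitive k x - primitive k a)|
    <= \int[mu]_(t in `[a, b]) `|d t - k t|.
Proof.
move=> ld lk ax xb.
rewrite !primitiveB// -RintegralB//; [|exact: ld.2|exact: lk.2].
apply: (le_trans (le_normr_Rintegral _ _)) => //.
  by have := (locintB ld lk).2 a x.
rewrite (Rintegral_chasles (locint_norm (locintB ld lk)) ax xb) lerDl.
by apply: Rintegral_ge0.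
Qed.

Lemma continuous_bound (g : R -> R) a b : a <= b -> continuous g ->
  exists2 M : R, 0 <= M & forall t, t \in `[a, b] -> `|g t| <= M.
Proof.
move=> ab cg.
have [|c _ H] := @EVT_max R (fun t => `|g t|) a b ab.
  by apply: continuous_subspaceT => x; apply: continuous_comp; [exact: cg|exact: norm_continuous].
by exists `|g c|.
Qed.

Lemma is_derive_continuous (g g' : R -> R) :
  (forall x, is_derive x 1 g (g' x)) -> continuous g.
Proof.
by move=> dg x; apply/differentiable_continuous/derivable1_diffP; have [] := dg x.
Qed.

Lemma locint_mul_continuous (g : R -> R) d :
  continuous g -> locint d -> locint (fun x => g x * d x).
Proof.
move=> cg [md id]; split.
  by apply: measurable_funM => //; exact: continuous_measurable_fun.
move=> a b; case: (leP a b) => ab; last first.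
  rewrite set_itv_ge; first exact: integrable_set0.
  by rewrite bnd_simp -ltNge.
have [M M0 HM] := continuous_bound ab cg.
apply: (@integrable_le _ _ _ mu _ _ (fun x => M * `|d x|)) => //.
- apply: measurable_funTS; apply: measurable_funM => //.
  exact: continuous_measurable_fun.
- by apply: integrableZ_real => //; have := integrable_norm (id a b).
- by move=> x ax; rewrite normrM ler_wpM2r//; exact: HM.
Qed.

(** By density: [d] is replaced by a continuous [k] at L^1 distance at most e on [a, b]. For [k] the
    rule is the fundamental theorem of calculus, and every error is at most a constant times e. *)
Lemma product_rule (al al' : R -> R) d c a b : locint d -> a <= b ->
  (forall x, is_derive x 1 al (al' x)) -> continuous al' ->
  al b * (c + primitive d b) - al a * (c + primitive d a) =
  \int[mu]_(t in `[a, b]) (al' t * (c + primitive d t) + al t * d t).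
Proof.
move=> ld ab dal cal'.
have cal := is_derive_continuous dal.
have [M M0 HM] := continuous_bound ab cal.
have [M' M'0 HM'] := continuous_bound ab cal'.
(* The three summands are the costs, per unit of e, of the boundary term [al b * (D b - E b)], of
   the integral of [al' * (D - E)] and of that of [al * (d - k)]. *)
apply: (@le_eps_eq _ _ (M + M' * (b - a) + M)).
  by rewrite !addr_ge0// mulr_ge0// subr_ge0.
move=> e e0.
have [k [ck Hk]] := continuous_approx a b ld e0.
have lk := continuous_locint ck.
pose D t := c + primitive d t.
pose E t := c + primitive d a + (primitive k t - primitive k a).
have dE x : is_derive x 1 E (k x).
  have := is_derive_primitive lk (ck x) => dk.
  have -> : k x = 0 + (k x - 0) by rewrite add0r subr0.
  by apply: is_deriveD; apply: is_deriveB.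
have cE := is_derive_continuous dE.
have cD : continuous D.
  by apply: contD; [exact: cont_cst|exact: continuous_primitive].
have DE t : t \in `[a, b] -> `|D t - E t| <= e.
  rewrite in_itv/= => /andP[at_ tb]; apply: le_trans Hk.
  have := primitive_dist_le ld lk at_ tb.
  by rewrite [X in `|X| <= _](_ : _ = D t - E t)// /D /E; ring.
have lDE : locint (fun t => al' t * (D t - E t)).
  by apply: continuous_locint; apply: contM => //; exact: contB.
have ldk := locint_mul_continuous cal (locintB ld lk).
have lD : locint (fun t => al' t * D t + al t * d t).
  apply: locintD; last exact: locint_mul_continuous.
  by apply: continuous_locint; exact: contM.
have cEk : continuous (fun t => al' t * E t + al t * k t).
  by apply: contD; exact: contM.
have HE : \int[mu]_(t in `[a, b]) (al' t * E t + al t * k t) =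
    al b * E b - al a * E a.
  apply: (@FTC2_continuous _ (fun t => al t * E t)) => // x.
  have dEx := dE x; have dalx := dal x.
  by apply: is_derive_eq; rewrite /GRing.scale/=; ring.
have HDE : \int[mu]_(t in `[a, b]) (al' t * D t + al t * d t) =
    (al b * E b - al a * E a) +
    \int[mu]_(t in `[a, b]) (al' t * (D t - E t)) +
    \int[mu]_(t in `[a, b]) (al t * (d t - k t)).
  have lEk := continuous_locint cEk; have lS := locintD lEk lDE.
  rewrite -HE -!RintegralD//;
    [|exact: lS.2|exact: ldk.2|exact: lEk.2|exact: lDE.2].
  by apply: eq_Rintegral => t _; ring.
rewrite -/(D a) -/(D b) HDE.
have -> : E a = D a by rewrite /E /D subrr addr0.
set I1 := \int[mu]_(t in _) _; set I2 := \int[mu]_(t in _) _.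
rewrite [X in `|X|](_ : _ = al b * (D b - E b) - (I1 + I2)); last first.
  by move: I1 I2 (D a) (D b) (E b) => *; ring.
rewrite mulrDl mulrDl -[leRHS]addrA.
apply: (le_trans (ler_normD _ _)); apply: lerD.
  rewrite normrM ler_pM//; first by apply: HM; rewrite in_itv/= ab lexx.
    by apply: DE; rewrite in_itv/= ab lexx.
rewrite normrN; apply: (le_trans (ler_normD _ _)); apply: lerD.
  apply: (le_trans (le_normr_Rintegral _ _)) => //; first exact: lDE.2.
  apply: (@le_trans _ _ (\int[mu]_(t in `[a, b]) (M' * e))).
    apply: le_Rintegral => //.
    - exact: (locint_norm lDE).2.
    - by have /continuous_locint[_] := @cst_continuous R R (M' * e); apply.
    - by move=> t tab; rewrite normrM ler_pM//; [exact: HM'|exact: DE].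
  by rewrite Rintegral_cst_itv// mulrAC.
apply: (le_trans (le_normr_Rintegral _ _)) => //; first exact: ldk.2.
apply: (@le_trans _ _ (\int[mu]_(t in `[a, b]) (M * `|d t - k t|))).
  apply: le_Rintegral => //.
  - exact: (locint_norm ldk).2.
  - exact: (locintZ M (locint_norm (locintB ld lk))).2.
  - by move=> t tab; rewrite normrM ler_wpM2r//; exact: HM.
rewrite RintegralZl//; last exact: (locint_norm (locintB ld lk)).2.
by rewrite ler_wpM2l.
Qed.

End one_dimensional_rules.

(** * Chain rule and positive part on the line *)

Section truncation_rule.
Context {R : realType}.
Notation mu := (@lebesgue_measure R).
Implicit Types (d U : R -> R) (a b c x : R).

Lemma locint_cst (k : R) : locint (fun _ : R => k).
Proof. by apply: continuous_locint; exact: cont_cst. Qed.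

Lemma primitive_lipschitz (ga : R -> R) (s t : R) : continuous ga ->
  (forall x, `|ga x| <= 1) -> `|primitive ga s - primitive ga t| <= `|s - t|.
Proof.
move=> cga ga1; wlog ts : s t / t <= s.
  by move=> H; case: (leP t s) => [/H//|/ltW/H]; rewrite distrC (distrC t).
have lga := continuous_locint cga.
rewrite primitiveB// [leRHS]ger0_norm ?subr_ge0//.
apply: (le_trans (le_normr_Rintegral _ _)) => //; first exact: lga.2.
apply: (@le_trans _ _ (\int[mu]_(t in `[t, s]) 1)).
  apply: le_Rintegral => //; first exact: (locint_norm lga).2.
  exact: (locint_cst 1).2.
by rewrite Rintegral_cst_itv// mul1r.
Qed.

(** The same density argument as for [product_rule]. The Lipschitz bound on [ga] turns uniform
    closeness of [D] and [E] into closeness of [ga (D t)] and [ga (E t)]. *)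
Lemma chain_rule (ga : R -> R) (L : R) d c a b : locint d -> a <= b ->
  (forall x, `|ga x| <= 1) -> 0 <= L ->
  (forall x y, `|ga x - ga y| <= L * `|x - y|) -> continuous ga ->
  primitive ga (c + primitive d b) - primitive ga (c + primitive d a) =
  \int[mu]_(t in `[a, b]) (ga (c + primitive d t) * d t).
Proof.
move=> ld ab ga1 L0 gaL cga.
have lga := continuous_locint cga.
pose N := \int[mu]_(t in `[a, b]) `|d t|.
have N0 : 0 <= N by apply: Rintegral_ge0.
(* The first 1 pays for the boundary term, since [primitive ga] is 1-Lipschitz; the second for
   [ga (E t) * (d t - k t)]; and [L * N] for [(ga (D t) - ga (E t)) * d t]. *)
apply: (@le_eps_eq _ _ _ (1 + (1 + L * N))).
  by rewrite !addr_ge0// mulr_ge0.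
move=> e e0.
have [k [ck Hk]] := continuous_approx a b ld e0.
have lk := continuous_locint ck.
pose D t := c + primitive d t.
pose E t := c + primitive d a + (primitive k t - primitive k a).
have dE x : is_derive x 1 E (k x).
  have := is_derive_primitive lk (ck x) => dk.
  have -> : k x = 0 + (k x - 0) by rewrite add0r subr0.
  by apply: is_deriveD; apply: is_deriveB.
have cE := is_derive_continuous dE.
have cD : continuous D.
  by apply: contD; [exact: cont_cst|exact: continuous_primitive].
have DE t : t \in `[a, b] -> `|D t - E t| <= e.
  rewrite in_itv/= => /andP[at_ tb]; apply: le_trans Hk.
  have := primitive_dist_le ld lk at_ tb.
  by rewrite [X in `|X| <= _](_ : _ = D t - E t)// /D /E; ring.
have cgaD : continuous (fun t => ga (D t)).
  by move=> x; apply: (continuous_comp (cD x)); exact: cga.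
have cgaE : continuous (fun t => ga (E t)).
  by move=> x; apply: (continuous_comp (cE x)); exact: cga.
have l1 := locint_mul_continuous cgaE (locintB ld lk).
have l2 : locint (fun t => (ga (D t) - ga (E t)) * d t).
  by apply: locint_mul_continuous => //; exact: contB.
have l3 := locint_mul_continuous cgaE lk.
have HE : \int[mu]_(t in `[a, b]) (ga (E t) * k t) =
    primitive ga (E b) - primitive ga (E a).
  apply: (@FTC2_continuous _ (fun t => primitive ga (E t))) => //.
    exact: contM.
  move=> x; have dg := is_derive_primitive lga (cga (E x)).
  have := @is_derive1_comp _ _ _ _ _ _ dg (dE x).
  by rewrite /GRing.scale/=.
have HDE : \int[mu]_(t in `[a, b]) (ga (D t) * d t) =
    (primitive ga (E b) - primitive ga (E a)) +
    \int[mu]_(t in `[a, b]) (ga (E t) * (d t - k t)) +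
    \int[mu]_(t in `[a, b]) ((ga (D t) - ga (E t)) * d t).
  rewrite -HE -!RintegralD//;
    [|exact: (locintD l3 l1).2|exact: l2.2|exact: l3.2|exact: l1.2].
  by apply: eq_Rintegral => t _; ring.
rewrite -/(D a) -/(D b) HDE.
have -> : E a = D a by rewrite /E /D subrr addr0.
set I1 := \int[mu]_(t in _) _; set I2 := \int[mu]_(t in _) _.
rewrite [X in `|X|](_ : _ = (primitive ga (D b) - primitive ga (E b)) - (I1 + I2));
  last by move: I1 I2 (primitive ga (D a)) (primitive ga (D b)) (primitive ga (E b)) => *; ring.
rewrite mulrDl; apply: (le_trans (ler_normD _ _)); apply: lerD.
  apply: (le_trans (primitive_lipschitz _ _ cga ga1)); rewrite mul1r.
  by apply: DE; rewrite in_itv/= ab lexx.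
rewrite normrN mulrDl; apply: (le_trans (ler_normD _ _)); apply: lerD.
  apply: (le_trans (le_normr_Rintegral _ _)) => //; first exact: l1.2.
  rewrite mul1r; apply: le_trans Hk; apply: le_Rintegral => //.
  - exact: (locint_norm l1).2.
  - exact: (locint_norm (locintB ld lk)).2.
  - by move=> t tab; rewrite normrM ler_piMl.
apply: (le_trans (le_normr_Rintegral _ _)) => //; first exact: l2.2.
apply: (@le_trans _ _ (\int[mu]_(t in `[a, b]) ((L * e) * `|d t|))).
  apply: le_Rintegral => //.
  - exact: (locint_norm l2).2.
  - exact: (locintZ _ (locint_norm ld)).2.
  - move=> t tab; rewrite normrM ler_wpM2r//.
    by apply: (le_trans (gaL _ _)); rewrite ler_wpM2l//; exact: DE.
rewrite RintegralZl//; last exact: (locint_norm ld).2.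
by rewrite -/N mulrAC.
Qed.

(** Lipschitz approximations of the Heaviside function that vanish at 0. Their limit is the
    indicator of s > 0 rather than of s >= 0, which is why the derivative of a positive part is 0
    wherever the function is. *)
Definition ramp (n : nat) (s : R) := Num.min (Num.max (n%:R * s) 0) 1.

Lemma ramp_ge0 n s : 0 <= ramp n s.
Proof. by rewrite /ramp le_min ler01 andbT le_max lexx orbT. Qed.

Lemma ramp_le1 n s : `|ramp n s| <= 1.
Proof. by rewrite ger0_norm ?ramp_ge0// /ramp ge_min lexx orbT. Qed.

Lemma ramp_lipschitz n s t : `|ramp n s - ramp n t| <= n%:R * `|s - t|.
Proof.
rewrite -[n%:R]ger0_norm// -normrM mulrBr /ramp.
move: (n%:R * s) (n%:R * t) => x y.
rewrite ler_norml /Num.min /Num.max.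
have := ler_norm (x - y); have := ler_norm (- (x - y)); rewrite normrN.
move: `|x - y| => z z1 z2.
by repeat case: ifPn; rewrite -?leNgt => *; apply/andP; split; lra.
Qed.

Lemma lipschitz_continuous (g : R -> R) (L : R) : 0 <= L ->
  (forall x y, `|g x - g y| <= L * `|x - y|) -> continuous g.
Proof.
move=> L0 gL x; apply/cvgrPdist_le => e e0.
have L1 : 0 < L + 1 by lra.
near=> y; apply: (le_trans (gL _ _)).
apply: (@le_trans _ _ ((L + 1) * `|x - y|)); first by rewrite ler_wpM2r//; lra.
rewrite mulrC -ler_pdivlMr//.
near: y; apply: cvgr_dist_le; first exact: cvg_id.
exact: divr_gt0.
Unshelve. all: by end_near. Qed.

Lemma ramp_continuous n : continuous (ramp n).
Proof. exact: lipschitz_continuous (ramp_lipschitz n). Qed.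

Lemma ramp_cvg s : ramp ^~ s @ \oo --> ((0 < s)%R%:R : R).
Proof.
case: (ltP 0 s) => s0; last first.
  apply: cvg_near_cst; apply: nearW => n.
  rewrite /ramp max_r; first by rewrite min_l.
  by rewrite mulr_ge0_le0.
apply: cvg_near_cst; near=> n.
rewrite /ramp min_r// le_max; apply/orP; left.
rewrite -ler_pdivrMr// mul1r ltW//.
near: n; exact: nbhs_infty_gtr.
Unshelve. all: by end_near. Qed.

Lemma primitive_heaviside s :
  primitive (fun t => (0 < t)%R%:R : R) s = Num.max s 0.
Proof.
have mh : measurable_fun setT (fun t : R => (0 < t)%R%:R : R).
  rewrite (_ : (fun _ => _) = fun t : R => if 0 < t then 1 else 0); last first.
    by apply/funext => t; case: ifPn.
  by apply: measurable_fun_ifT => //; exact: measurable_fun_ltr.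
rewrite /primitive; case: (leP 0 s) => s0.
  rewrite -[RHS]subr0 -[RHS]mul1r -Rintegral_cst_itv//.
  apply: ae_eq_Rintegral => //; first exact: measurable_funTS.
  have : mu.-negligible [set 0] by apply/negligibleP => //; exact: lebesgue_measure_set1.
  apply: negligibleS => t /= /not_implyP[ts].
  move: ts; rewrite in_itv/= => /andP[t0 _] h.
  apply/eqP; rewrite eq_le t0 andbT leNgt; apply/negP => t1.
  by apply: h; rewrite t1.
rewrite (@eq_Rintegral _ _ _ _ _ (fun=> 0)).
  by rewrite Rintegral_cst_itv ?(ltW s0)// mul0r oppr0.
by move=> t; rewrite inE/= in_itv/= => /andP[_ t0]; rewrite ltNge t0.
Qed.

(** [chain_rule] for [ramp n], then dominated convergence on both sides: the primitives of the ramps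
    tend to the positive part. *)
Lemma truncation_rule d c a b : locint d -> a <= b ->
  Num.max (c + primitive d b) 0 - Num.max (c + primitive d a) 0 =
  \int[mu]_(t in `[a, b]) (if 0 < c + primitive d t then d t else 0).
Proof.
move=> ld ab.
have H n := @chain_rule (ramp n) n%:R d c a b ld ab (ramp_le1 n) (ler0n R n)
  (ramp_lipschitz n) (@ramp_continuous n).
have cD : continuous (fun t => c + primitive d t).
  by apply: contD; [exact: cont_cst|exact: continuous_primitive].
have C1 s : primitive (ramp n) s @[n --> \oo] --> Num.max s 0.
  rewrite -primitive_heaviside /primitive; case: ifPn => _; [|apply: cvgN];
  apply: (@dominated_cvg_Rintegral _ _ _ _ _ _ _ (cst 1) _ _ _ _ _).2 => //.
  - by move=> n; apply: measurable_funTS; apply: continuous_measurable_fun; exact: ramp_continuous.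
  - by move=> x _; exact: ramp_cvg.
  - exact: (locint_cst 1).2.
  - by move=> n x _; exact: ramp_le1.
  - by move=> n; apply: measurable_funTS; apply: continuous_measurable_fun; exact: ramp_continuous.
  - by move=> x _; exact: ramp_cvg.
  - exact: (locint_cst 1).2.
  - by move=> n x _; exact: ramp_le1.
have [||||_ C2] := @dominated_cvg_Rintegral _ _ _ mu `[a, b]
    (fun n t => ramp n (c + primitive d t) * d t)
    (fun t => if 0 < c + primitive d t then d t else 0) (fun t => `|d t|)
    (measurable_itv _).
- move=> n; apply: measurable_funTS; apply: measurable_funM; last exact: ld.1.
  apply: continuous_measurable_fun => x.
  by apply: (continuous_comp (cD x)); exact: ramp_continuous.
- move=> x _.
  have := cvgM (@ramp_cvg (c + primitive d x)) (cvg_cst (d x)).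
  case: ifPn => _; rewrite ?mul1r ?mul0r => H'; [exact: H'|exact: H'].
- exact: (locint_norm ld).2.
- by move=> n x _; rewrite normrM ler_piMl// ramp_le1.
apply: (cvg_unique _ _ C2); first exact: Rhausdorff.
rewrite -(funext H).
by apply: cvgB; exact: C1.
Qed.

End truncation_rule.

(** * Affine changes of variable *)

Section affine.
Context {R : realType}.
Notation mu := (@lebesgue_measure R).
Variables (k t : R) (k0 : 0 < k).

Let aff : measurableTypeR R -> measurableTypeR R := fun x => k * x + t.

Lemma measurable_affine : measurable_fun setT (fun x : R => k * x + t).
Proof. by apply: measurable_funD => //; exact: measurable_funM. Qed.

(** By uniqueness of Lebesgue measure: [k] times the image measure gives every half-open interval
    its length. *)
Lemma lebesgue_affine (A : set (measurableTypeR R)) : measurable A ->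
  mu (aff @^-1` A) = ((k^-1)%:E * mu A)%E.
Proof.
move=> mA.
have maff : measurable_fun setT aff by exact: measurable_affine.
have [m Hm] : exists m : {measure set (measurableTypeR R) -> \bar R},
    forall B, m B = pushforward mu aff B.
  by eexists (pushforward mu aff).
suff : mscale (NngNum (ltW k0)) m A = mu A.
  rewrite /mscale Hm /pushforward/= => <-.
  by rewrite muleA -EFinM mulVf ?gt_eqF// mul1e.
apply/esym/lebesgue_measure_unique => //= _ [[a b]] _ <-.
rewrite /mscale Hm /pushforward/=.
have -> : aff @^-1` `]a, b]%classic = `](a - t) / k, (b - t) / k]%classic.
  apply/seteqP; split => x /=; rewrite !in_itv/= /aff ltr_pdivrMr// ler_pdivlMr//.
    by move=> /andP[h1 h2]; apply/andP; split; lra.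
  by move=> /andP[h1 h2]; apply/andP; split; lra.
rewrite !lebesgue_measure_itv/= !lte_fin ltr_pM2r ?invr_gt0// ltrD2r.
case: ifPn => _; last by rewrite mule0.
rewrite -!EFinB -EFinM; congr EFin; field.
by rewrite gt_eqF.
Unshelve. exact: maff. Qed.

Lemma ge0_integral_affine (F : R -> \bar R) :
  measurable_fun setT F -> (forall x, 0 <= F x)%E ->
  (\int[mu]_x F (k * x + t)%R = (k^-1)%:E * \int[mu]_x F x)%E.
Proof.
move=> mF F0.
have maff : measurable_fun setT aff by exact: measurable_affine.
have ki0 : 0 <= k^-1 by rewrite invr_ge0 ltW.
rewrite -(@ge0_integral_mscale _ _ _ mu _ measurableT (NngNum ki0))//.
rewrite -(@ge0_integral_pushforward _ _ _ _ _ _ maff mu setT)//.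
apply: eq_measure_integral => A mA _.
have := lebesgue_affine mA; rewrite /mscale /pushforward/= => H.
exact: H.
Qed.

Lemma ae_affine (P : R -> Prop) :
  {ae mu, forall x, P x} -> {ae mu, forall x, P (k * x + t)}.
Proof.
move=> [N [mN N0 PN]]; exists (aff @^-1` N); split.
- by rewrite -[X in measurable X]setTI; exact: measurable_affine.
- have := lebesgue_affine mN.
  by move=> ->; rewrite [X in (_ * X)%E]N0 mule0.
- by move=> x /= Px; apply: PN.
Qed.

Lemma integral_affine (f : R -> R) : mu.-integrable setT (EFin \o f) ->
  mu.-integrable setT (EFin \o (fun x => f (k * x + t))) /\
  \int[mu]_x (f (k * x + t)) = k^-1 * \int[mu]_x f x.
Proof.
move=> intf.
have mf := integrable_measurable intf.
have mfa : measurable_fun setT (fun x => f (k * x + t)).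
  by apply: measurableT_comp => //; exact: measurable_affine.
have ia : mu.-integrable setT (EFin \o (fun x => f (k * x + t))).
  apply/integrableP; split; first exact/measurable_EFinP.
  have := @ge0_integral_affine (fun x => `|f x|%:E).
  move=> /= ->//; last by apply/measurable_EFinP; exact: measurableT_comp.
  move/integrableP : intf => [_ H].
  by rewrite lte_mul_pinfty// ?lee_fin ?invr_ge0 ?ltW.
split => //.
have ipos := integrable_funrpos measurableT intf.
have ineg := integrable_funrneg measurableT intf.
have E (g : R -> R) : (forall x, 0 <= g x) -> mu.-integrable setT (EFin \o g) ->
    \int[mu]_x (g (k * x + t)) = k^-1 * \int[mu]_x g x.
  move=> g0 ig; rewrite /Rintegral (@ge0_integral_affine (fun x => (g x)%:E)).
  - by rewrite fineM//; exact: integrable_fin_num.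
  - by apply/measurable_EFinP; exact: integrable_measurable ig.
  - by move=> x; rewrite lee_fin.
have sp (g : R -> R) : mu.-integrable setT (EFin \o g) ->
    \int[mu]_x g x = \int[mu]_x (funrpos g x) - \int[mu]_x (funrneg g x).
  move=> ig; rewrite -RintegralB//; last 2 first.
  - exact: integrable_funrpos.
  - exact: integrable_funrneg.
  by apply: eq_Rintegral => x _; rewrite -[in LHS](funrposBneg g).
rewrite (sp _ ia) (sp _ intf) mulrBr -!E//.
Qed.

Lemma Rintegral_affine_itv (d : R -> R) (a b : R) : locint d ->
  mu.-integrable `[a, b] (EFin \o (fun x => d (k * x + t))) /\
  \int[mu]_(x in `[a, b]) (k * d (k * x + t)) =
  \int[mu]_(x in `[k * a + t, k * b + t]) d x.
Proof.
move=> ld.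
pose J := `[k * a + t, k * b + t]%classic.
pose e := d \_ J.
have ie : mu.-integrable setT (EFin \o e).
  rewrite /e -restrict_EFin -integrable_mkcond; first exact: ld.2.
  exact: measurable_itv.
have He : (fun x => e (k * x + t)) = (fun x => d (k * x + t)) \_ `[a, b].
  apply/funext => x; rewrite /e !patchE; congr (if _ then _ else _).
  by apply/idP/idP; rewrite /J !inE/= !in_itv/= !lerD2r !ler_pM2l.
have [i1 i2] := integral_affine ie.
have i3 : mu.-integrable `[a, b] (EFin \o (fun x => d (k * x + t))).
  by rewrite integrable_mkcond// restrict_EFin -He.
split => //.
rewrite RintegralZl// [in LHS]Rintegral_mkcond -He i2 mulrA divff ?gt_eqF// mul1r.
by rewrite [RHS]Rintegral_mkcond.
Qed.

End affine.

(** * Absolutely continuous representatives *)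

Section acl1.
Context {R : realType}.
Notation mu := (@lebesgue_measure R).
Implicit Types (d U V W e : R -> R) (a b c x : R).

(** [U] only has to agree almost everywhere with an absolutely continuous function of derivative
    [d], because the restrictions of a Sobolev function to lines are known only up to null sets. *)
Definition acl1 U d := [/\ measurable_fun setT U, locint d &
  exists c, {ae mu, forall x, U x = c + primitive d x}].

Lemma locint_ae e e' : measurable_fun setT e -> locint e' ->
  {ae mu, forall x, e x = e' x} -> locint e.
Proof.
move=> me [me' ie'] ee'; split => // a b.
apply/integrableP; split; first by apply/measurable_EFinP; exact: measurable_funTS.
have /integrableP[_] := ie' a b.
apply: le_lt_trans; rewrite le_eqVlt; apply/orP; left; apply/eqP.
apply: ae_eq_integral => //.
- by apply: measurableT_comp => //; apply/measurable_EFinP; exact: measurable_funTS.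
- by apply: measurableT_comp => //; apply/measurable_EFinP; exact: measurable_funTS.
- by apply: ae_sub ee' => x /= -> _.
Qed.

Lemma primitive_of_increments W e :
  (forall a b, a <= b -> W b - W a = \int[mu]_(t in `[a, b]) e t) ->
  forall x, W x = W 0 + primitive e x.
Proof.
move=> H x; rewrite /primitive; case: (leP 0 x) => x0.
  by rewrite -H// addrC subrK.
by rewrite -H ?(ltW x0)// opprB addrC subrK.
Qed.

Lemma acl1D U d V e : acl1 U d -> acl1 V e ->
  acl1 (fun x => U x + V x) (fun x => d x + e x).
Proof.
move=> [mU ld [c Hc]] [mV le [c' Hc']]; split.
- exact: measurable_funD.
- exact: locintD.
- exists (c + c'); apply: ae_sub2 Hc Hc' => x -> ->.
  by rewrite primitiveD// addrACA.
Qed.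

Lemma acl1Z k U d : acl1 U d -> acl1 (fun x => k * U x) (fun x => k * d x).
Proof.
move=> [mU ld [c Hc]]; split.
- exact: measurable_funM.
- exact: locintZ.
- by exists (k * c); apply: ae_sub Hc => x ->; rewrite primitiveZ// mulrDr.
Qed.

Lemma acl1_C1 (al al' : R -> R) : (forall x, is_derive x 1 al (al' x)) ->
  continuous al' -> acl1 al al'.
Proof.
move=> dal cal'; split.
- by apply: continuous_measurable_fun; exact: is_derive_continuous dal.
- exact: continuous_locint.
- exists (al 0); apply: aeW => x; apply: primitive_of_increments => a b ab.
  by rewrite (FTC2_continuous ab cal' dal).
Qed.

Lemma acl1_cst k : acl1 (fun=> k) (fun=> 0).
Proof. by apply: acl1_C1; exact: cont_cst. Qed.

Lemma acl1_posp U d : acl1 U d ->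
  acl1 (fun x => Num.max (U x) 0) (fun x => if 0 < U x then d x else 0).
Proof.
move=> [mU ld [c Hc]].
have mif V : measurable_fun setT V -> measurable_fun setT (fun x => if 0 < V x then d x else 0).
  move=> mV; apply: measurable_fun_ifT => //; last exact: ld.1.
  exact: measurable_fun_ltr.
have cD : measurable_fun setT (fun x => c + primitive d x).
  apply: measurable_funD => //; apply: continuous_measurable_fun.
  exact: continuous_primitive.
have ee : {ae mu, forall x, (if 0 < U x then d x else 0) =
    (if 0 < c + primitive d x then d x else 0)}.
  by apply: ae_sub Hc => x ->.
split.
- exact: measurable_maxr.
- apply: (locint_le_norm _ ld); first exact: mif.
  by move=> x; case: ifPn => // _; rewrite normr0.
- exists (Num.max c 0); apply: ae_sub Hc => x ->.
  rewrite (ae_eq_primitive _ _ ee)//; [|exact: mif|exact: mif].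
  have := @primitive_of_increments (fun x => Num.max (c + primitive d x) 0)
    (fun x => if 0 < c + primitive d x then d x else 0)
    (fun a b => truncation_rule c ld) x.
  by rewrite primitive0 addr0.
Qed.

Lemma acl1_mul (al al' : R -> R) U d : (forall x, is_derive x 1 al (al' x)) ->
  continuous al' -> acl1 U d ->
  acl1 (fun x => al x * U x) (fun x => al' x * U x + al x * d x).
Proof.
move=> dal cal' [mU ld [c Hc]].
have cal := is_derive_continuous dal.
have mal := continuous_measurable_fun cal.
have mal' := continuous_measurable_fun cal'.
have cD : continuous (fun x => c + primitive d x).
  by apply: contD; [exact: cont_cst|exact: continuous_primitive].
have me : measurable_fun setT (fun x => al' x * U x + al x * d x).
  by apply: measurable_funD; apply: measurable_funM => //; exact: ld.1.
have le' : locint (fun x => al' x * (c + primitive d x) + al x * d x).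
  apply: locintD; last exact: locint_mul_continuous.
  by apply: continuous_locint; exact: contM.
have ee : {ae mu, forall x, al' x * U x + al x * d x =
   al' x * (c + primitive d x) + al x * d x}.
  by apply: ae_sub Hc => x ->.
split.
- exact: measurable_funM.
- exact: locint_ae ee.
- exists (al 0 * c); apply: ae_sub Hc => x ->.
  rewrite (ae_eq_primitive me le'.1 ee).
  have := @primitive_of_increments (fun x => al x * (c + primitive d x)) _
    (fun a b ab => product_rule c ld ab dal cal') x.
  by rewrite primitive0 addr0.
Qed.

Lemma acl1_parts (al al' : R -> R) U d a b :
  (forall x, is_derive x 1 al (al' x)) -> continuous al' -> acl1 U d ->
  a <= b -> al a = 0 -> al b = 0 ->
  \int[mu]_(x in `[a, b]) (al' x * U x + al x * d x) = 0.
Proof.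
move=> dal cal' [mU ld [c Hc]] ab ala alb.
transitivity (\int[mu]_(x in `[a, b]) (al' x * (c + primitive d x) + al x * d x));
  last by rewrite -product_rule// ala alb !mul0r subrr.
apply: ae_eq_Rintegral => //.
- have cal := is_derive_continuous dal.
  have mal := continuous_measurable_fun cal.
  have mal' := continuous_measurable_fun cal'.
  apply: measurable_funTS.
  by apply: measurable_funD; apply: measurable_funM => //; exact: ld.1.
- have cal := is_derive_continuous dal.
  have mal := continuous_measurable_fun cal.
  have mal' := continuous_measurable_fun cal'.
  apply: measurable_funTS.
  apply: measurable_funD; apply: measurable_funM => //; last exact: ld.1.
  apply: measurable_funD => //; apply: continuous_measurable_fun.
  exact: continuous_primitive.
- by apply: ae_sub Hc => x ->.
Qed.

Lemma acl1_affine k t U d : 0 < k -> acl1 U d ->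
  acl1 (fun x => U (k * x + t)) (fun x => k * d (k * x + t)).
Proof.
move=> k0 [mU ld [c Hc]].
have mk := measurable_affine k t.
split.
- exact: measurableT_comp.
- split.
    by apply: measurable_funM => //; apply: measurableT_comp => //; exact: ld.1.
  by move=> a b; apply: integrableZ_real => //; have [] := Rintegral_affine_itv t k0 a b ld.
- exists (c + primitive d t).
  apply: ae_sub (ae_affine t k0 Hc) => x ->.
  rewrite -addrA; congr (_ + _).
  have := @primitive_of_increments (fun x => primitive d (k * x + t))
    (fun x => k * d (k * x + t)) _ x.
  rewrite mulr0 add0r; apply => a b ab.
  have [_ ->] := Rintegral_affine_itv t k0 a b ld.
  by rewrite primitiveB// lerD2r ler_pM2l.
Qed.

Lemma ae_eq_continuous (g h : R -> R) : continuous g -> continuous h ->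
  {ae mu, forall x, g x = h x} -> g =1 h.
Proof.
move=> cg ch [N [mN N0 gN]] x; apply/eqP/negP => /negP gx.
have : nbhs x [set y | g y - h y != 0].
  have gh0 : 0 < `|g x - h x| by rewrite normr_gt0 subr_eq0.
  have C : (fun y => g y - h y) @ x --> g x - h x by exact: (cvgB (cg x) (ch x)).
  move/cvgrPdist_lt : C => /(_ _ gh0); apply: filterS => y /= H; apply/negP => /eqP gh.
  by move: H; rewrite gh subr0 ltxx.
move=> /nbhs_ballP[e e0 He].
have : (mu (ball x e) <= mu N)%E.
  apply: le_measure; rewrite ?inE//; first exact: measurable_ball.
  move=> y /He /= h0; apply: gN => /= gh; move: h0.
  by rewrite gh subrr eqxx.
rewrite [X in (_ <= X)%E]N0 => H.
have : (0%:E < mu (ball x e))%E.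
  by rewrite lebesgue_measure_ball ?ltW// lte_fin mulrn_wgt0.
by rewrite ltNge H.
Qed.

Lemma acl1_unique U d d' : acl1 U d -> acl1 U d' -> {ae mu, forall x, d x = d' x}.
Proof.
move=> [mU ld [c Hc]] [_ ld' [c' Hc']].
have H : (fun x => c + primitive d x) =1 (fun x => c' + primitive d' x).
  apply: ae_eq_continuous.
  - by apply: contD; [exact: cont_cst|exact: continuous_primitive].
  - by apply: contD; [exact: cont_cst|exact: continuous_primitive].
  - by apply: ae_sub2 Hc Hc' => x <- <-.
apply: eq_primitive_ae => // x.
have := H 0; rewrite !primitive0 !addr0 => cc.
by have := H x; rewrite cc => /addrI.
Qed.

(** The continuous representative oscillates by at most S, the integral of |d|. If its modulus
    exceeded S at one point, it would stay above some [de] > 0 on the whole line, against square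
    integrability. *)
Lemma acl1_bound U d : acl1 U d -> (\int[mu]_x (U x ^+ 2)%:E < +oo)%E ->
  {ae mu, forall x, (`|U x|%:E <= \int[mu]_s `|d s|%:E)%E}.
Proof.
move=> [mU ld [c Hc]] U2.
have md : measurable_fun setT (fun s => `|d s|%:E).
  by apply/measurable_EFinP; exact: measurableT_comp ld.1.
have I0 : (0 <= \int[mu]_s `|d s|%:E)%E by apply: integral_ge0.
case: (leP +oo%E (\int[mu]_s `|d s|%:E)%E) => [|dfin].
  by rewrite leye_eq => /eqP ->; apply: aeW => x; rewrite leey.
pose S := fine (\int[mu]_s `|d s|%:E)%E.
have ES : (\int[mu]_s `|d s|%:E)%E = S%:E by rewrite fineK// ge0_fin_numE.
have lS a b : a <= b -> `|primitive d b - primitive d a| <= S.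
  move=> ab; rewrite primitiveB//.
  apply: (le_trans (le_normr_Rintegral _ _)) => //; first exact: ld.2.
  rewrite -lee_fin -EFin_Rintegral//; last exact: (locint_norm ld).2.
  by rewrite -ES; apply: ge0_subset_integral.
have lS' a b : `|primitive d b - primitive d a| <= S.
  by case: (leP a b) => [/lS//|/ltW /lS]; rewrite distrC.
have key x : `|c + primitive d x| <= S.
  rewrite leNgt; apply/negP => Sx.
  pose de := `|c + primitive d x| - S.
  have de0 : 0 < de by rewrite subr_gt0.
  have Hde y : de <= `|c + primitive d y|.
    rewrite lerBlDr; have := lS' y x.
    have -> : primitive d x - primitive d y = (c + primitive d x) - (c + primitive d y) by ring.
    move=> H; have := ler_normD (c + primitive d y) ((c + primitive d x) - (c + primitive d y)).
    rewrite addrC subrK => /le_trans; apply; exact: lerD.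
  have : (\int[mu]_x (de ^+ 2)%:E <= \int[mu]_x (U x ^+ 2)%:E)%E.
    apply: ae_ge0_le_integral => //.
    - by move=> y _; rewrite lee_fin sqr_ge0.
    - by move=> y _; rewrite lee_fin sqr_ge0.
    - by apply/measurable_EFinP; exact: measurable_funX.
    - apply: ae_sub Hc => y -> _; rewrite lee_fin.
      by rewrite -[leRHS]real_normK ?num_real// lerXn2r// nnegrE// ltW.
  rewrite integral_cst//.
  have T : mu setT = +oo%E by rewrite -set_itvNyy lebesgue_measure_itv.
  rewrite [X in (_ * X)%E]T muleC gt0_mulye ?lte_fin ?exprn_gt0//.
  by rewrite leNgt U2.
by apply: ae_sub Hc => x ->; rewrite ES lee_fin.
Qed.

End acl1.

(** * Smooth bumps on the line *)

Section smooth_functions.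
Context {R : realType}.
Notation mu := (@lebesgue_measure R).

(** The classical flat function exp(-1/x), with the powers x^-k that its derivatives produce, so
    that linear combinations of the family are closed under differentiation. *)
Definition flat (k : nat) (x : R) : R :=
  if 0 < x then x^-1 ^+ k * expR (- x^-1) else 0.

Lemma flat_ge0 k x : 0 <= flat k x.
Proof.
rewrite /flat; case: ifPn => // x0.
by rewrite mulr_ge0 ?expR_ge0// exprn_ge0// invr_ge0 ltW.
Qed.

Lemma flat_gt0 k x : 0 < x -> 0 < flat k x.
Proof.
by move=> x0; rewrite /flat x0 mulr_gt0 ?expR_gt0// exprn_gt0// invr_gt0.
Qed.

Lemma flat_le0 k x : x <= 0 -> flat k x = 0.
Proof. by rewrite leNgt /flat => /negbTE ->. Qed.

(** With t = 1/x: t <= (k+1) exp(t / (k+1)), and the (k+1)-st power of this inequality gives t^k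
    exp(-t) <= (k+1)^(k+1) / t. *)
Lemma flat_bound k x : `|flat k x| <= (k.+1%:R ^+ k.+1) * `|x|.
Proof.
rewrite ger0_norm ?flat_ge0// /flat; case: ifPn => x0; last first.
  by rewrite mulr_ge0// exprn_ge0.
rewrite gtr0_norm// expRN ler_pdivrMr ?expR_gt0//.
pose t := x^-1; rewrite -/t.
have t0 : 0 < t by rewrite invr_gt0.
have -> : x = t^-1 by rewrite invrK.
have kS : 0 < k.+1%:R :> R by rewrite ltr0n.
have H : t ^+ k.+1 <= k.+1%:R ^+ k.+1 * expR t.
  have -> : expR t = expR (t / k.+1%:R) ^+ k.+1.
    by rewrite -expRM_natl mulrC divfK// gt_eqF.
  rewrite -exprMn; apply: lerXn2r; rewrite ?nnegrE; [exact: ltW| |].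
    by rewrite mulr_ge0// expR_ge0.
    apply: (@le_trans _ _ (k.+1%:R * (1 + t / k.+1%:R))).
    by rewrite mulrDr mulrCA divff ?gt_eqF// !mulr1 lerDr ltW.
  by rewrite ler_pM2l// expR_ge1Dx.
by rewrite mulrAC ler_pdivlMr// -exprSr.
Qed.

Lemma flat_cvg0 k : flat k x @[x --> 0] --> (0 : R).
Proof.
have K0 : 0 < (k.+1%:R ^+ k.+1 : R) by rewrite exprn_gt0// ltr0n.
apply/cvgrPdist_le => e e0; near=> x.
rewrite sub0r normrN; apply: (le_trans (flat_bound _ _)).
rewrite mulrC -ler_pdivlMr//.
near: x; have d0 : 0 < e / (k.+1%:R ^+ k.+1) by exact: divr_gt0.
apply: filterS (nbhsx_ballx (0 : R) _ d0) => x.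
by rewrite /ball/= sub0r normrN => /ltW.
Unshelve. all: by end_near. Qed.

Lemma is_derive_flat k (x : R) :
  is_derive x 1 (flat k) (- k%:R * flat k.+1 x + flat k.+2 x).
Proof.
case: (ltgtP 0 x) => x0.
- apply: (@near_eq_is_derive _ _ _ (fun y : R => y^-1 ^+ k * expR (- y^-1))).
    apply: filterS (nbhsx_ballx x _ x0) => y.
    rewrite /ball/= => H; rewrite /flat.
    have -> // : 0 < y by move: H; rewrite ltr_norml => /andP[_]; lra.
  have xn : x != 0 by rewrite gt_eqF.
  have dV := @is_deriveV _ _ _ _ _ xn (is_derive_id x 1).
  rewrite /flat x0.
  have dX := @is_deriveX _ _ _ k _ _ _ dV.
  have dE := @is_derive1_comp _ expR (fun y : R => - y^-1) x _ _ (is_derive_expR _) (is_deriveN dV).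
  have M := is_deriveM dX dE.
  have fE : (fun y : R => y^-1 ^+ k * expR (- y^-1)) =
      ([eta GRing.inv] : R -> R) ^+ k * (expR \o (fun y : R => - y^-1)).
    by apply/funext => y; rewrite !fctE.
  rewrite fE; apply: (is_derive_eq M).
  rewrite !fctE /GRing.scale/=.
  case: k {dX M fE} => [|k]; first by rewrite mulr0n oppr0 !mul0r expr0 !add0r; field.
  rewrite -!exprVn; move: (x^-1) (expR _) => t E.
  by rewrite /= !exprS; move: (t ^+ k) => z; ring.
- apply: (@near_eq_is_derive _ _ _ (cst 0)).
    have nx : 0 < - x by lra.
    apply: filterS (nbhsx_ballx x _ nx) => y.
    rewrite /ball/= => H; rewrite flat_le0//.
    by move: H; rewrite ltr_norml => /andP[+ _]; lra.
  rewrite !flat_le0 ?ltW// mulr0 addr0; exact: is_derive_cst.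
- rewrite -x0 !(@flat_le0 _ 0)// mulr0 addr0.
  (* At 0 the difference quotient of [flat k] is [flat k.+1] itself, which tends to 0. *)
  have H : (fun h : R => h^-1 *: (flat k (h *: 1 + 0) - flat k 0)) @ 0^' --> (0 : R).
    apply: (@cvg_trans _ (flat k.+1 @ 0^')); last first.
      by apply: cvg_trans (@flat_cvg0 k.+1); apply: cvg_app; exact: nbhs_dnbhs.
    apply: near_eq_cvg; near=> h.
    rewrite (@flat_le0 _ 0)// subr0 addr0 /GRing.scale/= mulr1 /flat.
    by case: ifPn => _; rewrite ?mulr0// exprS mulrA.
  apply: DeriveDef; first by apply/cvg_ex; exists 0.
  exact: cvg_lim H.
Unshelve. all: by end_near. Qed.

(* Closed under differentiation, and under taking antiderivatives, so that the
   mean-zero test functions below have smooth primitives. *)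
Inductive smooth1 : (R -> R) -> Prop :=
| smooth1_flat k a t : smooth1 (fun x => flat k (a * x + t))
| smooth1D g h : smooth1 g -> smooth1 h -> smooth1 (fun x => g x + h x)
| smooth1M g h : smooth1 g -> smooth1 h -> smooth1 (fun x => g x * h x)
| smooth1Z (c : R) g : smooth1 g -> smooth1 (fun x => c * g x)
| smooth1_anti (A g : R -> R) : (forall x : R, is_derive x 1 A (g x)) -> smooth1 g -> smooth1 A.

Lemma smooth1_derive (g : R -> R) : smooth1 g ->
  exists2 g' : R -> R, smooth1 g' & forall x : R, is_derive x 1 g (g' x).
Proof.
elim => {g}.
- move=> k a t; exists (fun x => a * (- k%:R * flat k.+1 (a * x + t) + flat k.+2 (a * x + t))).
    apply/smooth1Z/smooth1D; last exact: smooth1_flat.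
    exact/smooth1Z/smooth1_flat.
  move=> x.
  have da : is_derive x 1 (fun x : R => a * x + t) a.
    by apply: is_derive_eq; rewrite /GRing.scale/= mulr1 addr0.
  have := @is_derive1_comp _ (flat k) (fun x => a * x + t) x _ _ (is_derive_flat k (a * x + t)) da.
  by rewrite mulrC.
- move=> g h _ [g' sg' dg] _ [h' sh' dh]; exists (fun x => g' x + h' x).
    exact: smooth1D.
  by move=> x; apply: is_deriveD.
- move=> g h sg [g' sg' dg] sh [h' sh' dh]; exists (fun x => g x * h' x + h x * g' x).
    by apply: smooth1D; exact: smooth1M.
  by move=> x; apply: is_deriveM.
- move=> c g _ [g' sg' dg]; exists (fun x => c * g' x); first exact: smooth1Z.
  by move=> x; apply: is_deriveZ.
- by move=> A g dA sg _; exists g.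
Qed.

Lemma smooth1_continuous g : smooth1 g -> continuous g.
Proof. by move=> /smooth1_derive[g' _ dg]; exact: is_derive_continuous dg. Qed.

(** The dilation factor [n.+1] steepens both flanks, so that the bumps tend to the indicator of the
    open interval. *)
Definition cbump (n : nat) (a b x : R) :=
  flat 0 (n.+1%:R * (x - a)) * flat 0 (n.+1%:R * (b - x)).

Lemma smooth1_cbump n a b : smooth1 (cbump n a b).
Proof.
rewrite (_ : cbump n a b = fun x => flat 0 (n.+1%:R * x + - (n.+1%:R * a)) *
    flat 0 (- n.+1%:R * x + n.+1%:R * b)).
  by apply: smooth1M; exact: smooth1_flat.
by apply/funext => x; rewrite /cbump; congr (flat _ _ * flat _ _); ring.
Qed.

Lemma flat0_le1 x : flat 0 x <= 1.
Proof.
rewrite /flat; case: ifPn => // x0.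
by rewrite expr0 mul1r expR_le1 oppr_le0 invr_ge0 ltW.
Qed.

Lemma cbump_ge0 n a b x : 0 <= cbump n a b x.
Proof. by rewrite mulr_ge0// flat_ge0. Qed.

Lemma cbump_le1 n a b x : cbump n a b x <= 1.
Proof. by rewrite /cbump mulr_ile1 ?flat_ge0 ?flat0_le1. Qed.

Lemma cbump_gt0 n a b x : a < x < b -> 0 < cbump n a b x.
Proof.
move=> /andP[ax xb]; rewrite /cbump.
by apply: mulr_gt0; apply: flat_gt0; rewrite mulr_gt0 ?ltr0n// subr_gt0.
Qed.

Lemma cbump_out n a b x : ~~ (a < x < b) -> cbump n a b x = 0.
Proof.
rewrite negb_and -!leNgt => /orP[] h; rewrite /cbump.
  by rewrite flat_le0 ?mul0r// pmulr_rle0 ?ltr0n// subr_le0.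
by rewrite mulrC flat_le0 ?mul0r// pmulr_rle0 ?ltr0n// subr_le0.
Qed.

Lemma flat0_cvg (x : R) : 0 < x -> flat 0 (n.+1%:R * x) @[n --> \oo] --> (1 : R).
Proof.
move=> x0.
have H : expR (- (n.+1%:R^-1 * x^-1)) @[n --> \oo] --> (1 : R).
  rewrite -[X in _ --> X]expR0; apply: (@continuous_cvg _ _ _ _ _ _ expR).
    exact: continuous_expR.
  rewrite -oppr0; apply: cvgN; rewrite -(mul0r x^-1).
  by apply: cvgM; [exact: cvg_harmonic|exact: cvg_cst].
apply: cvg_trans H; apply: near_eq_cvg; apply: nearW => n.
by rewrite /flat pmulr_rgt0 ?ltr0n// x0 expr0 mul1r invfM.
Qed.

Lemma cbump_cvg a b x : cbump n a b x @[n --> \oo] --> ((a < x < b)%R%:R : R).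
Proof.
case: (boolP (a < x < b)) => [/andP[ax xb]|xab].
  rewrite -[X in _ --> X]mulr1; apply: cvgM; apply: flat0_cvg; rewrite subr_gt0//.
by apply: cvg_near_cst; apply: nearW => n; exact: cbump_out.
Qed.

End smooth_functions.

(** * Fundamental lemma of the calculus of variations, Fubini, tensor test functions *)

Section fundamental_lemma.
Context {R : realType}.
Notation mu := (@lebesgue_measure R).

Lemma Rintegral_support d (T : measurableType d) (m : {measure set T -> \bar R})
    (D : set T) (f : T -> R) : (forall x, ~ D x -> f x = 0) ->
  \int[m]_(x in D) f x = \int[m]_x f x.
Proof.
move=> H; rewrite Rintegral_mkcond; apply: eq_Rintegral => x _.
by rewrite patchE; case: ifPn => //; rewrite notin_setE => /H.
Qed.

Lemma integrable_support d (T : measurableType d) (m : {measure set T -> \bar R})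
    (D : set T) (f : T -> R) : measurable D -> (forall x, ~ D x -> f x = 0) ->
  m.-integrable D (EFin \o f) -> m.-integrable setT (EFin \o f).
Proof.
move=> mD H; rewrite integrable_mkcond// restrict_EFin.
rewrite (_ : f \_ D = f)//; apply/funext => x.
by rewrite patchE; case: ifPn => //; rewrite notin_setE => /H.
Qed.

Lemma locint_cs (v k : R -> R) (N : R) : locint v -> continuous k ->
  (forall x, N < `|x| -> k x = 0) ->
  mu.-integrable setT (EFin \o (fun x => v x * k x)) /\
  \int[mu]_(x in `[- N, N]) (v x * k x) = \int[mu]_x (v x * k x).
Proof.
move=> lv ck kN.
have H x : ~ `[- N, N]%classic x -> v x * k x = 0.
  move=> /negP; rewrite /= in_itv/= -ler_norml -ltNge => /kN ->.
  by rewrite mulr0.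
split; last exact: Rintegral_support.
apply: (@integrable_support _ _ mu `[- N, N] (fun x => v x * k x)) => //.
have := (locint_mul_continuous ck lv).2 (- N) N.
by apply: eq_integrable => // x _; rewrite /= mulrC.
Qed.

Lemma ae_neq (a : R) : {ae mu, forall x, x <> a}.
Proof.
have : mu.-negligible [set a] by apply/negligibleP => //; exact: lebesgue_measure_set1.
by apply: negligibleS => x /= /contrapT.
Qed.

Lemma integral_cbump_eq0 (E : R -> R) (a b : R) : locint E -> a <= b ->
  (forall n, \int[mu]_x (E x * cbump n a b x) = 0) ->
  \int[mu]_(x in `[a, b]) E x = 0.
Proof.
move=> lE ab H.
have S n : \int[mu]_(x in `[a, b]) (E x * cbump n a b x) = 0.
  rewrite Rintegral_support// => x /negP; rewrite /= in_itv/= => xab.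
  rewrite cbump_out ?mulr0//; apply: contra xab => /andP[h1 h2].
  by rewrite !ltW.
have [||||_ C] := @dominated_cvg_Rintegral _ _ _ mu `[a, b]
    (fun n x => E x * cbump n a b x) (fun x => E x * (a < x < b)%R%:R)
    (fun x => `|E x|) (measurable_itv _).
- move=> n; apply: measurable_funTS; apply: measurable_funM; first exact: lE.1.
  apply: continuous_measurable_fun; apply: smooth1_continuous; exact: smooth1_cbump.
- by move=> x _; apply: cvgM; [exact: cvg_cst|exact: cbump_cvg].
- exact: (locint_norm lE).2.
- move=> n x _; rewrite normrM ler_piMr//.
  by rewrite ger0_norm ?cbump_ge0// cbump_le1.
have -> : \int[mu]_(x in `[a, b]) E x = \int[mu]_(x in `[a, b]) (E x * (a < x < b)%R%:R).
  apply: ae_eq_Rintegral => //.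
  - by apply: measurable_funTS; exact: lE.1.
  - apply: measurable_funM; first by apply: measurable_funTS; exact: lE.1.
    apply: measurable_funTS.
    rewrite (_ : (fun x : R => _) = fun x : R => if (a < x) && (x < b) then 1 else 0); last first.
      by apply/funext => t; case: ifPn.
    apply: measurable_fun_ifT => //.
    by apply: measurable_and; exact: measurable_fun_ltr.
  - apply: ae_sub2 (ae_neq a) (ae_neq b) => x xa xb /=.
    rewrite in_itv/= !lt_neqAle => /andP[-> ->].
    by rewrite !andbT (eq_sym a); move/eqP : xa => ->; move/eqP : xb => ->; rewrite mulr1.
apply: (cvg_unique _ C); first exact: Rhausdorff.
by rewrite (funext S); exact: cvg_cst.
Qed.

(** The family of test functions is countable, so that on lines one null set serves for all of them.
    In the limit n -> oo the hypothesis says that the primitive of [E] takes equal values at all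
    rationals; being continuous, it vanishes, and its derivative [E] vanishes almost everywhere. *)
Lemma fundamental_lemma1 (E : R -> R) : locint E ->
  (forall n (p q : rat), \int[mu]_x (E x * cbump n (ratr p) (ratr q) x) = 0) ->
  {ae mu, forall x, E x = 0}.
Proof.
move=> lE H.
have H0 (p q : rat) : ratr p <= ratr q :> R -> primitive E (ratr p) = primitive E (ratr q).
  move=> pq; apply/esym/eqP; rewrite -subr_eq0 primitiveB//.
  by rewrite integral_cbump_eq0.
have H1 (q : rat) : primitive E (ratr q) = 0.
  have h0 : ratr 0 = 0 :> R by rewrite rmorph0.
  rewrite -(primitive0 E) -h0.
  by case: (leP (ratr 0 : R) (ratr q)) => [/H0//|/ltW/H0].
have H2 x : primitive E x = 0.
  apply/eqP/negP => /negP Ex.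
  have e0 : 0 < `|primitive E x| by rewrite normr_gt0.
  have cE : primitive E @ x --> primitive E x by exact: continuous_primitive.
  move/cvgrPdist_lt : cE => /(_ _ e0) /nbhs_ballP[e /= epos He].
  have xe : x < x + e by rewrite ltrDl.
  have [q] := rat_in_itvoo xe; rewrite in_itv/= => /andP[q1 q2].
  have : `|primitive E x - primitive E (ratr q)| < `|primitive E x|.
    by apply: He; rewrite /ball/= ltr_norml; apply/andP; split; lra.
  by rewrite H1 subr0 ltxx.
have l0 := locint_cst (0 : R).
apply: (@eq_primitive_ae _ _ (fun=> 0)) => // x; rewrite H2.
have := primitiveZ 0 x l0; rewrite [RHS]mul0r => {1}<-.
by apply: ae_eq_primitive => //; apply: aeW => y; rewrite mulr0.
Qed.

Notation leb2 := (@leb2 R).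

Lemma Rfubini (w : R * R -> R) : leb2.-integrable setT (EFin \o w) ->
  [/\ {ae mu, forall y, mu.-integrable setT (EFin \o (fun x => w (x, y)))},
     mu.-integrable setT (EFin \o (fun y => \int[mu]_x w (x, y))) &
     \int[leb2]_z w z = \int[mu]_y (\int[mu]_x w (x, y))].
Proof.
move=> iw.
have mw : measurable_fun setT (EFin \o w) := measurable_int _ iw.
have ae1 := ae_integrable2 iw.
have mG := measurable_fubini_G iw.
have mG' : measurable_fun setT (fun y => \int[mu]_x w (x, y)).
  exact: (measurableT_comp (@fine_measurable R setT measurableT) mG).
have e21 := integral21_prod_meas1 iw.
have eG : {ae mu, forall y, fubini_G mu (EFin \o w) y = (\int[mu]_x w (x, y))%:E}.
  by apply: ae_sub ae1 => y iy; rewrite /fubini_G -EFin_Rintegral.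
split => //.
- apply/integrableP; split; first exact/measurable_EFinP.
  apply: (@le_lt_trans _ _ (\int[mu]_y \int[mu]_x `|(EFin \o w) (x, y)|)%E).
    apply: ge0_le_integral => //.
    + by apply/measurable_EFinP; apply: measurableT_comp.
    + have maw : measurable_fun setT (abse \o (EFin \o w)) by exact: measurableT_comp.
      exact: (measurable_fun_fubini_tonelli_G (m1 := mu) _ maw (fun _ => abse_ge0 _)).
    + move=> y _; rewrite /=.
      have ms : measurable_fun setT (fun x => (w (x, y))%:E).
        exact: (measurableT_comp mw (pair2_measurable y)).
      apply: (le_trans _ (le_abse_integral mu measurableT ms)).
      rewrite /Rintegral; case: (\int[mu]_x (w (x, y))%:E)%E => //=.
        by rewrite normr0 leey.
      by rewrite normr0 leey.
  exact: (integrable21ltyP mu mu mw).1 iw.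
- rewrite /Rintegral -[X in fine X = _]e21; congr fine.
  apply: ae_eq_integral => //; first exact/measurable_EFinP.
  by apply: ae_sub eG => y H _; exact: H.
Qed.

Lemma continuous_tensor (a b : R -> R) : continuous a -> continuous b ->
  continuous (fun z : R * R => a z.1 * b z.2).
Proof.
move=> ca cb; apply: contM => z.
  by apply: (@continuous_comp _ _ _ fst a); [exact: cvg_fst|exact: ca].
by apply: (@continuous_comp _ _ _ snd b); [exact: cvg_snd|exact: cb].
Qed.

(** Every iterated partial derivative of a tensor product is again a tensor product of [smooth1]
    functions. *)
Lemma tensor_test (al be : R -> R) (N : R) : smooth1 al -> smooth1 be ->
  (forall x, N < `|x| -> al x = 0) -> (forall x, N < `|x| -> be x = 0) ->
  test_fun (fun z : R * R => al z.1 * be z.2).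
Proof.
move=> sal sbe alN beN; split.
- move=> s.
  have [g sg [h sh ->]] : exists2 g, smooth1 g & exists2 h, smooth1 h &
      iter_partial s (fun z : R * R => al z.1 * be z.2) = (fun z : R * R => g z.1 * h z.2).
    elim: s => [|i s [g sg [h sh e]]]; first by exists al => //; exists be.
    rewrite /= e; have [g' sg' dg] := smooth1_derive sg.
    have [h' sh' dh] := smooth1_derive sh.
    case: i; [exists g => //; exists h' => //|exists g' => //; exists h => //].
      apply/funext => z; rewrite /partial derive1E.
      have := is_deriveZ (g z.1) (dh z.2) => H.
      by rewrite (@derive_val _ _ _ _ _ _ _ H).
    apply/funext => z; rewrite /partial derive1E.
    have := is_deriveZ (h z.2) (dg z.1) => H.
    rewrite (_ : (fun t => _) = h z.2 \*: g); last by apply/funext => t /=; rewrite mulrC.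
    by rewrite (@derive_val _ _ _ _ _ _ _ H) mulrC.
  have cg := smooth1_continuous sg; have ch := smooth1_continuous sh.
  split; first exact: continuous_tensor.
  have [g' sg' dg] := smooth1_derive sg.
  have [h' sh' dh] := smooth1_derive sh.
  move=> [] z; rewrite /partial_exists.
    by have [] := is_deriveZ (g z.1) (dh z.2).
  rewrite (_ : (fun t => _) = h z.2 \*: g); last by apply/funext => t /=; rewrite mulrC.
  by have [] := is_deriveZ (h z.2) (dg z.1).
- pose B := `[- N, N]%classic : set R.
  have cB : compact B by exact: segment_compact.
  have clB : closed B by exact: interval_closed.
  apply: (@subclosed_compact _ _ (B `*` B)).
  + exact: closed_closure.
  + exact: compact_setX.
  + have clBB : closed (B `*` B).
      rewrite (_ : B `*` B = (fst @^-1` B) `&` (snd @^-1` B))//.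
      apply: closedI; apply: closed_comp => // z _; [exact: cvg_fst|exact: cvg_snd].
    rewrite [X in _ `<=` X](closure_id _).1//; apply: closureS => z /= z0.
    have : ~~ ((N < `|z.1|) || (N < `|z.2|)).
      apply: contra z0 => /orP[/alN ->|/beN ->]; by rewrite ?mul0r ?mulr0.
    by rewrite negb_or -!leNgt => /andP[h1 h2]; split; rewrite /B /= in_itv/= -ler_norml.
Qed.

End fundamental_lemma.

(** * Weak derivatives and lines *)

Section weak_to_acl.
Context {R : realType}.
Notation mu := (@lebesgue_measure R).
Notation leb2 := (@leb2 R).
Implicit Types (u g : R * R -> R).

Definition box (N : R) : set (R * R) := `[- N, N]%classic `*` `[- N, N]%classic.

Lemma measurable_box N : measurable (box N).
Proof. exact: measurableX. Qed.

Definition locint2 u :=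
  measurable_fun setT u /\ forall N : R, leb2.-integrable (box N) (EFin \o u).

Lemma measurable_line u (y : R) : measurable_fun setT u ->
  measurable_fun setT (fun x => u (x, y)).
Proof. by move=> mu'; exact: (measurableT_comp mu' (pair2_measurable y)). Qed.

Lemma measurable_fst_comp (al : R -> R) : measurable_fun setT al ->
  measurable_fun setT (fun z : R * R => al z.1).
Proof. by move=> mal; exact: (measurableT_comp mal measurable_fst). Qed.

Lemma measurable_snd_comp (al : R -> R) : measurable_fun setT al ->
  measurable_fun setT (fun z : R * R => al z.2).
Proof. by move=> mal; exact: (measurableT_comp mal measurable_snd). Qed.

Lemma cs_bounded (al : R -> R) (N : R) : continuous al ->
  (forall x, N < `|x| -> al x = 0) -> exists2 M : R, 0 <= M & forall x, `|al x| <= M.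
Proof.
move=> cal alN.
have NN : - `|N| <= `|N| by rewrite (le_trans _ (normr_ge0 N))// oppr_le0.
have [M M0 HM] := continuous_bound NN cal.
exists M => // x; case: (leP `|x| N) => xN; last by rewrite alN// normr0.
apply: HM; rewrite in_itv/= -ler_norml.
exact: (le_trans xN (ler_norm _)).
Qed.

Lemma locint2_tensor u (al be : R -> R) (N : R) : locint2 u ->
  continuous al -> continuous be ->
  (forall x, N < `|x| -> al x = 0) -> (forall x, N < `|x| -> be x = 0) ->
  leb2.-integrable setT (EFin \o (fun z => u z * (al z.1 * be z.2))).
Proof.
move=> [mu' iu] cal cbe alN beN.
have [M M0 HM] := cs_bounded cal alN.
have [K K0 HK] := cs_bounded cbe beN.
have mab : measurable_fun setT (fun z : R * R => al z.1 * be z.2).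
  apply: measurable_funM.
  - by apply: measurable_fst_comp; exact: continuous_measurable_fun.
  - by apply: measurable_snd_comp; exact: continuous_measurable_fun.
apply: (@integrable_support _ _ _ leb2 (box N)).
- exact: measurable_box.
- move=> z /= /not_andP[] /negP; rewrite in_itv/= -ler_norml -ltNge.
    by move/alN => ->; rewrite mul0r mulr0.
  by move/beN => ->; rewrite !mulr0.
apply: (@integrable_le _ _ _ leb2 _ _ (fun z => (M * K) * `|u z|)).
- exact: measurable_box.
- by apply: measurable_funTS; exact: measurable_funM.
- apply: integrableZ_real; first exact: measurable_box.
  by have := integrable_norm (iu N).
- by move=> z _; rewrite normrM mulrC ler_wpM2r// normrM ler_pM.
Qed.

Lemma locint2_lines u : locint2 u -> {ae mu, forall y, locint (fun x => u (x, y))}.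
Proof.
move=> [mu' iu].
pose w n := u \_ (box n%:R).
have H (n : nat) : {ae mu, forall y, mu.-integrable setT (EFin \o (fun x => w n (x, y)))}.
  have iw : leb2.-integrable setT (EFin \o w n).
    rewrite /w -restrict_EFin -integrable_mkcond; first exact: iu.
    exact: measurable_box.
  by have [] := Rfubini iw.
have := ae_foralln H; apply: ae_sub => y Hy.
split; first exact: measurable_line.
move=> a b.
pose n := (Num.truncn (`|a| + `|b| + `|y|)).+1.
have nn : `|a| + `|b| + `|y| <= n%:R by rewrite ltW// truncnS_gt.
have : mu.-integrable `[a, b] (EFin \o (fun x => w n (x, y))).
  by apply: integrableS (Hy n).
apply: eq_integrable => // x; rewrite inE/= in_itv/= => /andP[ax xb].
rewrite /w patchE mem_set//.
have := normr_ge0 a; have := normr_ge0 b; have := normr_ge0 y => y0 b0 a0.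
split; rewrite /= in_itv/= -ler_norml; last by lra.
rewrite ler_norml; apply/andP; split.
  by have := ler_norm (- a); rewrite normrN; lra.
by have := ler_norm b; lra.
Qed.

Definition weak_d1 u g := forall (al al' be : R -> R) (N : R),
  smooth1 al -> smooth1 be -> (forall x : R, is_derive x 1 al (al' x)) ->
  (forall x, N < `|x| -> al x = 0) -> (forall x, N < `|x| -> be x = 0) ->
  (\int[leb2]_z (u z * (al' z.1 * be z.2))%:E =
   - \int[leb2]_z (g z * (al z.1 * be z.2))%:E)%E.

Lemma cs_derive (al al' : R -> R) (N : R) : (forall x : R, is_derive x 1 al (al' x)) ->
  (forall x, N < `|x| -> al x = 0) -> forall x, N < `|x| -> al' x = 0.
Proof.
move=> dal alN x xN.
have e0 : 0 < `|x| - N by rewrite subr_gt0.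
have H : is_derive x 1 al 0.
  apply: (@near_eq_is_derive R R R (cst 0)).
    apply: filterS (nbhsx_ballx x _ e0) => y; rewrite /ball/= => xy.
    rewrite alN//; have := ler_normD (x - y) y; rewrite subrK; lra.
by rewrite -(@derive_val _ _ _ _ _ _ _ (dal x)) (@derive_val _ _ _ _ _ _ _ H).
Qed.

(** A fixed bump of positive integral, used in [weak_acl] to subtract means. *)
Let al0 := cbump 0 (-1) 1 : R -> R.

Lemma int_cs (k : R -> R) (N : R) : continuous k -> (forall x, N < `|x| -> k x = 0) ->
  mu.-integrable setT (EFin \o k) /\
  \int[mu]_(x in `[- N, N]) k x = \int[mu]_x k x.
Proof.
move=> ck kN; have [i1 i2] := locint_cs (locint_cst 1) ck kN.
have e : (fun x => 1 * k x) = k by apply/funext => x; rewrite mul1r.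
by rewrite e in i1 i2.
Qed.

Lemma int_al0_gt0 : 0 < \int[mu]_x al0 x.
Proof.
have cal0 : continuous al0 by apply: smooth1_continuous; exact: smooth1_cbump.
have hh : - 2^-1 <= 2^-1 :> R by lra.
have [c cin Hc] := @EVT_min R al0 _ _ hh (continuous_subspaceT cal0).
have c0 : 0 < al0 c.
  by apply: cbump_gt0; move: cin; rewrite in_itv/= => /andP[h1 h2]; apply/andP; split; lra.
have [ial0 _] : mu.-integrable setT (EFin \o al0) /\
    \int[mu]_(x in `[- 1, 1]) al0 x = \int[mu]_x al0 x.
  apply: int_cs => // x x1; apply: cbump_out; apply/negP => /andP[h1 h2].
  by move: x1; rewrite ltNge ler_norml !ltW.
apply: (@lt_le_trans _ _ (\int[mu]_(x in `[- 2^-1, 2^-1]) (al0 c))).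
  by rewrite Rintegral_cst_itv// mulr_gt0//; lra.
rewrite Rintegral_mkcond; apply: le_Rintegral => //.
- rewrite -restrict_EFin -integrable_mkcond; last exact: measurable_itv.
  exact: (locint_cst _).2.
- move=> x _; rewrite patchE; case: ifPn => [|_]; last exact: cbump_ge0.
  by rewrite inE/= => xin; apply: Hc.
Qed.

(** The du Bois-Reymond lemma on almost every line. A bump corrected to mean zero has a compactly
    supported smooth primitive, which may be used as a test function in x. Varying the factor in y
    localises the identity to almost every line, simultaneously for countably many bumps. On such a
    line [u] minus the primitive of [g] is orthogonal to all these mean-zero functions, hence
    constant. *)
Lemma weak_acl u g : locint2 u -> locint2 g -> weak_d1 u g ->
  {ae mu, forall y, acl1 (fun x => u (x, y)) (fun x => g (x, y))}.
Proof.
move=> lu lg wd.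
pose I0 := \int[mu]_x al0 x.
have cal0 : continuous al0 by apply: smooth1_continuous; exact: smooth1_cbump.
have al0N x : 1 < `|x| -> al0 x = 0.
  move=> x1; apply: cbump_out; apply/negP => /andP[h1 h2].
  by move: x1; rewrite ltNge ler_norml !ltW.
pose al (i : nat * rat * rat) : R -> R := cbump i.1.1 (ratr i.1.2) (ratr i.2).
have sal i : smooth1 (al i) by exact: smooth1_cbump.
have cal i : continuous (al i) by apply: smooth1_continuous; exact: sal.
pose N (i : nat * rat * rat) : R := 1 + `|ratr i.1.2 : R| + `|ratr i.2 : R|.
have alN (i : nat * rat * rat) x : N i < `|x| -> al i x = 0.
  move=> xN; apply: cbump_out; apply/negP => /andP[h1 h2].
  have := normr_ge0 (ratr i.1.2 : R); have := normr_ge0 (ratr i.2 : R).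
  move: xN; rewrite /N ltNge => /negP xN p0 q0; apply: xN.
  rewrite ler_norml; apply/andP; split.
    by have := ler_norm (- (ratr i.1.2 : R)); rewrite normrN; lra.
  by have := ler_norm (ratr i.2 : R); lra.
have N1 (i : nat * rat * rat) : 1 <= N i by rewrite /N -addrA lerDl addr_ge0.
pose Ia i := \int[mu]_x al i x.
(* The combination of [al i] and [al0] with integral [I0 * Ia i - Ia i * I0 = 0]. *)
pose ga i x := I0 * al i x - Ia i * al0 x.
have sga i : smooth1 (ga i).
  rewrite (_ : ga i = fun x => I0 * al i x + (- Ia i) * al0 x); last first.
    by apply/funext => x; rewrite mulNr.
  by apply: smooth1D; apply: smooth1Z; [exact: sal|exact: smooth1_cbump].
have cga i : continuous (ga i) by exact: smooth1_continuous.
have al0N' i x : N i < `|x| -> al0 x = 0.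
  by move=> xN; apply: al0N; exact: le_lt_trans (N1 i) xN.
have gaN i x : N i < `|x| -> ga i x = 0.
  by move=> xN; rewrite /ga alN// (al0N' i)// !mulr0 subrr.
have lga i := continuous_locint (cga i).
(* Normalised to vanish to the left of the support of [ga i]; the zero mean makes it vanish to the
   right as well. *)
pose A i x := primitive (ga i) x - primitive (ga i) (- N i).
have dA i (x : R) : is_derive x 1 (A i) (ga i x).
  have := is_derive_primitive (lga i) (cga i x) => dk.
  have -> : ga i x = ga i x - 0 by rewrite subr0.
  by apply: is_deriveB.
have sA i : smooth1 (A i) by exact: smooth1_anti (dA i) (sga i).
have iga i : \int[mu]_x ga i x = 0.
  have [ia _] := int_cs (cal i) (alN i).
  have [ia0 _] := int_cs cal0 al0N.
  rewrite /ga RintegralB//; [|exact: integrableZ_real..].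
  by rewrite !RintegralZl// mulrC subrr.
have AN i x : N i < `|x| -> A i x = 0.
  have [_ igN] := int_cs (cga i) (gaN i).
  move=> xN; rewrite /A; case: (leP 0 x) => x0.
    rewrite ger0_norm// in xN.
    rewrite primitiveB//; last by have := N1 i; lra.
    have NN : - N i <= N i by have := N1 i; lra.
    rewrite (Rintegral_chasles (lga i) NN (ltW xN)) igN iga add0r.
    transitivity (primitive (ga i) x - primitive (ga i) (N i)); first by rewrite primitiveB// ltW.
    have H : \int[mu]_(t in `[N i, x]) (0 * ga i t) = \int[mu]_(t in `[N i, x]) ga i t.
      apply: ae_eq_Rintegral => //.
      - by apply: measurable_funTS; exact: (locintZ 0 (lga i)).1.
      - by apply: measurable_funTS; exact: (lga i).1.
      apply: ae_sub (ae_neq (N i)) => t tN; rewrite /= in_itv/= => /andP[t1 _].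
      rewrite mul0r gaN//; apply: lt_le_trans (ler_norm t).
      by rewrite lt_neqAle t1 andbT eq_sym; exact/eqP.
    by rewrite primitiveB ?(ltW xN)// -H RintegralZl ?mul0r//; exact: (lga i).2.
  rewrite ltr0_norm// in xN.
  apply/eqP; rewrite subr_eq0 eq_sym -subr_eq0 primitiveB//; last by lra.
  have H : \int[mu]_(t in `[x, - N i]) (0 * ga i t) = \int[mu]_(t in `[x, - N i]) ga i t.
    apply: ae_eq_Rintegral => //.
    - by apply: measurable_funTS; exact: (locintZ 0 (lga i)).1.
    - by apply: measurable_funTS; exact: (lga i).1.
    apply: ae_sub (ae_neq (- N i)) => t tN; rewrite /= in_itv/= => /andP[_ t1].
    rewrite mul0r gaN//.
    have tN' : t < - N i by rewrite lt_neqAle t1 andbT; exact/eqP.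
    by have := ler_norm (- t); rewrite normrN; lra.
  by rewrite -H RintegralZl ?mul0r//; exact: (lga i).2.
have cA i : continuous (A i) by exact: smooth1_continuous.
pose H i y := \int[mu]_x (u (x, y) * ga i x + g (x, y) * A i x).
have H0 i : {ae mu, forall y, H i y = 0}.
  (* A cut-off in y makes the integrand integrable over the plane. A given y is reached with [M] the
     integer part of |y|, where [be M] is positive and can be divided out. *)
  pose be (M : nat) : R -> R := cbump 0 (- M%:R - 1) (M%:R + 1).
  have beN (M : nat) (x : R) : M%:R + 1 < `|x| -> be M x = 0.
    move=> xN; apply: cbump_out; apply/negP => /andP[h1 h2].
    move: xN; rewrite ltNge => /negP; apply; rewrite ler_norml.
    by apply/andP; split; lra.
  have sbe M : smooth1 (be M) by exact: smooth1_cbump.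
  have cbe M : continuous (be M) by exact: smooth1_continuous.
  pose w M z := (u z * (ga i z.1 * be M z.2) + g z * (A i z.1 * be M z.2)).
  pose K M : R := N i + (M%:R + 1).
  have NK (M : nat) : N i <= K M by rewrite /K lerDl addr_ge0.
  have MK (M : nat) : M%:R + 1 <= K M by rewrite /K lerDr; have := N1 i; lra.
  have iw M : leb2.-integrable setT (EFin \o w M).
    apply: integrableD_real => //.
      apply: (@locint2_tensor _ _ _ (K M)) => // x xK.
        exact/gaN/(le_lt_trans (NK M)).
      exact/beN/(le_lt_trans (MK M)).
    apply: (@locint2_tensor _ _ _ (K M)) => // x xK.
      exact/AN/(le_lt_trans (NK M)).
    exact/beN/(le_lt_trans (MK M)).
  have ls := locint2_lines lu; have lsg := locint2_lines lg.
  have Hbe M y (k : R) : locint (fun x => u (x, y)) -> locint (fun x => g (x, y)) ->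
      \int[mu]_x (w M (x, y) * k) = H i y * be M y * k.
    move=> l1 l2.
    have [i1 _] := locint_cs l1 (cga i) (gaN i).
    have [i2 _] := locint_cs l2 (cA i) (AN i).
    rewrite -mulrA -RintegralZr//; last exact: integrableD_real.
    by apply: eq_Rintegral => x _; rewrite /w/=; ring.
  have Z M : {ae mu, forall y, \int[mu]_x w M (x, y) = 0}.
    have [_ iE _] := Rfubini (iw M).
    apply: fundamental_lemma1.
      split; first exact: integrable_measurable iE.
      by move=> a b; apply: integrableS iE.
    (* The product [be M * b] is the second factor of the test function; Fubini turns the weak
       identity into the vanishing of a one-dimensional integral against [b]. *)
    move=> n p q; set b := cbump n _ _.
    have sb : smooth1 (fun y => be M y * b y).
      by apply: smooth1M => //; exact: smooth1_cbump.
    have cb := smooth1_continuous sb.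
    have bN (x : R) : K M < `|x| -> be M x * b x = 0.
      by move=> xK; rewrite beN ?mul0r//; exact: le_lt_trans (MK M) xK.
    have AK (x : R) : K M < `|x| -> A i x = 0.
      by move=> xK; apply: AN; exact: le_lt_trans (NK M) xK.
    have gaK (x : R) : K M < `|x| -> ga i x = 0.
      by move=> xK; apply: gaN; exact: le_lt_trans (NK M) xK.
    have j1 := locint2_tensor lu (cga i) cb gaK bN.
    have j2 := locint2_tensor lg (cA i) cb AK bN.
    have := wd _ _ _ _ (sA i) sb (dA i) AK bN.
    rewrite (EFin_Rintegral measurableT j1) (EFin_Rintegral measurableT j2).
    rewrite -EFinN => -[e].
    have j3 := integrableD_real measurableT j1 j2.
    have [_ _] := Rfubini j3.
    rewrite RintegralD// e addrC subrr => /esym <-.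
    apply: ae_eq_Rintegral => //.
    - apply: measurable_funM; first exact: integrable_measurable iE.
      apply: continuous_measurable_fun; apply: smooth1_continuous; exact: smooth1_cbump.
    - by have [_ j4 _] := Rfubini j3; exact: integrable_measurable j4.
    - apply: ae_sub2 ls lsg => y l1 l2 _.
      have := Hbe M y 1 l1 l2; rewrite mulr1 => e1.
      have -> : \int[mu]_x w M (x, y) = H i y * be M y.
        by rewrite -e1; apply: eq_Rintegral => x _; rewrite mulr1.
      rewrite -Hbe//; apply: eq_Rintegral => x _; rewrite /w/=; ring.
  have := ae_foralln Z => Z'.
  apply: ae_sub2 (ae_sub2 (fun y a b => conj a b) ls lsg) Z' => y [l1 l2] /(_ (Num.truncn `|y|)).
  set M := Num.truncn _.
  have := Hbe M y 1 l1 l2; rewrite mulr1 => e1.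
  have -> : \int[mu]_x w M (x, y) = H i y * be M y.
    by rewrite -e1; apply: eq_Rintegral => x _; rewrite mulr1.
  move=> /eqP; rewrite mulf_eq0 => /orP[/eqP//|].
  have : 0 < be M y.
    apply: cbump_gt0.
    have : `|y| < M.+1%:R by exact: truncnS_gt.
    by rewrite -natr1 ltr_norml => /andP[h1 h2]; apply/andP; split; lra.
  by move=> b0 /eqP b1; rewrite b1 ltxx in b0.
have H0' : {ae mu, forall y, forall i, H i y = 0}.
  have := @ae_foralln _ _ _ mu (fun n y => forall i, unpickle n = Some i -> H i y = 0).
  move=> /(_ _)/ae_sub; apply.
    by move=> y Hn i; apply: (Hn (pickle i)); rewrite pickleK.
  move=> n; case: (unpickle n) => [j|]; last by apply: aeW.
  by apply: ae_sub (H0 j) => y + i [<-].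
have ls := locint2_lines lu; have lsg := locint2_lines lg.
apply: ae_sub2 (ae_sub2 (fun y a b => conj a b) ls lsg) H0' => y [l1 l2] Hy.
pose P := primitive (fun x => g (x, y)).
have cP : continuous P by exact: continuous_primitive.
have lP := continuous_locint cP.
pose E0 x := u (x, y) - P x.
have lE0 : locint E0 by exact: locintB.
have key i : \int[mu]_x (E0 x * ga i x) = 0.
  have aP : acl1 P (fun x => g (x, y)).
    split => //; first exact: continuous_measurable_fun.
    by exists 0; apply: aeW => x; rewrite add0r.
  have NN : - N i <= N i by have := N1 i; lra.
  have [i1 e1] := locint_cs l1 (cga i) (gaN i).
  have [i2 e2] := locint_cs l2 (cA i) (AN i).
  have [i3 e3] := locint_cs lP (cga i) (gaN i).
  have aE : A i (N i) = 0.
    have [_ igN] := int_cs (cga i) (gaN i).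
    by rewrite /A primitiveB// igN iga.
  have := acl1_parts (dA i) (cga i) aP NN (subrr _) aE.
  have H2 := locint_mul_continuous (cA i) l2.
  have H3 := locint_mul_continuous (cga i) lP.
  rewrite RintegralD//; [|exact: H3.2|exact: H2.2].
  under eq_Rintegral do rewrite mulrC.
  under [X in _ + X]eq_Rintegral do rewrite mulrC.
  rewrite e2 e3 => e4.
  have := Hy i; rewrite /H RintegralD// => e5.
  rewrite /E0; under eq_Rintegral do rewrite mulrBl.
  rewrite RintegralB//.
  by apply/eqP; rewrite subr_eq0; apply/eqP; lra.
(* The mean of [E0] with weight [al0]: orthogonality to [ga i] says exactly that [E0 - c] is
   orthogonal to [al i]. *)
pose c := \int[mu]_x (E0 x * al0 x) / I0.
have I0p : 0 < I0 := int_al0_gt0.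
have E00 : {ae mu, forall x, E0 x - c = 0}.
  apply: fundamental_lemma1; first by apply: locintB => //; exact: locint_cst.
  move=> n p q; rewrite -/(al (n, p, q)); set i := (n, p, q).
  have [i1 _] := locint_cs lE0 (cal i) (alN i).
  have [i2 _] := locint_cs lE0 cal0 al0N.
  have [i3 _] := int_cs (cal i) (alN i).
  under eq_Rintegral do rewrite mulrBl.
  rewrite RintegralB//; last exact: integrableZ_real.
  rewrite RintegralZl// -/(Ia i).
  have := key i.
  have -> : (fun x => E0 x * ga i x) = fun x => I0 * (E0 x * al i x) - Ia i * (E0 x * al0 x).
    apply/funext => x; rewrite /ga; move: (E0 x) (al i x) (al0 x) => r1 r2 r3; ring.
  rewrite RintegralB//; [|exact: integrableZ_real..].
  rewrite !RintegralZl// => /eqP; rewrite subr_eq0 => /eqP e.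
  apply/eqP; rewrite subr_eq0 /c mulrAC -[_ * Ia i]mulrC -e.
  by rewrite mulrAC divff ?mul1r// gt_eqF.
split => //; first by apply: measurable_line; exact: lu.1.
exists c; apply: ae_sub E00 => x /eqP; rewrite subr_eq0 => /eqP <-.
by rewrite /E0 subrK.
Qed.

End weak_to_acl.

(** * Measurability, exchange of coordinates and null sets in the plane *)

Section plane.
Context {R : realType}.
Notation mu := (@lebesgue_measure R).
Notation leb2 := (@leb2 R).
Implicit Types (u g : R * R -> R).

(** Measurability is wanted for the product sigma-algebra. Rounding x down to a multiple of 1/(n+1)
    makes every preimage a countable union of rectangles, and [phi] is the pointwise limit of these
    roundings. *)
Lemma continuous2_measurable (phi : R * R -> R) :
  continuous phi -> measurable_fun setT phi.
Proof.
move=> cphi.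
pose r (n : nat) (x : R) : R := (Num.floor (n.+1%:R * x))%:~R / n.+1%:R.
have mr n : measurable_fun setT (r n).
  apply: measurable_funM => //.
  apply: nondecreasing_measurable => // x y xy.
  by rewrite ler_int le_floor// ler_wpM2l.
have cr (x : R) : r n x @[n --> \oo] --> x.
  apply/cvgrPdist_le => e e0; near=> n.
  have n0 : 0 < n.+1%:R :> R by rewrite ltr0n.
  have h1 : (Num.floor (n.+1%:R * x))%:~R <= n.+1%:R * x by exact: floor_le.
  have h2 : n.+1%:R * x < (Num.floor (n.+1%:R * x))%:~R + 1.
    by have := floorD1_gt (n.+1%:R * x); rewrite intrD1.
  have -> : x - r n x = (n.+1%:R * x - (Num.floor (n.+1%:R * x))%:~R) / n.+1%:R.
    by rewrite /r; field; rewrite gt_eqF.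
  rewrite ger0_norm; last by rewrite divr_ge0 ?subr_ge0// ltW.
  apply: (@le_trans _ _ (n.+1%:R^-1)).
    by rewrite ler_pdivrMr// mulVf ?gt_eqF//; lra.
  near: n; have := @cvg_harmonic R => /cvgrPdist_le /(_ _ e0).
  by apply: filterS => n; rewrite /= sub0r normrN ger0_norm.
apply: (@measurable_fun_cvg _ _ _ setT (fun n z => phi (r n z.1, z.2))) => //.
- move=> n _ Y mY; rewrite setTI.
  rewrite (_ : _ @^-1` Y = \bigcup_(q : rat)
    ((r n @^-1` [set ratr q]) `*` ((fun y => phi (ratr q, y)) @^-1` Y))).
    apply: bigcupT_measurable_rat => q; apply: measurableX.
      by rewrite -[X in measurable X]setTI; exact: mr.
    rewrite -[X in measurable X]setTI.
    have cq : continuous (fun y : R => phi (ratr q, y)).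
      move=> y; apply: (@continuous_comp _ _ _ (fun y : R => (ratr q : R, y)) phi); last exact: cphi.
      move=> A /= [[B C] [/= HB HC] BC].
      by apply: filterS HC => z Cz; apply: BC; split => //=; exact: nbhs_singleton HB.
    exact: (continuous_measurable_fun cq).
  apply/seteqP; split => [[x y] /= H|[x y] /= [q _ [/= -> //]]].
  exists (((Num.floor (n.+1%:R * x))%:~R / n.+1%:R)%R : rat) => //.
  have -> : ratr ((Num.floor (n.+1%:R * x))%:~R / n.+1%:R) = r n x.
    by rewrite /r rmorphM fmorphV /= ratr_int ratr_nat.
  by split.
- move=> [x y] _ /=.
  apply: (@continuous_cvg _ _ _ _ _ _ phi); first exact: cphi.
  move=> A /= [[B C] [/= HB HC] BC].
  have := cr x B HB; rewrite /nbhs/=; apply: filterS => n Bn; apply: BC.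
  by split => //=; exact: nbhs_singleton HC.
Unshelve. all: by end_near. Qed.

Definition swp u : R * R -> R := fun z => u (z.2, z.1).

Lemma measurable_flip : measurable_fun setT (fun z : R * R => (z.2, z.1)).
Proof. by apply: measurable_fun_pair; [exact: measurable_snd|exact: measurable_fst]. Qed.

Lemma ge0_integral_swap (F : R * R -> \bar R) : measurable_fun setT F ->
  (forall z, 0 <= F z)%E -> (\int[leb2]_z F (z.2, z.1) = \int[leb2]_z F z)%E.
Proof.
move=> mF F0.
have mF' : measurable_fun setT (fun z : R * R => F (z.2, z.1)).
  exact: (measurableT_comp mF measurable_flip).
have e1 := fubini_tonelli1 (m1 := mu) (m2 := mu) (fun z => F (z.2, z.1)) mF' (fun z => F0 _).
have e2 := fubini_tonelli2 (m1 := mu) (m2 := mu) F mF F0.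
exact: (etrans e1 (esym e2)).
Qed.

Lemma integral_swap (F : R * R -> \bar R) : measurable_fun setT F ->
  (\int[leb2]_z F (z.2, z.1) = \int[leb2]_z F z)%E.
Proof.
move=> mF; rewrite integralE [RHS]integralE.
congr (_ - _)%E.
- apply: etrans (ge0_integral_swap (measurable_funepos mF) (funepos_ge0 F)).
  by apply: eq_integral => z _; rewrite !funeposE.
- apply: etrans (ge0_integral_swap (measurable_funeneg mF) (funeneg_ge0 F)).
  by apply: eq_integral => z _; rewrite !funenegE.
Qed.

Lemma ge0_integral_affine2 (F : R * R -> \bar R) (k s t : R) : 0 < k ->
  measurable_fun setT F -> (forall z, 0 <= F z)%E ->
  (\int[leb2]_z F ((k * z.1 + s)%R, (k * z.2 + t)%R) =
   (k ^- 2)%:E * \int[leb2]_z F z)%E.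
Proof.
move=> k0 mF F0.
have mT : measurable_fun setT (fun z : R * R => (k * z.1 + s, k * z.2 + t)).
  apply: measurable_fun_pair.
    exact: (measurable_fst_comp (measurable_affine k s)).
  exact: (measurable_snd_comp (measurable_affine k t)).
have mF' := measurableT_comp mF mT.
have e1 := fubini_tonelli1 (m1 := mu) (m2 := mu)
  (fun z => F (k * z.1 + s, k * z.2 + t)%R) mF' (fun z => F0 _).
have e2 := fubini_tonelli1 (m1 := mu) (m2 := mu) F mF F0.
rewrite [LHS]e1 [X in (_ * X)%E]e2.
pose G x := (\int[mu]_y F (x, y))%E.
have mG : measurable_fun setT G by exact: measurable_fun_fubini_tonelli_F.
have G0 x : (0 <= G x)%E by exact: integral_ge0.
have ki0 : 0 <= k^-1 by rewrite invr_ge0 ltW.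
transitivity (\int[mu]_x ((k^-1)%:E * G (k * x + s)%R))%E.
  apply: eq_integral => x _; rewrite /fubini_F /=.
  apply: (@ge0_integral_affine _ k t k0 (fun y => F ((k * x + s)%R, y))) => //.
  exact: (measurableT_comp mF (pair1_measurable (k * x + s))).
have mGa : measurable_fun setT (fun x => G (k * x + s)).
  exact: (measurableT_comp mG (measurable_affine k s)).
have -> : (\int[mu]_x ((k^-1)%:E * G (k * x + s)%R) =
    (k^-1)%:E * \int[mu]_x G (k * x + s)%R)%E by apply: ge0_integralZl.
rewrite (@ge0_integral_affine _ k s k0 G)// muleA -EFinM.
by rewrite -exprVn expr2.
Qed.

Lemma ae_lines (P : R * R -> Prop) : {ae leb2, forall z, P z} ->
  {ae mu, forall y, {ae mu, forall x, P (x, y)}}.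
Proof.
move=> [N [mN N0 PN]].
have m1 : measurable_fun setT (fun z => (\1_N z)%:E : \bar R).
  by apply/measurable_EFinP.
have H : (\int[mu]_y \int[mu]_x (\1_N (x, y))%:E = 0)%E.
  rewrite -(fubini_tonelli2 (m1 := mu) (m2 := mu) _ m1) => [|z]; last by rewrite lee_fin.
  rewrite integral_indic// setIT; exact: N0.
have mG : measurable_fun setT (fun y => \int[mu]_x (\1_N (x, y))%:E)%E.
  by apply: (measurable_fun_fubini_tonelli_G (m1 := mu) _ m1) => z; rewrite lee_fin.
have := (@ae_eq_integral_abs _ _ _ mu setT measurableT _ mG).1.
have -> : (\int[mu]_y `|\int[mu]_x (\1_N (x, y))%:E| = 0)%E.
  rewrite -[RHS]H; apply: eq_integral => y _; rewrite gee0_abs//.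
  by apply: integral_ge0 => x _; rewrite lee_fin.
move=> /(_ erefl); apply: ae_sub => y /= /(_ I) Hy.
exists (ysection N y); split.
- exact: measurable_ysection.
- have e := @integral_indic _ _ _ mu setT measurableT _ (measurable_ysection y mN).
  rewrite setIT in e; rewrite -[LHS]e -[RHS]Hy; apply: eq_integral => x _.
  rewrite !indicE; suff -> : (x \in ysection N y) = ((x, y) \in N) by [].
  by apply/idP/idP; rewrite !inE /ysection /= ?inE.
- by move=> x /= Px; rewrite /ysection /= inE; apply: PN.
Qed.

(** Measurability of the exceptional set lets Tonelli compute its measure from the sections, which
    are null. *)
Lemma ae_of_lines (P : R * R -> Prop) : measurable [set z | ~ P z] ->
  {ae mu, forall y, {ae mu, forall x, P (x, y)}} -> {ae leb2, forall z, P z}.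
Proof.
move=> mN H; set N := [set z | ~ P z] in mN *.
exists N; split => //.
have m1 : measurable_fun setT (fun z => (\1_N z)%:E : \bar R).
  by apply/measurable_EFinP.
have e := @integral_indic _ _ _ leb2 setT measurableT _ mN.
rewrite setIT in e; rewrite -[LHS]e.
have z0 (z : R * R) : (0 <= (\1_N z)%:E :> \bar R)%E by rewrite lee_fin.
rewrite [LHS](fubini_tonelli2 (m1 := mu) (m2 := mu) _ m1 z0).
transitivity (\int[mu]_y (0 : \bar R))%E; last exact: integral0.
have mG := measurable_fun_fubini_tonelli_G (m1 := mu) _ m1 z0.
apply: ae_eq_integral => //.
apply: ae_sub H => y Hy _; rewrite /fubini_G.
transitivity (\int[mu]_x (0 : \bar R))%E; last exact: integral0.
apply: ae_eq_integral => //.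
  exact: (measurableT_comp m1 (pair2_measurable y)).
apply: ae_sub Hy => x ux _; rewrite indicE memNset//.
Qed.

Lemma ae_eq_lines u g : measurable_fun setT u -> measurable_fun setT g ->
  {ae mu, forall y, {ae mu, forall x, u (x, y) = g (x, y)}} ->
  {ae leb2, forall z, u z = g z}.
Proof.
move=> mu' mg; apply: ae_of_lines.
have := @measurable_fun_eqr _ _ _ setT _ _ mu' mg measurableT [set false].
move=> /(_ I); rewrite setTI; congr measurable.
by apply/seteqP; split => z /=; [move=> /negbT/eqP|move=> /eqP/negbTE].
Qed.

End plane.

Section weak_acl_equivalence.
Context {R : realType}.
Notation mu := (@lebesgue_measure R).
Notation leb2 := (@leb2 R).
Implicit Types (u g : R * R -> R).

(* On almost every horizontal line u agrees a.e. with an absolutely continuous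
   function whose derivative is g; vertical lines are reached through [swp]. *)
Definition acl u g := {ae mu, forall y, acl1 (fun x => u (x, y)) (fun x => g (x, y))}.

Lemma box_out (N : R) (z : R * R) : ~ box N z -> (N < `|z.1|) || (N < `|z.2|).
Proof.
move=> H; apply: contra_notT H; rewrite negb_or -!leNgt => /andP[h1 h2].
by split; rewrite /= in_itv/= -ler_norml.
Qed.

Lemma continuous2_bounded (phi : R * R -> R) (N : R) : continuous phi ->
  (forall z, ~ box N z -> phi z = 0) -> exists2 M : R, 0 <= M & forall z, `|phi z| <= M.
Proof.
move=> cphi phiN.
have cb : compact (box N) by apply: compact_setX; exact: segment_compact.
have := continuous_compact (continuous_subspaceT cphi) cb.
move=> /compact_bounded[M [Mr HM]].
exists (`|M| + 1); first by rewrite addr_ge0.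
move=> z; have [zb|/phiN ->] := pselect (box N z); last by rewrite normr0 addr_ge0.
apply: (HM (`|M| + 1)); first by rewrite (le_lt_trans (ler_norm M))// ltrDl.
by exists z.
Qed.

Lemma locint2_bounded_mul u (k : R * R -> R) (N M : R) : locint2 u ->
  measurable_fun setT k -> (forall z, `|k z| <= M) -> (forall z, ~ box N z -> k z = 0) ->
  leb2.-integrable setT (EFin \o (fun z => u z * k z)).
Proof.
move=> [mu' iu] mk kM kN.
apply: (@integrable_support _ _ _ leb2 (box N)).
- exact: measurable_box.
- by move=> z /kN ->; rewrite mulr0.
apply: (@integrable_le _ _ _ leb2 _ _ (fun z => M * `|u z|)).
- exact: measurable_box.
- by apply: measurable_funTS; exact: measurable_funM.
- apply: integrableZ_real; first exact: measurable_box.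
  by have := integrable_norm (iu N).
- by move=> z _; rewrite normrM mulrC ler_wpM2r.
Qed.

Lemma acl_parts u g (phi phi' : R * R -> R) (N : R) : locint2 u -> locint2 g ->
  acl u g -> continuous phi -> continuous phi' ->
  (forall x y : R, is_derive x 1 (fun t => phi (t, y)) (phi' (x, y))) ->
  (forall z, ~ box N z -> phi z = 0) ->
  (\int[leb2]_z (u z * phi' z)%:E = - \int[leb2]_z (g z * phi z)%:E)%E.
Proof.
move=> lu lg aug cphi cphi' dphi phiN.
have phiN1 x y : N < `|x| -> phi (x, y) = 0.
  move=> xN; apply: phiN => -[/= + _]; rewrite in_itv/= -ler_norml leNgt.
  by rewrite xN.
have phiN2 x y : N < `|y| -> phi (x, y) = 0.
  move=> xN; apply: phiN => -[/= _ +]; rewrite in_itv/= -ler_norml leNgt.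
  by rewrite xN.
have phi'N z : ~ box N z -> phi' z = 0.
  case: z => x y /box_out/= /orP[xN|yN].
    exact: (@cs_derive _ (fun t => phi (t, y)) (fun t => phi' (t, y)) N
      (fun t => dphi t y) (fun t => @phiN1 t y) x xN).
  have H : is_derive x 1 (fun t => phi (t, y)) 0.
    have -> : (fun t => phi (t, y)) = cst 0 by apply/funext => t; rewrite phiN2.
    exact: is_derive_cst.
  by rewrite -(@derive_val _ _ _ _ _ _ _ (dphi x y)) (@derive_val _ _ _ _ _ _ _ H).
have [M _ HM] := continuous2_bounded cphi phiN.
have [M' _ HM'] := continuous2_bounded cphi' phi'N.
have i1 := locint2_bounded_mul lu (continuous2_measurable cphi') HM' phi'N.
have i2 := locint2_bounded_mul lg (continuous2_measurable cphi) HM phiN.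
rewrite (EFin_Rintegral measurableT i1) (EFin_Rintegral measurableT i2) -EFinN.
congr EFin; apply/eqP; rewrite -subr_eq0 opprK -RintegralD//; apply/eqP.
have i3 := integrableD_real measurableT i1 i2.
have [_ i4 ->] := Rfubini i3.
have l0 := locint_cst (0 : R).
transitivity (\int[mu]_y (0 : R)); last by rewrite Rintegral_cst// mul0r.
apply: ae_eq_Rintegral => //; first exact: integrable_measurable i4.
apply: ae_sub aug => y ay _.
have [_ ld _] := ay.
have cl (k : R * R -> R) : continuous k -> continuous (fun t : R => k (t, y)).
  move=> ck t; apply: (@continuous_comp _ _ _ (fun t : R => (t, y)) k); last exact: ck.
  move=> A /= [[B C] [/= HB HC] BC].
  by apply: filterS HB => z Cz; apply: BC; split => //=; exact: nbhs_singleton HC.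
pose N' := `|N| + 1.
have NN' : N < N' by rewrite (le_lt_trans (ler_norm N))// ltrDl.
have N'0 : 0 <= N' by rewrite addr_ge0.
have := @acl1_parts _ _ _ _ _ (- N') N' (dphi^~ y) (cl _ cphi') ay.
have -> : phi (- N', y) = 0 by rewrite phiN1// normrN ger0_norm.
have -> : phi (N', y) = 0 by rewrite phiN1// ger0_norm.
move=> /(_ _ erefl erefl) <-; last by rewrite (le_trans _ N'0)// oppr_le0.
rewrite -[LHS](@Rintegral_support _ _ _ mu `[- N', N']).
  by apply: eq_Rintegral => x _; rewrite mulrC (mulrC (g _)).
move=> x /negP; rewrite /= in_itv/= -ler_norml -ltNge => xN'.
have xN : N < `|x| by exact: lt_trans xN'.
rewrite phiN1// phi'N ?mulr0 ?addr0//.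
by case=> /= + _; rewrite in_itv/= -ler_norml leNgt xN.
Qed.

Lemma measurable_swp u : measurable_fun setT u -> measurable_fun setT (swp u).
Proof. move=> mu'; have h := measurableT_comp mu' measurable_flip. exact: h. Qed.

Lemma integrable_swap (D : set (R * R)) u : measurable_fun setT u ->
  measurable D -> (forall x y, D (x, y) -> D (y, x)) ->
  leb2.-integrable D (EFin \o u) -> leb2.-integrable D (EFin \o swp u).
Proof.
move=> mu' mD Ds /integrableP[_ H].
have ms := measurable_swp mu'.
apply/integrableP; split; first by apply/measurable_EFinP; exact: measurable_funTS.
move: H; rewrite integral_mkcond [X in _ -> (X < _)%E]integral_mkcond.
rewrite -(@ge0_integral_swap _ ((abse \o (EFin \o u)) \_ D)).
- set F := (X in (X < _)%E -> _); set G := (X in _ -> (X < _)%E); suff -> : F = G by [].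
  apply: eq_integral => -[x y] _; rewrite !patchE /=.
  have -> // : ((y, x) \in D) = ((x, y) \in D).
  by apply/idP/idP; rewrite !inE; exact: Ds.
- apply/(measurable_restrictT _ _).1 => //.
  by apply: measurableT_comp => //; apply/measurable_EFinP; exact: measurable_funTS.
- by move=> z; rewrite patchE; case: ifPn => // _; exact: abse_ge0.
Qed.

Lemma locint2_swp u : locint2 u -> locint2 (swp u).
Proof.
move=> [mu' iu]; split; first exact: measurable_swp.
move=> N; apply: integrable_swap => //; first exact: measurable_box.
by move=> x y [].
Qed.

Lemma test_fun_box (phi : R * R -> R) : test_fun phi ->
  exists N : R, forall z, ~ box N z -> phi z = 0.
Proof.
move=> [_ cs]; have [M [_ HM]] := compact_bounded cs.
exists (`|M| + 1) => z Hz; apply/eqP/negP => /negP z0; apply: Hz.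
have : `|z| <= `|M| + 1.
  apply: (HM (`|M| + 1)); first by rewrite (le_lt_trans (ler_norm M))// ltrDl.
  exact: subset_closure.
rewrite prod_normE ge_max => /andP[h1 h2].
by split; rewrite /= in_itv/= -ler_norml.
Qed.

(** One direction tests with tensor products only and applies [weak_acl]; the other integrates by
    parts on each line against an arbitrary test function. The second derivative is treated by
    exchanging the coordinates. *)
Lemma weak_gradP u g1 g2 : locint2 u -> locint2 g1 -> locint2 g2 ->
  weak_grad u g1 g2 <-> acl u g1 /\ acl (swp u) (swp g2).
Proof.
move=> lu lg1 lg2; split=> [wg|[a1 a2] phi tphi].
- split.
    apply: weak_acl => // al al' be N sal sbe dal alN beN.
    have [+ _] := wg _ (tensor_test sal sbe alN beN).
    rewrite (_ : partial false _ = fun z => al' z.1 * be z.2)//.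
    apply/funext => z; rewrite /partial derive1E.
    rewrite (_ : (fun t => _) = be z.2 \*: al); last by apply/funext => t /=; rewrite mulrC.
    by rewrite (@derive_val _ _ _ _ _ _ _ (is_deriveZ (be z.2) (dal z.1))) mulrC.
  apply: weak_acl; [exact: locint2_swp|exact: locint2_swp|].
  move=> al al' be N sal sbe dal alN beN.
  have mal := continuous_measurable_fun (smooth1_continuous sal).
  have mbe := continuous_measurable_fun (smooth1_continuous sbe).
  have mal' : measurable_fun setT al'.
    have [al2 sal2 dal2] := smooth1_derive sal.
    rewrite (_ : al' = al2); first exact: continuous_measurable_fun (smooth1_continuous sal2).
    apply/funext => x.
    by rewrite -(@derive_val _ _ _ _ _ _ _ (dal x)) (@derive_val _ _ _ _ _ _ _ (dal2 x)).
  have [_] := wg _ (tensor_test sbe sal beN alN).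
  rewrite (_ : partial true _ = fun z => be z.1 * al' z.2); last first.
    apply/funext => z; rewrite /partial derive1E.
    by rewrite (@derive_val _ _ _ _ _ _ _ (is_deriveZ (be z.1) (dal z.2))).
  rewrite -(@integral_swap _ (fun z => (u z * (be z.1 * al' z.2))%:E)); last first.
    apply/measurable_EFinP; apply: measurable_funM; first exact: lu.1.
    by apply: measurable_funM; [exact: measurable_fst_comp|exact: measurable_snd_comp].
  rewrite -(@integral_swap _ (fun z => (g2 z * (be z.1 * al z.2))%:E)); last first.
    apply/measurable_EFinP; apply: measurable_funM; first exact: lg2.1.
    by apply: measurable_funM; [exact: measurable_fst_comp|exact: measurable_snd_comp].
  rewrite /swp /= => H.
  under eq_integral do rewrite (mulrC (al' _)).
  by under [in RHS]eq_integral do rewrite (mulrC (al _)).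
- have [N phiN] := test_fun_box tphi.
  have [cphi dphi] := (tphi.1 [::]).
  have [cp1 _] := (tphi.1 [:: false]).
  have [cp2 _] := (tphi.1 [:: true]).
  rewrite /= in cphi dphi cp1 cp2.
  split.
    apply: (@acl_parts _ _ _ _ N) => // x y.
    have := dphi false (x, y); rewrite /partial_exists /= => d.
    by apply: (DeriveDef d); rewrite -derive1E.
  have cswp (k : R * R -> R) : continuous k -> continuous (swp k).
    move=> ck z; apply: (@continuous_comp _ _ _ (fun z : R * R => (z.2, z.1)) k); last exact: ck.
    by move=> A /= [[B C] [/= HB HC] BC]; exists (C, B) => // -[x y] [/= Cx By]; exact: BC.
  have := @acl_parts (swp u) (swp g2) (swp phi) (swp (partial true phi)) N
    (locint2_swp lu) (locint2_swp lg2) a2 (cswp _ cphi) (cswp _ cp2).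
  rewrite (@integral_swap _ (fun z => (u z * partial true phi z)%:E)); last first.
    apply/measurable_EFinP; apply: measurable_funM; first exact: lu.1.
    exact: continuous2_measurable.
  rewrite (@integral_swap _ (fun z => (g2 z * phi z)%:E)); last first.
    apply/measurable_EFinP; apply: measurable_funM; first exact: lg2.1.
    exact: continuous2_measurable.
  apply.
    move=> x y; have := dphi true (y, x); rewrite /partial_exists /= => d.
    by apply: (DeriveDef d); rewrite -derive1E.
  by move=> z Hz; apply: phiN => -[h1 h2]; apply: Hz.
Qed.

End weak_acl_equivalence.

(** * Sobolev functions *)

Section sobolev.
Context {R : realType}.
Notation mu := (@lebesgue_measure R).
Notation leb2 := (@leb2 R).
Implicit Types (u v g : R * R -> R).

Lemma L2_integrable u : L2 u -> leb2.-integrable setT (EFin \o (fun z => u z ^+ 2)).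
Proof.
move=> [mu' iu]; apply/integrableP; split.
  by apply/measurable_EFinP; exact: measurable_funX.
by under eq_integral do rewrite /= ger0_norm ?sqr_ge0//.
Qed.

Lemma integrable_L2 u : measurable_fun setT u ->
  leb2.-integrable setT (EFin \o (fun z => u z ^+ 2)) -> L2 u.
Proof.
move=> mu' /integrableP[_ iu]; split => //.
by under eq_integral do rewrite -[_ ^+ 2]ger0_norm ?sqr_ge0//.
Qed.

Lemma L2_le u v : L2 u -> measurable_fun setT v ->
  (forall z, `|v z| <= `|u z|) -> L2 v.
Proof.
move=> lu mv vu; apply: integrable_L2 => //.
apply: (integrable_le measurableT _ (L2_integrable lu)).
  exact: measurable_funX.
move=> z _; rewrite ger0_norm ?sqr_ge0//.
rewrite -[v z ^+ 2]real_normK ?num_real// -[u z ^+ 2]real_normK ?num_real//.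
by rewrite lerXn2r// nnegrE.
Qed.

Lemma L2Z k u : L2 u -> L2 (fun z => k * u z).
Proof.
move=> lu; apply: integrable_L2; first by apply: measurable_funM => //; exact: lu.1.
have := integrableZ_real (k ^+ 2) measurableT (L2_integrable lu).
by apply: eq_integrable => // z _; rewrite /= exprMn.
Qed.

Lemma L2D u v : L2 u -> L2 v -> L2 (fun z => u z + v z).
Proof.
move=> lu lv; apply: integrable_L2; first by apply: measurable_funD; [exact: lu.1|exact: lv.1].
have i1 := integrableZ_real 2 measurableT
  (integrableD_real measurableT (L2_integrable lu) (L2_integrable lv)).
apply: (integrable_le measurableT _ i1).
  by apply: measurable_funX; apply: measurable_funD; [exact: lu.1|exact: lv.1].
move=> z _; rewrite ger0_norm ?sqr_ge0//.
have := sqr_ge0 (u z - v z); rewrite !expr2; nra.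
Qed.

Lemma L2_bounded_mul (k : R * R -> R) (M : R) u : L2 u -> measurable_fun setT k ->
  (forall z, `|k z| <= M) -> L2 (fun z => k z * u z).
Proof.
move=> lu mk kM; apply: (L2_le (L2Z M lu)); first by apply: measurable_funM => //; exact: lu.1.
move=> z; rewrite !normrM ler_wpM2r//; apply: le_trans (kM z) _; exact: ler_norm.
Qed.

Lemma L2_swp u : L2 u -> L2 (swp u).
Proof.
move=> [mu' iu]; split; first exact: measurable_swp.
rewrite (@ge0_integral_swap _ (fun z => (u z ^+ 2)%:E))//.
  by apply/measurable_EFinP; exact: measurable_funX.
by move=> z; rewrite lee_fin sqr_ge0.
Qed.

Lemma integrable_box1 (N : R) : leb2.-integrable (box N) (EFin \o (fun=> 1)).
Proof.
have mb : (leb2 (box N) < +oo)%E.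
  have e := @product_measure1E _ _ _ _ _ mu mu `[- N, N]%classic `[- N, N]%classic
    (measurable_itv _) (measurable_itv _).
  have f : mu `[- N, N] \is a fin_num by rewrite ge0_fin_numE// mu_itv_lty.
  have e' : leb2 (box N) = (fine (mu `[- N, N]) * fine (mu `[- N, N]))%:E.
    by rewrite EFinM (fineK f); exact: e.
  by rewrite [X in (X < _)%E]e' ltry.
apply/integrableP; split; first by apply/measurable_EFinP.
rewrite /= (eq_integral (cst 1%E)); last by move=> z _; rewrite normr1.
by rewrite integral_cst ?mul1e//; exact: measurable_box.
Qed.

Lemma L2_locint2 u : L2 u -> locint2 u.
Proof.
move=> lu; split; first exact: lu.1.
move=> N.
have i1 : leb2.-integrable (box N) (EFin \o (fun z => u z ^+ 2)).
  by apply: integrableS (L2_integrable lu) => //; exact: measurable_box.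
have i2 := @integrable_box1 N.
apply: (@integrable_le _ _ _ leb2 (box N) u (fun z => u z ^+ 2 + 1)).
- exact: measurable_box.
- by apply: measurable_funTS; exact: lu.1.
- by apply: integrableD_real => //; exact: measurable_box.
- move=> z _; rewrite ler_norml; apply/andP; split.
    have := sqr_ge0 (u z + 1); rewrite expr2; nra.
  have := sqr_ge0 (u z - 1); rewrite expr2; nra.
Qed.

Lemma aclD u v g h : acl u g -> acl v h ->
  acl (fun z => u z + v z) (fun z => g z + h z).
Proof. by apply: ae_sub2 => y; exact: acl1D. Qed.

Lemma aclZ k u g : acl u g -> acl (fun z => k * u z) (fun z => k * g z).
Proof. by apply: ae_sub => y; exact: acl1Z. Qed.

Lemma acl_cst (k : R) : acl (fun _ : R * R => k) (fun=> 0).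
Proof. by apply: aeW => y; exact: acl1_cst. Qed.

Definition gpos u g : R * R -> R := fun z => if 0 < u z then g z else 0.

Lemma acl_pos u g : acl u g -> acl (posp u) (gpos u g).
Proof. by apply: ae_sub => y; exact: acl1_posp. Qed.

Definition cutf (al be : R -> R) u : R * R -> R := fun z => al z.1 * (be z.2 * u z).

Lemma acl_cut1 (al al' be : R -> R) u g : (forall x : R, is_derive x 1 al (al' x)) ->
  continuous al' -> acl u g ->
  acl (cutf al be u) (fun z => cutf al' be u z + cutf al be g z).
Proof.
move=> dal cal'; apply: ae_sub => y ay.
exact: (acl1_mul dal cal' (acl1Z (be y) ay)).
Qed.

Lemma acl_cut2 (al be be' : R -> R) u g : (forall x : R, is_derive x 1 be (be' x)) ->
  continuous be' -> acl (swp u) (swp g) ->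
  acl (swp (cutf al be u)) (swp (fun z => cutf al be' u z + cutf al be g z)).
Proof.
move=> dbe cbe'; apply: ae_sub => y ay.
have := acl1Z (al y) (acl1_mul dbe cbe' ay).
congr acl1; apply/funext => x; rewrite /swp /cutf /= mulrDr.
by congr (_ * _ + _ * _).
Qed.

Definition aff (k s t : R) u : R * R -> R := fun z => u (k * z.1 + s, k * z.2 + t).

Lemma acl_aff k s t u g : 0 < k -> acl u g -> acl (aff k s t u) (fun z => k * aff k s t g z).
Proof.
move=> k0 a; have := ae_affine t k0 a; apply: ae_sub => y ay.
exact: (acl1_affine s k0 ay).
Qed.

Lemma measurable_aff k s t u : measurable_fun setT u -> measurable_fun setT (aff k s t u).
Proof.
move=> mu'; apply: (measurableT_comp mu').
apply: measurable_fun_pair.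
  exact: (measurable_fst_comp (measurable_affine k s)).
exact: (measurable_snd_comp (measurable_affine k t)).
Qed.

Lemma L2_aff k s t u : 0 < k -> L2 u -> L2 (aff k s t u).
Proof.
move=> k0 [mu' iu]; split; first exact: measurable_aff.
rewrite (@ge0_integral_affine2 _ (fun z => (u z ^+ 2)%:E))//.
- by rewrite lte_mul_pinfty// lee_fin -exprVn exprn_ge0// invr_ge0 ltW.
- by apply/measurable_EFinP; exact: measurable_funX.
- by move=> z; rewrite lee_fin sqr_ge0.
Qed.

(** By [sob_weak] and [weak_sob] this is H^1 together with a chosen weak gradient. In this form
    truncation, cut-off and dilation reduce to one-dimensional rules. *)
Definition sob u g1 g2 := [/\ L2 u, L2 g1, L2 g2, acl u g1 & acl (swp u) (swp g2)].

Lemma sob_weak u g1 g2 : sob u g1 g2 -> weak_grad u g1 g2.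
Proof.
move=> [lu l1 l2 a1 a2].
by apply/(weak_gradP (L2_locint2 lu) (L2_locint2 l1) (L2_locint2 l2)).
Qed.

Lemma weak_sob u g1 g2 : L2 u -> L2 g1 -> L2 g2 -> weak_grad u g1 g2 -> sob u g1 g2.
Proof.
move=> lu l1 l2.
by move=> /(weak_gradP (L2_locint2 lu) (L2_locint2 l1) (L2_locint2 l2))[a1 a2].
Qed.

Lemma sob_H1 u g1 g2 : sob u g1 g2 -> H1 u.
Proof.
move=> s; have [lu l1 l2 _ _] := s; split => //.
by exists g1, g2; split => //; split => //; exact: sob_weak.
Qed.

Lemma H1_sob u : H1 u -> exists g1 g2, sob u g1 g2.
Proof.
by move=> [lu [g1 [g2 [l1 [l2 w]]]]]; exists g1, g2; exact: weak_sob.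
Qed.

Lemma ae_swap (P : R * R -> Prop) : {ae leb2, forall z, P z} ->
  {ae leb2, forall z, P (z.2, z.1)}.
Proof.
move=> [N [mN N0 PN]]; pose sw (z : R * R) : R * R := (z.2, z.1).
have mN' : measurable (sw @^-1` N).
  by rewrite -[X in measurable X]setTI; exact: measurable_flip.
exists (sw @^-1` N); split => //; last by move=> z /= Pz; exact: PN.
have e := @integral_indic _ _ _ leb2 setT measurableT _ mN'.
have e' := @integral_indic _ _ _ leb2 setT measurableT _ mN.
rewrite !setIT in e e'; rewrite -[LHS]e -[RHS]N0 -[RHS]e'.
rewrite -[RHS]ge0_integral_swap//.
by apply/measurable_EFinP.
Qed.

Lemma acl_unique u g g' : measurable_fun setT g -> measurable_fun setT g' ->
  acl u g -> acl u g' -> {ae leb2, forall z, g z = g' z}.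
Proof.
move=> mg mg' a a'; apply: ae_eq_lines => //.
by apply: ae_sub2 a a' => y; exact: acl1_unique.
Qed.

Lemma sob_unique u g1 g2 h1 h2 : sob u g1 g2 -> sob u h1 h2 ->
  {ae leb2, forall z, g1 z = h1 z} /\ {ae leb2, forall z, g2 z = h2 z}.
Proof.
move=> [_ l1 l2 a1 a2] [_ k1 k2 b1 b2]; split.
  by apply: (acl_unique l1.1 k1.1 a1 b1).
have := ae_swap (acl_unique (measurable_swp l2.1) (measurable_swp k2.1) a2 b2).
by apply: ae_sub => -[x y].
Qed.

Definition energy g1 g2 : R := \int[leb2]_z (g1 z ^+ 2 + g2 z ^+ 2).

Lemma energy_integrable g1 g2 : L2 g1 -> L2 g2 ->
  leb2.-integrable setT (EFin \o (fun z => g1 z ^+ 2 + g2 z ^+ 2)).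
Proof. by move=> l1 l2; apply: integrableD_real => //; exact: L2_integrable. Qed.

(** Weak gradients are unique almost everywhere, so the infimum runs over a single value. *)
Lemma dirichletE u g1 g2 : sob u g1 g2 -> dirichlet setT u = (energy g1 g2)%:E.
Proof.
move=> s; have [lu l1 l2 _ _] := s.
rewrite /dirichlet (_ : [set e | _] = [set (energy g1 g2)%:E]) ?ereal_inf1//.
apply/seteqP; split => [e /= [h1 [h2 [k1 [k2 [w ->]]]]]|_ /= ->].
  rewrite (EFin_Rintegral measurableT (energy_integrable k1 k2)); congr EFin.
  have [e1 e2] := sob_unique s (weak_sob lu k1 k2 w).
  apply: ae_eq_Rintegral => //.
  - exact: integrable_measurable (energy_integrable k1 k2).
  - exact: integrable_measurable (energy_integrable l1 l2).
  - by apply: ae_sub2 e1 e2 => z -> -> _.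
exists g1, g2; split => //; split => //; split; first exact: sob_weak.
by rewrite (EFin_Rintegral measurableT (energy_integrable l1 l2)).
Qed.

Lemma sobZ k u g1 g2 : sob u g1 g2 ->
  sob (fun z => k * u z) (fun z => k * g1 z) (fun z => k * g2 z).
Proof.
move=> [lu l1 l2 a1 a2]; split; [exact: L2Z..| |]; first exact: aclZ.
exact: (aclZ k a2).
Qed.

Lemma sobD u g1 g2 v h1 h2 : sob u g1 g2 -> sob v h1 h2 ->
  sob (fun z => u z + v z) (fun z => g1 z + h1 z) (fun z => g2 z + h2 z).
Proof.
move=> [lu l1 l2 a1 a2] [lv k1 k2 b1 b2]; split; [exact: L2D..| |]; first exact: aclD.
exact: (aclD a2 b2).
Qed.

Lemma measurable_posp u : measurable_fun setT u -> measurable_fun setT (posp u).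
Proof. by move=> mu'; exact: measurable_maxr. Qed.

Lemma measurable_gpos u g : measurable_fun setT u -> measurable_fun setT g ->
  measurable_fun setT (gpos u g).
Proof.
by move=> mu' mg; apply: measurable_fun_ifT => //; exact: measurable_fun_ltr.
Qed.

Lemma posp_le u z : `|posp u z| <= `|u z|.
Proof. by rewrite /posp; case: (leP 0 (u z)) => h; rewrite ?normr0. Qed.

Lemma gpos_le u g z : `|gpos u g z| <= `|g z|.
Proof. by rewrite /gpos; case: ifPn => h; rewrite ?normr0. Qed.

Lemma sob_pos u g1 g2 : sob u g1 g2 -> sob (posp u) (gpos u g1) (gpos u g2).
Proof.
move=> [lu l1 l2 a1 a2]; split.
- by apply: (L2_le lu); [apply: measurable_posp; exact: lu.1|exact: posp_le].
- by apply: (L2_le l1); [apply: measurable_gpos; [exact: lu.1|exact: l1.1]|exact: gpos_le].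
- by apply: (L2_le l2); [apply: measurable_gpos; [exact: lu.1|exact: l2.1]|exact: gpos_le].
- exact: acl_pos.
- exact: (acl_pos a2).
Qed.

Lemma sob_aff k s t u g1 g2 : 0 < k -> sob u g1 g2 ->
  sob (aff k s t u) (fun z => k * aff k s t g1 z) (fun z => k * aff k s t g2 z).
Proof.
move=> k0 [lu l1 l2 a1 a2]; split.
- exact: L2_aff.
- by apply: L2Z; exact: L2_aff.
- by apply: L2Z; exact: L2_aff.
- exact: acl_aff.
- exact: (acl_aff t s k0 a2).
Qed.

End sobolev.

(** * Exponential integrability *)

Section gagliardo.
Context {R : realType}.
Notation mu := (@lebesgue_measure R).
Notation leb2 := (@leb2 R).
Implicit Types (u v g : R * R -> R).

Lemma L2_lines u : L2 u -> {ae mu, forall y, (\int[mu]_x (u (x, y) ^+ 2)%:E < +oo)%E}.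
Proof.
move=> lu; have [H _ _] := Rfubini (L2_integrable lu).
apply: ae_sub H => y /integrableP[_].
by under eq_integral do rewrite /= ger0_norm ?sqr_ge0//.
Qed.

Lemma acl_line_bound u g : L2 u -> measurable_fun setT g -> acl u g ->
  {ae leb2, forall z, (`|u z|%:E <= \int[mu]_s `|g (s, z.2)|%:E)%E}.
Proof.
move=> lu mg a.
have mag : measurable_fun setT (fun z => `|g z|%:E).
  by apply/measurable_EFinP; exact: measurableT_comp.
have mA : measurable_fun setT (fun y => \int[mu]_s `|g (s, y)|%:E)%E.
  exact: (measurable_fun_fubini_tonelli_G (m1 := mu) _ mag (fun z => abse_ge0 (g z)%:E)).
have mA2 : measurable_fun setT (fun z : R * R => \int[mu]_s `|g (s, z.2)|%:E)%E.
  exact: (measurableT_comp mA measurable_snd).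
apply: ae_of_lines.
  have mU : measurable_fun setT (fun z => `|u z|%:E).
    by apply/measurable_EFinP; apply: measurableT_comp => //; exact: lu.1.
  rewrite (_ : [set z | _] = setT `&` [set z | (\int[mu]_s `|g (s, z.2)|%:E < `|u z|%:E)%E]).
    exact: emeasurable_fun_lt.
  by rewrite setTI; apply/seteqP; split => z /=; [move=> /negP; rewrite -ltNge|rewrite ltNge => /negP].
apply: ae_sub2 a (L2_lines lu) => y ay uy.
exact: (acl1_bound ay uy).
Qed.

(** |u(x, y)| is bounded by a function A(y), integrating along the horizontal line, and by a
    function B(x), integrating along the vertical one. Hence u^2 <= A(y) B(x), whose integral
    factorises. *)
Lemma gagliardo_nirenberg u g1 g2 : L2 u -> measurable_fun setT g1 ->
  measurable_fun setT g2 -> acl u g1 -> acl (swp u) (swp g2) ->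
  (\int[leb2]_z (u z ^+ 2)%:E <=
   (\int[leb2]_z `|g1 z|%:E) * (\int[leb2]_z `|g2 z|%:E))%E.
Proof.
move=> lu mg1 mg2 a1 a2.
have H1 := acl_line_bound lu mg1 a1.
have H2 := ae_swap (acl_line_bound (L2_swp lu) (measurable_swp mg2) a2).
pose A y := (\int[mu]_s `|g1 (s, y)|%:E)%E.
pose B x := (\int[mu]_s `|g2 (x, s)|%:E)%E.
have ma1 : measurable_fun setT (fun z => `|g1 z|%:E).
  by apply/measurable_EFinP; exact: measurableT_comp.
have ma2 : measurable_fun setT (fun z => `|g2 z|%:E).
  by apply/measurable_EFinP; exact: measurableT_comp.
have mA : measurable_fun setT A.
  exact: (measurable_fun_fubini_tonelli_G (m1 := mu) _ ma1 (fun z => abse_ge0 (g1 z)%:E)).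
have mB : measurable_fun setT B.
  exact: (measurable_fun_fubini_tonelli_F (m2 := mu) _ ma2 (fun z => abse_ge0 (g2 z)%:E)).
have A0 y : (0 <= A y)%E by exact: integral_ge0.
have B0 x : (0 <= B x)%E by exact: integral_ge0.
have mAB : measurable_fun setT (fun z : R * R => A z.2 * B z.1)%E.
  by apply: emeasurable_funM; [exact: (measurableT_comp mA measurable_snd)|exact: (measurableT_comp mB measurable_fst)].
have e1 := fubini_tonelli2 (m1 := mu) (m2 := mu) _ ma1 (fun z => abse_ge0 (g1 z)%:E).
have e2 := fubini_tonelli1 (m1 := mu) (m2 := mu) _ ma2 (fun z => abse_ge0 (g2 z)%:E).
rewrite [X in (_ <= X * _)%E]e1 [X in (_ <= _ * X)%E]e2.
apply: (@le_trans _ _ (\int[leb2]_z (A z.2 * B z.1))%E).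
  apply: ae_ge0_le_integral => //.
  - by move=> z _; rewrite lee_fin sqr_ge0.
  - by apply/measurable_EFinP; apply: measurable_funX; exact: lu.1.
  - by move=> z _; exact: mule_ge0.
  - apply: ae_sub2 H1 H2 => -[x y] /= h1 h2 _.
    rewrite -[(u (x, y) ^+ 2)%R]real_normK ?num_real// expr2 EFinM.
    by apply: lee_pmul.
have AB0 (z : R * R) : (0 <= A z.2 * B z.1)%E by exact: mule_ge0.
rewrite [X in (X <= _)%E](fubini_tonelli1 (m1 := mu) (m2 := mu) _ mAB AB0).
rewrite le_eqVlt; apply/orP; left; apply/eqP.
rewrite /fubini_F /=.
transitivity (\int[mu]_x ((\int[mu]_y A y) * B x))%E.
  by apply: eq_integral => x _; rewrite ge0_integralZr.
by rewrite ge0_integralZl//; exact: integral_ge0.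
Qed.

End gagliardo.

Section trudinger_moser_step.
Context {R : realType}.
Notation mu := (@lebesgue_measure R).
Notation leb2 := (@leb2 R).
Implicit Types (u v g : R * R -> R).

Lemma measurable_above v (t : R) : measurable_fun setT v ->
  measurable_fun setT (fun z => (t < v z)%R%:R : R).
Proof.
move=> mv.
rewrite (_ : (fun _ => _) = fun z => if t < v z then 1 else 0); last first.
  by apply/funext => z; case: ifPn.
by apply: measurable_fun_ifT => //; exact: measurable_fun_ltr.
Qed.

Lemma integrable_above v (t : R) : L2 v -> 0 < t ->
  leb2.-integrable setT (EFin \o (fun z => (t < v z)%R%:R)).
Proof.
move=> lv t0.
apply: (integrable_le measurableT _
  (integrableZ_real (t ^- 2) measurableT (L2_integrable lv))).
  by apply: measurable_above; exact: lv.1.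
move=> z _; case: ltP => h; rewrite ?normr0 ?normr1; last first.
  by rewrite mulr_ge0 ?sqr_ge0// -exprVn exprn_ge0// invr_ge0 ltW.
rewrite -ler_pdivrMl ?invr_gt0 ?exprn_gt0// invrK mulr1.
by rewrite lerXn2r// ?nnegrE ?ltW// (lt_trans t0).
Qed.

(** Cauchy-Schwarz on the set {k = 1}, from the nonnegativity for all c of the integral of (|g| - c
    k)^2, a quadratic polynomial in c. *)
Lemma cauchy_schwarz_support g (k : R * R -> R) : L2 g ->
  leb2.-integrable setT (EFin \o k) -> (forall z, k z = 0 \/ k z = 1) ->
  (forall z, k z = 0 -> g z = 0) ->
  leb2.-integrable setT (EFin \o (fun z => `|g z|)) /\
  (\int[leb2]_z `|g z|) ^+ 2 <= (\int[leb2]_z k z) * \int[leb2]_z (g z ^+ 2).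
Proof.
move=> lg ik k01 kg.
have ig2 := L2_integrable lg.
have ig : leb2.-integrable setT (EFin \o (fun z => `|g z|)).
  apply: (integrable_le measurableT _ (integrableD_real measurableT ik ig2)).
    by apply: measurableT_comp => //; exact: lg.1.
  move=> z _; rewrite normr_id; case: (k01 z) => kz.
    by rewrite (kg z kz) normr0 kz expr0n addr0.
  rewrite kz ler_norml; apply/andP; split.
    have := sqr_ge0 (g z + 1); rewrite expr2; nra.
  have := sqr_ge0 (g z - 1); rewrite expr2; nra.
split => //.
set n := \int[leb2]_z `|g z|; set m := \int[leb2]_z k z; set q := \int[leb2]_z (g z ^+ 2).
have m0 : 0 <= m.
  by apply: Rintegral_ge0 => z _; case: (k01 z) => ->.
have n0 : 0 <= n by apply: Rintegral_ge0.
have key (c : R) : 0 <= q - 2 * c * n + c ^+ 2 * m.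
  have -> : q - 2 * c * n + c ^+ 2 * m =
      \int[leb2]_z (g z ^+ 2 - (2 * c) * `|g z| + c ^+ 2 * k z).
    rewrite RintegralD//; [|apply: integrableB_real => //|]; [|exact: integrableZ_real..].
    by rewrite RintegralB// ?RintegralZl//; exact: integrableZ_real.
  apply: Rintegral_ge0 => z _; case: (k01 z) => kz; rewrite kz.
    by rewrite (kg z kz) normr0 expr0n !mulr0 subr0 addr0.
  have -> : g z ^+ 2 - 2 * c * `|g z| + c ^+ 2 * 1 = (`|g z| - c) ^+ 2.
    by rewrite -[g z ^+ 2]real_normK ?num_real//; ring.
  exact: sqr_ge0.
have [m_eq0|mn0] := eqVneq m 0; last first.
  have mp : 0 < m by rewrite lt_neqAle eq_sym mn0.
  have := key (n / m).
  have -> : q - 2 * (n / m) * n + (n / m) ^+ 2 * m = q - n ^+ 2 / m by field.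
  by rewrite subr_ge0 ler_pdivrMr// mulrC.
rewrite m_eq0 mul0r.
have q0 : 0 <= q by apply: Rintegral_ge0 => z _; exact: sqr_ge0.
suff -> : n = 0 by rewrite expr0n.
apply/eqP; rewrite eq_le n0 andbT leNgt; apply/negP => np.
(* When m = 0 the polynomial is affine in c; this value of c gives it the negative value - q - 2. *)
have := key ((q + 1) / n); rewrite m_eq0 mulr0 addr0.
have -> : q - 2 * ((q + 1) / n) * n = - q - 2 by field; rewrite gt_eqF.
lra.
Qed.

Variables (v g1 g2 : R * R -> R).
Hypotheses (sv : sob v g1 g2).

Definition level (t : R) := \int[leb2]_z ((t < v z)%R%:R : R).
(** For t <= s, the Dirichlet energy on {t < v <= s}. *)
Definition slice (t s : R) :=
  \int[leb2]_z ((g1 z ^+ 2 + g2 z ^+ 2) * ((t < v z)%R%:R - (s < v z)%R%:R)).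

Lemma integrable_energy_above (t : R) :
  leb2.-integrable setT (EFin \o (fun z => (g1 z ^+ 2 + g2 z ^+ 2) * (t < v z)%R%:R)).
Proof.
have [lv l1 l2 _ _] := sv.
apply: (integrable_le measurableT _ (energy_integrable l1 l2)).
  apply: measurable_funM; last by apply: measurable_above; exact: lv.1.
  exact: integrable_measurable (energy_integrable l1 l2).
move=> z _; rewrite normrM ger0_norm ?addr_ge0 ?sqr_ge0//.
by rewrite ler_piMr ?addr_ge0 ?sqr_ge0//; case: ltP; rewrite ?normr0 ?normr1.
Qed.

Lemma sliceE (t s : R) : slice t s =
  \int[leb2]_z ((g1 z ^+ 2 + g2 z ^+ 2) * (t < v z)%R%:R) -
  \int[leb2]_z ((g1 z ^+ 2 + g2 z ^+ 2) * (s < v z)%R%:R).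
Proof.
rewrite -RintegralB//; [|exact: integrable_energy_above..].
by apply: eq_Rintegral => z _; rewrite mulrBr.
Qed.

(** Gagliardo's inequality for the truncation w = min((v - t)^+, h): w equals h on {v > t + h}, and
    its gradient lives on the slice {t < v <= t + h}, where Cauchy-Schwarz bounds the L^1 norms of
    both derivatives by the measure of {v > t} and the energy of the slice. *)
Lemma level_step (t h : R) : 0 < t -> 0 < h ->
  h ^+ 2 * level (t + h) <= level t * slice t (t + h).
Proof.
move=> t0 h0; have [lv l1 l2 a1 a2] := sv.
have mv := lv.1.
have th : t < t + h by rewrite ltrDl.
pose k z : R := (t < v z)%R%:R - (t + h < v z)%R%:R.
have kE z : k z = if (t < v z) && (v z <= t + h) then 1 else 0.
  rewrite /k; case: (ltP t (v z)) => h1; case: (leP (v z) (t + h)) => h2 //=; rewrite ?subr0 ?subrr//.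
  by have := lt_le_trans (lt_trans th h2) h1; rewrite ltxx.
(* The truncation as a difference of two positive parts, to which [acl_pos] applies. *)
pose w z := posp (fun z => v z - t) z - posp (fun z => v z - (t + h)) z.
have mk : measurable_fun setT k by apply: measurable_funB; exact: measurable_above.
have lG g : L2 g -> L2 (fun z => k z * g z).
  move=> lg; apply: (@L2_bounded_mul _ _ 1) => // z.
  by rewrite kE; case: ifPn; rewrite ?normr0 ?normr1.
have lw : L2 w.
  apply: (L2_le lv).
    by apply: measurable_funB; apply: measurable_posp; apply: measurable_funB.
  move=> z; rewrite /w /posp /Num.max; rewrite !subr_lt0.
  case: ifPn => h1; case: ifPn => h2; rewrite ?subrr ?normr0//.
  - by have := lt_trans h1 th; move: h2; rewrite -leNgt => /lt_le_trans /[apply]; rewrite ltxx.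
  - rewrite -leNgt in h1; rewrite subr0 !ger0_norm; lra.
  - rewrite -leNgt in h1; rewrite -leNgt in h2; rewrite !ger0_norm; lra.
have aw g : acl v g -> acl w (fun z => k z * g z).
  move=> a.
  have b1 := acl_pos (aclD a (acl_cst (- t))).
  have b2 := acl_pos (aclD a (acl_cst (- (t + h)))).
  have := aclD b1 (aclZ (-1) b2).
  congr acl; apply/funext => z; rewrite /w ?mulN1r// /gpos /k !subr_gt0 !addr0.
  by case: (t < v _); case: (t + h < v _); rewrite /=; ring.
have b1 := aw _ a1.
have b2 : acl (swp w) (swp (fun z => k z * g2 z)).
  have c1 := acl_pos (aclD a2 (acl_cst (- t))).
  have c2 := acl_pos (aclD a2 (acl_cst (- (t + h)))).
  have := aclD c1 (aclZ (-1) c2).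
  congr acl; apply/funext => z; rewrite /swp /w ?mulN1r// /gpos /k !subr_gt0 !addr0.
  by case: (t < v _); case: (t + h < v _); rewrite /=; ring.
have H := gagliardo_nirenberg lw (lG _ l1).1 (lG _ l2).1 b1 b2.
have ik : leb2.-integrable setT (EFin \o (fun z => (t < v z)%R%:R)).
  exact: integrable_above.
have k01 z : ((t < v z)%R%:R : R) = 0 \/ ((t < v z)%R%:R : R) = 1.
  by case: ltP; [right|left].
have kz g z : ((t < v z)%R%:R : R) = 0 -> k z * g z = 0.
  by rewrite kE; case: ltP => //= _ /eqP; rewrite ?oner_eq0// mul0r.
have [n1 c1] := cauchy_schwarz_support (lG _ l1) ik k01 (kz g1).
have [n2 c2] := cauchy_schwarz_support (lG _ l2) ik k01 (kz g2).
rewrite (EFin_Rintegral measurableT n1) (EFin_Rintegral measurableT n2) in H.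
rewrite (EFin_Rintegral measurableT (L2_integrable lw)) -EFinM lee_fin in H.
rewrite -/(level t) in c1 c2.
have c3 : \int[leb2]_z ((k z * g1 z) ^+ 2) + \int[leb2]_z ((k z * g2 z) ^+ 2) = slice t (t + h).
  rewrite -RintegralD//; [|exact: L2_integrable (lG _ l1)|exact: L2_integrable (lG _ l2)].
  apply: eq_Rintegral => z _; rewrite -/(k z) kE.
  by case: ifPn => _; rewrite ?mul0r ?mul1r ?mulr1 ?mulr0// expr0n addr0.
have c4 : h ^+ 2 * level (t + h) <= \int[leb2]_z (w z ^+ 2).
  have ia : leb2.-integrable setT (EFin \o (fun z => (t + h < v z)%R%:R)).
    by apply: integrable_above => //; exact: addr_gt0.
  rewrite /level -RintegralZl//; apply: le_Rintegral => //.
  - exact: integrableZ_real.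
  - exact: L2_integrable.
  - move=> z _; case: ltP => hz; last by rewrite mulr0 sqr_ge0.
    rewrite /w /posp !max_l; [|lra|lra].
    by rewrite mulr1 (_ : _ - _ = h)//; lra.
have lt0 : 0 <= level t.
  by apply: Rintegral_ge0 => z _; case: ltP.
move: c1 c2 H c3 c4 lt0.
move: (\int[leb2]_z `|k z * g1 z|) (\int[leb2]_z `|k z * g2 z|) => r1 r2.
move: (\int[leb2]_z ((k z * g1 z) ^+ 2)) (\int[leb2]_z ((k z * g2 z) ^+ 2)) => q1 q2.
move=> c1 c2 H <- c4 lt0.
apply: (le_trans c4); apply: (le_trans H).
have := sqr_ge0 (r1 - r2); have := sqr_ge0 (r1 + r2).
rewrite mulrDr; rewrite !expr2 in c1 c2 *; nra.
Qed.

End trudinger_moser_step.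

Section trudinger_moser.
Context {R : realType}.
Notation mu := (@lebesgue_measure R).
Notation leb2 := (@leb2 R).
Implicit Types (u v g : R * R -> R).

(** The first two terms of the binomial expansion. The factor [n.+1] on the left is what supplies
    the 1/N! in [level_decay]. *)
Lemma expn_add_ge (S e : R) (n : nat) : 0 <= S -> 0 <= e ->
  S ^+ n.+1 + n.+1%:R * e * S ^+ n <= (S + e) ^+ n.+1.
Proof.
move=> S0 e0; elim: n => [|n IH]; first by rewrite !expr1 expr0 mul1r mulr1.
rewrite [leRHS]exprSr.
apply: (@le_trans _ _ ((S ^+ n.+1 + n.+1%:R * e * S ^+ n) * (S + e))); last first.
  by apply: ler_wpM2r => //; exact: addr_ge0.
have Sn : 0 <= S ^+ n by exact: exprn_ge0.
rewrite !exprS -[n.+2%:R]natr1; move: (S ^+ n) (n.+1%:R : R) (ler0n R n.+1) Sn => s k k0 s0.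
rewrite -subr_ge0 [X in 0 <= X](_ : _ = k * (e * e * s)); first by rewrite !mulr_ge0.
by ring.
Qed.

Lemma bin_le_expn2 n k : ('C(n, k) <= 2 ^ n)%N.
Proof.
elim: n k => [|n IH] [|k]; rewrite ?bin0 ?expn_gt0// ?bin0n//.
by rewrite binS expnS mul2n -addnn leq_add.
Qed.

(** From one level to the next v^2 grows by 1, so exp(al v^2) changes by the bounded factor
    exp(al). *)
Let sq (k : nat) : R := Num.sqrt k%:R.

Lemma sq_gt0 k : (0 < k)%N -> 0 < sq k.
Proof. by move=> k0; rewrite sqrtr_gt0 ltr0n. Qed.

(** The difference of the two roots is 1 divided by their sum, hence at least 1 / (2 sqrt(k+1)). *)
Lemma sq_step k : (0 < k)%N -> 0 < sq k.+1 - sq k /\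
  (4 * k.+1%:R)^-1 <= (sq k.+1 - sq k) ^+ 2.
Proof.
move=> k0; have a0 := sq_gt0 k0; have b0 : 0 < sq k.+1 by exact: sq_gt0.
have a2 : sq k ^+ 2 = k%:R by rewrite sqr_sqrtr.
have b2 : sq k.+1 ^+ 2 = k.+1%:R by rewrite sqr_sqrtr.
have ab : sq k < sq k.+1 by rewrite ltr_sqrt ?ltr0n// ltr_nat.
split; first by rewrite subr_gt0.
rewrite -b2; rewrite -natr1 -a2 in b2.
move: a0 b0 ab b2; move: (sq k) (sq k.+1) => a b a0 b0 ab b2.
have h : (2 * b)^-1 <= b - a.
  rewrite -[_^-1]mul1r ler_pdivrMr ?mulr_gt0//.
  by rewrite !expr2 in b2; nra.
have -> : (4 * b ^+ 2)^-1 = (2 * b)^-1 ^+ 2 by rewrite exprVn exprMn -natrX.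
by rewrite lerXn2r// ?nnegrE ?invr_ge0 ?mulr_ge0 ?subr_ge0 ?ltW.
Qed.

Variables (v g1 g2 : R * R -> R).
Hypotheses (sv : sob v g1 g2).

Let e2 z := g1 z ^+ 2 + g2 z ^+ 2.
Let lev := level v.
Let sl := slice v g1 g2.

Lemma level_ge0 t : 0 <= lev t.
Proof. by apply: Rintegral_ge0 => z _; case: ltP. Qed.

Lemma slice_ge0 t s : t <= s -> 0 <= sl t s.
Proof.
move=> ts; apply: Rintegral_ge0 => z _.
apply: mulr_ge0; first by rewrite addr_ge0 ?sqr_ge0.
rewrite subr_ge0 ler_nat; case: (ltP s (v z)) => // h.
by rewrite (le_lt_trans ts h).
Qed.

(** Iterating [level_step] multiplies the measure by 4 (k+1) s_k at each level, s_k being the energy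
    of the slice. The factors k+1 alone would grow like a factorial; but the slices are disjoint, so
    the product of N of the s_k is at most S^N / N! with S their sum, and only a binomial
    coefficient is left. *)
Lemma level_decay m N : (0 < m)%N ->
  lev (sq (m + N)) <= lev (sq m) * (4 ^+ N * 'C(m + N, N)%:R * sl (sq m) (sq (m + N)) ^+ N).
Proof.
move=> m0; elim: N => [|N IH]; first by rewrite addn0 bin0 !expr0 !mulr1.
rewrite addnS; set k := (m + N)%N in IH *.
have k0 : (0 < k)%N by rewrite addn_gt0 m0.
have [h0 hk] := sq_step k0.
have := level_step sv (sq_gt0 k0) h0.
have -> : sq k + (sq k.+1 - sq k) = sq k.+1 by rewrite addrC subrK.
rewrite -/lev -/sl => H.
have mk : sq m <= sq k by rewrite ler_sqrt ?ler_nat ?leq_addr.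
have kk : sq k <= sq k.+1 by rewrite ltW// -subr_gt0.
have add : sl (sq m) (sq k.+1) = sl (sq m) (sq k) + sl (sq k) (sq k.+1).
  by rewrite /sl !(sliceE sv); ring.
have S0 := slice_ge0 mk; have E0 := slice_ge0 kk.
have step : lev (sq k.+1) <= 4 * k.+1%:R * (lev (sq k) * sl (sq k) (sq k.+1)).
  have K0 : 0 < 4 * k.+1%:R :> R by rewrite mulr_gt0 ?ltr0n.
  rewrite -ler_pdivrMl//; apply: le_trans H.
  by rewrite ler_wpM2r ?level_ge0.
apply: (le_trans step).
apply: (@le_trans _ _ (4 * k.+1%:R * ((lev (sq m) * (4 ^+ N * 'C(k, N)%:R * sl (sq m) (sq k) ^+ N))
    * sl (sq k) (sq k.+1)))).
  by rewrite ler_wpM2l ?mulr_ge0// ler_wpM2r.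
rewrite add.
have Hb : k.+1%:R * 'C(k, N)%:R = N.+1%:R * 'C(k.+1, N.+1)%:R :> R.
  by rewrite -!natrM mul_bin_diag.
have Hp := expn_add_ge N S0 E0.
have L0 := level_ge0 (sq m).
rewrite [leLHS](_ : _ = lev (sq m) * (4 ^+ N.+1 * (k.+1%:R * 'C(k, N)%:R) *
    (sl (sq m) (sq k) ^+ N * sl (sq k) (sq k.+1)))); last by rewrite exprS; ring.
rewrite Hb [leLHS](_ : _ = lev (sq m) * (4 ^+ N.+1 * 'C(k.+1, N.+1)%:R *
    (N.+1%:R * sl (sq k) (sq k.+1) * sl (sq m) (sq k) ^+ N))); last by ring.
rewrite ler_wpM2l// ler_wpM2l ?mulr_ge0 ?exprn_ge0//.
by apply: le_trans Hp; rewrite lerDr exprn_ge0.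
Qed.

Let tail (t : R) := \int[leb2]_z (e2 z * (t < v z)%R%:R).

Lemma tail_cvg0 : tail (sq m) @[m --> \oo] --> (0 : R).
Proof.
have [lv l1 l2 _ _] := sv.
have [||||_] := @dominated_cvg_Rintegral _ _ _ leb2 setT
  (fun m z => e2 z * (sq m < v z)%R%:R) (fun _ => 0) e2 measurableT.
- by move=> m; exact: integrable_measurable (integrable_energy_above sv (sq m)).
- move=> z _; apply: cvg_near_cst; near=> m.
  have -> : (sq m < v z) = false; last by rewrite mulr0.
  apply/negbTE; rewrite -leNgt; apply: (le_trans (ler_norm _)).
  rewrite -sqrtr_sqr; apply: ler_wsqrtr; rewrite ltW//.
  by near: m; exact: nbhs_infty_gtr.
- exact: energy_integrable.
- move=> m z _; rewrite normrM ger0_norm ?addr_ge0 ?sqr_ge0//.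
  by rewrite ler_piMr ?addr_ge0 ?sqr_ge0//; case: ltP; rewrite ?normr0 ?normr1.
by rewrite Rintegral_cst// mul0r.
Unshelve. all: by end_near. Qed.

(** The ratio in [level_decay] is proportional to the energy above the starting level, which is
    arbitrarily small for large m; hence every exponential rate is beaten. *)
Lemma exp_level_decay (al : R) : exists (m : nat) (C : R), [/\ (0 < m)%N, 0 <= C &
  forall N, expR (al * (m + N.+2)%:R) * lev (sq (m + N)) <= C / 2 ^+ N].
Proof.
(* The 16 is 4 from [level_decay], 2 from the bound 2^(m+N) on the binomial coefficient, and 2 for
   the final rate 2^-N; exp(-al) offsets the growth of the exponential weight. *)
pose r := expR (- al) / 16.
have r0 : 0 < r by rewrite divr_gt0 ?expR_gt0.
have : \forall m \near \oo, tail (sq m) <= r.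
  have /cvgrPdist_le/(_ r r0) := tail_cvg0.
  by apply: filterS => m; rewrite sub0r normrN; apply: le_trans; exact: ler_norm.
move=> [m0 _ Hm0]; pose m := m0.+1.
have Tm : tail (sq m) <= r by apply: Hm0; rewrite /= /m leqnSn.
exists m, (expR (al * (m + 2)%:R) * lev (sq m) * 2 ^+ m).
split => //; first by rewrite !mulr_ge0 ?expR_ge0 ?level_ge0 ?exprn_ge0.
move=> N.
have mN : sq m <= sq (m + N) by rewrite ler_sqrt ?ler_nat ?leq_addr.
have S0 := slice_ge0 mN.
have Sr : sl (sq m) (sq (m + N)) <= r.
  rewrite /sl (sliceE sv); apply: le_trans Tm; rewrite gerBl.
  apply: Rintegral_ge0 => z _; rewrite mulr_ge0 ?addr_ge0 ?sqr_ge0//.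
have D := level_decay N (ltn0Sn m0).
have L0 := level_ge0 (sq m).
have D2 : lev (sq (m + N)) <= lev (sq m) * (4 ^+ N * 2 ^+ (m + N) * r ^+ N).
  apply: (le_trans D); rewrite ler_wpM2l//; apply: ler_pM.
  - by rewrite mulr_ge0 ?exprn_ge0.
  - exact: exprn_ge0.
  - by rewrite ler_wpM2l ?exprn_ge0// -natrX ler_nat bin_le_expn2.
  - by rewrite lerXn2r// nnegrE ltW.
apply: (@le_trans _ _ (expR (al * (m + N.+2)%:R) *
  (lev (sq m) * (4 ^+ N * 2 ^+ (m + N) * r ^+ N)))).
  by rewrite ler_wpM2l ?expR_ge0.
have -> : expR (al * (m + N.+2)%:R) = expR (al * (m + 2)%:R) * expR al ^+ N.
  rewrite -expRM_natr -expRD; congr expR.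
  by rewrite -[N.+2]addn2 addnA addnAC natrD mulrDr.
rewrite /r expRN exprMn exprVn exprD.
have -> : 16 = 4 * 2 * 2 :> R by rewrite -!natrM.
rewrite exprVn !exprMn.
rewrite le_eqVlt; apply/orP; left; apply/eqP; field.
by rewrite !expf_neq0//= gt_eqF ?expR_gt0.
Qed.

(** For al >= 0 the integrand is at each point dominated by a single term of the series of exp(al
    (m+N+2)) times the indicator of {v > sqrt(m+N)}; the integrals of these terms decay
    geometrically. For al < 0 the exponential is at most 1 and the superlevel set has finite
    measure. *)
Lemma exp_integrable (al : R) : exists m : nat,
  leb2.-integrable setT (EFin \o (fun z => expR (al * v z ^+ 2) * (sq m < v z)%R%:R)).
Proof.
have [lv l1 l2 _ _] := sv.
wlog al0 : / 0 <= al.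
  move=> H; case: (leP 0 al) => [/H//|al0].
  exists 1%N.
  apply: (integrable_le measurableT _ (integrable_above lv (sq_gt0 (ltn0Sn 0)))).
    apply: measurable_funM; last by apply: measurable_above; exact: lv.1.
    apply: measurableT_comp; first exact: measurable_expR.
    by apply: measurable_funM => //; apply: measurable_funX; exact: lv.1.
  move=> z _; rewrite ger0_norm ?mulr_ge0 ?expR_ge0//.
  by rewrite ler_piMl// expR_le1 nmulr_rle0// sqr_ge0.
have [m [C [m0 C0 HC]]] := exp_level_decay al.
exists m.
have mF : measurable_fun setT (fun z => expR (al * v z ^+ 2) * (sq m < v z)%R%:R).
  apply: measurable_funM; last by apply: measurable_above; exact: lv.1.
  apply: measurableT_comp; first exact: measurable_expR.
  by apply: measurable_funM => //; apply: measurable_funX; exact: lv.1.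
apply/integrableP; split; first exact/measurable_EFinP.
pose T N z := (expR (al * (m + N.+2)%:R) * (sq (m + N) < v z)%R%:R)%:E : \bar R.
have T0 N z : (0 <= T N z)%E by rewrite lee_fin mulr_ge0 ?expR_ge0.
have mT N : measurable_fun setT (T N).
  apply/measurable_EFinP; apply: measurable_funM => //.
  by apply: measurable_above; exact: lv.1.
apply: (@le_lt_trans _ _ (\int[leb2]_z \sum_(0 <= N <oo) T N z)%E).
  apply: ge0_le_integral => //.
  - by apply: measurableT_comp => //; exact/measurable_EFinP.
  - exact: (@ge0_emeasurable_sum _ _ _ setT T xpredT (fun N z _ _ => T0 N z) (fun N _ => mT N)).
  - move=> z _ /=; rewrite ger0_norm ?mulr_ge0 ?expR_ge0//.
    case: (ltP (sq m) (v z)) => h; last by rewrite mulr0; exact: nneseries_ge0.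
    rewrite mulr1.
    have v0 : 0 < v z by apply: le_lt_trans h; exact: sqrtr_ge0.
    pose n := Num.truncn (v z ^+ 2 - m%:R).
    have mv : m%:R <= v z ^+ 2.
      by rewrite -[m%:R]sqr_sqrtr// ltW// ltrXn2r// ?nnegrE ?sqrtr_ge0// ltW.
    have n1 : n%:R <= v z ^+ 2 - m%:R by rewrite truncn_le subr_ge0.
    have n2 : v z ^+ 2 - m%:R < n.+1%:R by exact: truncnS_gt.
    (* The integer part n only gives sqrt(m+n) <= v, whereas the indicator in [T] asks for strict
       inequality. Stepping back to [n.-1] restores it, and v^2 < m + n + 1 remains below the
       exponent thanks to the [N.+2] in [T]. *)
    apply: (@le_trans _ _ (T n.-1 z)); last first.
      apply: le_trans (nneseries_lim_ge n.-1.+1 _) => //.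
      by rewrite big_nat_recr//= leeDr// sume_ge0.
    rewrite lee_fin.
    have -> : sq (m + n.-1) < v z.
      case: n n1 n2 => [|n] n1 n2; first by rewrite addn0.
      rewrite -[v z]ger0_norm ?ltW// -sqrtr_sqr ltr_sqrt ?exprn_gt0//.
      by move: n1; rewrite -natr1 natrD /=; lra.
    rewrite mulr1 ler_expR ler_wpM2l// natrD.
    have : n.+1%:R <= n.-1.+2%:R :> R by rewrite ler_nat; case: (n).
    by lra.
rewrite integral_nneseries//.
(* C / 2^N is rewritten as 2 C / 2^(N+1) to match [epsilon_trick0]. *)
apply: (@le_lt_trans _ _ (\sum_(N <oo) ((2 * C) / (2 ^ N.+1)%:R)%:E)%E).
  apply: lee_nneseries => [N _ _|N _]; first exact: integral_ge0.
  have ia : leb2.-integrable setT (EFin \o (fun z => (sq (m + N) < v z)%R%:R)).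
    by apply: integrable_above => //; apply: sq_gt0; rewrite addn_gt0 m0.
  rewrite /T (EFin_Rintegral measurableT (integrableZ_real _ measurableT ia)).
  rewrite RintegralZl// lee_fin; apply: (le_trans (HC N)).
  by rewrite natrX exprS invfM mulrACA divff// mul1r.
apply: (@le_lt_trans _ _ (2 * C)%:E); last exact: ltry.
by apply: epsilon_trick0; rewrite mulr_ge0.
Qed.

End trudinger_moser.

(** The factor [u ^+ 2] provides integrability where |u| is bounded, since the exponential alone is
    close to 1 where u is small. Where u or -u is large, this factor is absorbed by raising the
    exponent to |al| + 1. *)
Lemma trudinger_moser (R : realType) (u g1 g2 : R * R -> R) (al : R) : sob u g1 g2 ->
  (@leb2 R).-integrable setT (EFin \o (fun z => u z ^+ 2 * expR (al * u z ^+ 2))).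
Proof.
move=> su; have [lu _ _ _ _] := su.
have [m1 i1] := exp_integrable su (`|al| + 1).
have [m2 i2] := exp_integrable (sobZ (-1) su) (`|al| + 1).
have i3 := integrableZ_real (expR (`|al| * (m1 + m2)%:R)) measurableT (L2_integrable lu).
have mE : measurable_fun setT (fun z => u z ^+ 2 * expR (al * u z ^+ 2)).
  apply: measurable_funM; first by apply: measurable_funX; exact: lu.1.
  apply: measurableT_comp; first exact: measurable_expR.
  by apply: measurable_funM => //; apply: measurable_funX; exact: lu.1.
apply: (integrable_le measurableT _
  (integrableD_real measurableT (integrableD_real measurableT i1 i2) i3)) => //.
move=> z _; rewrite ger0_norm; last by apply: mulr_ge0; [exact: sqr_ge0|exact: expR_ge0].
rewrite mulN1r sqrrN.
have alu : al * u z ^+ 2 <= `|al| * u z ^+ 2 by rewrite ler_wpM2r ?sqr_ge0// ler_norm.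
have big (b : bool) : b -> u z ^+ 2 * expR (al * u z ^+ 2) <=
    expR ((`|al| + 1) * u z ^+ 2) * b%:R.
  move=> ->; rewrite mulr1 mulrDl mul1r expRD mulrC; apply: ler_pM; rewrite ?expR_ge0 ?sqr_ge0//.
    by rewrite ler_expR.
  by apply: le_trans (expR_ge1Dx _); rewrite lerDr.
have p1 (b : bool) : 0 <= expR ((`|al| + 1) * u z ^+ 2) * b%:R by rewrite mulr_ge0 ?expR_ge0.
have p3 : 0 <= expR (`|al| * (m1 + m2)%:R) * u z ^+ 2 by apply: mulr_ge0; [exact: expR_ge0|exact: sqr_ge0].
case: (boolP (Num.sqrt m1%:R < u z)) => h1.
  by apply: (le_trans (big _ h1)); rewrite h1 -addrA lerDl addr_ge0.
case: (boolP (Num.sqrt m2%:R < - u z)) => h2.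
  have := big _ h2; rewrite h2 => H; apply: (le_trans H).
  by rewrite mulr0 add0r lerDl.
rewrite !mulr0 !add0r mulrC ler_wpM2r ?sqr_ge0// ler_expR.
apply: (le_trans alu); rewrite ler_wpM2l//.
rewrite -!leNgt in h1 h2.
have s1 : Num.sqrt (m1%:R : R) ^+ 2 = m1%:R by rewrite sqr_sqrtr.
have s2 : Num.sqrt (m2%:R : R) ^+ 2 = m2%:R by rewrite sqr_sqrtr.
have := sqrtr_ge0 (m1%:R : R); have := sqrtr_ge0 (m2%:R : R).
rewrite natrD -s1 -s2; move: h1 h2; move: (Num.sqrt _) (Num.sqrt _) (u z) => a b x.
by rewrite !expr2; case: (leP 0 x) => x0; nra.
Qed.

(** * The functional and the Nehari set *)

Record admissible {R : realType} (theta : R) (f : R -> R) : Prop := Admissible {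
  adm_cont : continuous f;
  adm_f1 : exists C : R, 0 < C /\ forall s : R, `|f s| <= C * expR (4 * pi * s ^+ 2);
  adm_f2 : (fun s => f s / s) x @[x --> 0^'] --> 0;
  adm_theta : 2 < theta;
  adm_f3 : forall s : R, s != 0 -> 0 < theta * primitive f s <= s * f s }.

Section functional.
Context {R : realType}.
Notation mu := (@lebesgue_measure R).
Notation leb2 := (@leb2 R).
Implicit Types (u v g : R * R -> R).
Variables (V0 theta : R) (f : R -> R).
Hypothesis adm : admissible theta f.

Let cf := adm_cont adm.
Let f1 := adm_f1 adm.
Let f2 := adm_f2 adm.
Let theta_gt2 := adm_theta adm.
Let f3 := adm_f3 adm.
Let F := primitive f.

(** Near 0 the limit of f(s)/s gives |f(s)| <= |s|; away from 0 the factor |s| / [de] is at least 1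
    and the exponential bound applies. Thus |s f(s)| is dominated by the integrand of
    [trudinger_moser]. *)
Lemma f_growth : exists2 C : R, 0 <= C &
  forall s, s != 0 -> `|f s| <= C * (`|s| * expR (4 * pi * s ^+ 2)).
Proof.
have [C0 [C0p HC0]] := f1.
have /cvgrPdist_le/(_ 1 ltr01) := f2.
rewrite near_withinE => /nbhs_ballP[de /= de0 Hde].
exists (1 + C0 / de); first by apply: addr_ge0 => //; apply: divr_ge0; exact: ltW.
move=> s s0.
have sp : 0 < `|s| by rewrite normr_gt0.
have e1 : 1 <= expR (4 * pi * s ^+ 2).
  by rewrite -expR0 ler_expR; apply: mulr_ge0; [rewrite mulr_ge0// pi_ge0|exact: sqr_ge0].
have E0 := expR_ge0 (4 * pi * s ^+ 2).
case: (ltP `|s| de) => sd.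
  have := Hde s; rewrite /ball/= !sub0r !normrN => /(_ sd s0).
  rewrite normrM normfV ler_pdivrMr// mul1r => h; apply: (le_trans h).
  rewrite [leRHS]mulrDl mul1r; apply: (@le_trans _ _ (`|s| * expR (4 * pi * s ^+ 2))).
    by rewrite ler_peMr.
  by rewrite lerDl; apply: mulr_ge0; [apply: divr_ge0; exact: ltW|exact: mulr_ge0].
apply: (le_trans (HC0 s)); rewrite [leRHS]mulrDl.
apply: (@le_trans _ _ (C0 / de * (`|s| * expR (4 * pi * s ^+ 2)))).
  by rewrite [leRHS]mulrA ler_wpM2r// mulrAC ler_pdivlMr// ler_pM2l.
by rewrite lerDr mul1r mulr_ge0.
Qed.

Lemma F_ge0 s : 0 <= F s.
Proof.
have [->|s0] := eqVneq s 0; first by rewrite /F primitive0.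
have /andP[h _] := f3 s0; rewrite pmulr_rgt0 in h; first exact: ltW.
by apply: lt_trans theta_gt2.
Qed.

Lemma F_le s : theta * F s <= s * f s.
Proof.
have [->|s0] := eqVneq s 0; first by rewrite /F primitive0 mul0r mulr0.
by have /andP[_ ->] := f3 s0.
Qed.

Lemma h_ge0 s : 0 <= s * f s.
Proof.
apply: le_trans (F_le s); rewrite mulr_ge0 ?F_ge0// ltW//.
exact: lt_trans theta_gt2.
Qed.

Lemma K_ge s : (2^-1 - theta^-1) * (s * f s) <= 2^-1 * (s * f s) - F s.
Proof.
have t0 : 0 < theta by apply: lt_trans theta_gt2.
rewrite mulrBl lerD2l lerN2 mulrC ler_pdivlMr// mulrC.
exact: F_le.
Qed.

Lemma theta_coef : 0 < 2^-1 - theta^-1.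
Proof.
have t0 : 0 < theta by apply: lt_trans theta_gt2.
by rewrite subr_gt0 ltf_pV2 ?posrE.
Qed.

Lemma K_ge0 s : 0 <= 2^-1 * (s * f s) - F s.
Proof.
apply: le_trans (K_ge s); rewrite mulr_ge0 ?h_ge0// ltW//; exact: theta_coef.
Qed.

Lemma K_gt0 s : s != 0 -> 0 < 2^-1 * (s * f s) - F s.
Proof.
move=> s0; apply: lt_le_trans (K_ge s).
have /andP[h1 h2] := f3 s0.
by rewrite mulr_gt0 ?theta_coef// (lt_le_trans h1).
Qed.

Lemma continuous_F : continuous F.
Proof. by apply: continuous_primitive; exact: continuous_locint. Qed.

Lemma measurable_comp_real (k : R -> R) u : continuous k -> measurable_fun setT u ->
  measurable_fun setT (fun z => k (u z)).
Proof.
by move=> ck mu'; apply: measurableT_comp => //; exact: continuous_measurable_fun.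
Qed.

Lemma continuous_h : continuous (fun s : R => s * f s).
Proof. by apply: contM => // x; exact: cvg_id. Qed.

Lemma h_integrable u g1 g2 : sob u g1 g2 ->
  leb2.-integrable setT (EFin \o (fun z => u z * f (u z))).
Proof.
move=> su; have [lu _ _ _ _] := su.
have [C C0 HC] := f_growth.
have i := integrableZ_real C measurableT (trudinger_moser (4 * pi) su).
apply: (integrable_le measurableT _ i).
  exact: (measurable_comp_real continuous_h lu.1).
move=> z _; have [->|s0] := eqVneq (u z) 0.
  by rewrite mul0r normr0 expr0n mul0r mulr0.
rewrite normrM; apply: (@le_trans _ _ (`|u z| * (C * (`|u z| * expR (4 * pi * u z ^+ 2))))).
  by rewrite ler_wpM2l// HC.
by rewrite mulrCA (mulrA `|u z|) -expr2 real_normK// num_real.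
Qed.

Lemma F_integrable u g1 g2 : sob u g1 g2 ->
  leb2.-integrable setT (EFin \o (fun z => F (u z))).
Proof.
move=> su; have [lu _ _ _ _] := su.
have t0 : 0 < theta by apply: lt_trans theta_gt2.
have i := integrableZ_real theta^-1 measurableT (h_integrable su).
apply: (integrable_le measurableT _ i).
  exact: (measurable_comp_real continuous_F lu.1).
move=> z _; rewrite ger0_norm ?F_ge0// mulrC ler_pdivlMr// mulrC; exact: F_le.
Qed.

Lemma J_sob u g1 g2 : sob u g1 g2 -> J V0 f u =
  (2^-1 * (energy g1 g2 + V0 * \int[leb2]_z (u z ^+ 2)) - \int[leb2]_z F (u z))%:E.
Proof.
move=> su; have [lu _ _ _ _] := su.
rewrite /J (dirichletE su) (EFin_Rintegral measurableT (L2_integrable lu)).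
by rewrite (EFin_Rintegral measurableT (F_integrable su)).
Qed.

Lemma sob_scale u g1 g2 (t : R) : sob u g1 g2 ->
  sob (fun z => u z + t * u z) (fun z => (1 + t) * g1 z) (fun z => (1 + t) * g2 z).
Proof.
move=> su; have := sobZ (1 + t) su; congr sob.
by apply/funext => z; rewrite mulrDl mul1r.
Qed.

Lemma energyZ (k : R) g1 g2 : L2 g1 -> L2 g2 ->
  energy (fun z => k * g1 z) (fun z => k * g2 z) = k ^+ 2 * energy g1 g2.
Proof.
move=> l1 l2; rewrite /energy -RintegralZl//; last exact: energy_integrable.
by apply: eq_Rintegral => z _; rewrite !exprMn mulrDr.
Qed.

(** Along u + t u the quadratic part is a polynomial in t; the integral of F is differentiated under
    the integral sign. *)
Lemma dJ_sob u g1 g2 : sob u g1 g2 -> dJ_diag V0 f u =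
  energy g1 g2 + V0 * \int[leb2]_z (u z ^+ 2) - \int[leb2]_z (u z * f (u z)).
Proof.
move=> su; have [lu l1 l2 _ _] := su.
set B := energy g1 g2 + V0 * \int[leb2]_z (u z ^+ 2).
pose Phi (t : R) := \int[leb2]_z F (u z + t * u z).
have Je (t : R) : fine (J V0 f (fun x => u x + t * u x)) = 2^-1 * ((1 + t) ^+ 2 * B) - Phi t.
  rewrite (J_sob (sob_scale t su))/= energyZ//; congr (_ - _); congr (_ * _).
  rewrite mulrDr; congr (_ + _); rewrite mulrCA; congr (_ * _).
  rewrite -RintegralZl//; last exact: L2_integrable.
  by apply: eq_Rintegral => z _; rewrite -exprMn mulrDl mul1r.
have [C C0 HC] := f_growth.
(* For |t| < 1/2 one has |u + t u| <= 2 |u|, whose square puts the extra factor 4 into the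
   exponent. *)
pose G z := (C * 4) * (u z ^+ 2 * expR (4 * pi * 4 * u z ^+ 2)).
have iG : leb2.-integrable setT (EFin \o G).
  by apply: integrableZ_real => //; exact: trudinger_moser su.
have lf := continuous_locint cf.
have dF (z : R * R) (t : R) : is_derive t 1 (fun t : R => F (u z + t * u z)) (u z * f (u z + t * u z)).
  have d1 : is_derive t 1 (fun t : R => u z + t * u z) (u z).
    have := is_deriveD (is_derive_cst (u z) t 1) (is_deriveZ (u z) (is_derive_id t 1)).
    rewrite add0r /GRing.scale/= mulr1; congr is_derive.
    by apply/funext => s /=; rewrite mulrC.
  have d2 := is_derive_primitive lf (cf (x:=u z + t * u z)).
  by have := @is_derive1_comp _ F (fun t => u z + t * u z) t _ _ d2 d1; rewrite mulrC.
have h0 : `]- 2^-1, 2^-1[%classic (0 : R).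
  by rewrite /= in_itv/=; apply/andP; split; lra.
have H1 (t : R) : `]- 2^-1, 2^-1[%classic t -> leb2.-integrable setT (EFin \o (fun z => F (u z + t * u z))).
  by move=> _; exact: F_integrable (sob_scale t su).
have H2 (t : R) (z : R * R) : `]- 2^-1, 2^-1[%classic t -> [set: R * R] z -> derivable (fun t : R => F (u z + t * u z)) t 1.
  by move=> _ _; have [] := dF z t.
have H3 z : 0 <= G z.
  by rewrite /G; apply: mulr_ge0; [exact: mulr_ge0|apply: mulr_ge0; [exact: sqr_ge0|exact: expR_ge0]].
have dE (t : R) (z : R * R) : partial1of2 (fun (t : R) (z : R * R) => F (u z + t * u z)) t z = u z * f (u z + t * u z).
  by rewrite partial1of2E (@derive_val _ _ _ _ _ _ _ (dF z t)).
have H4 (t : R) (z : R * R) : `]- 2^-1, 2^-1[%classic t -> [set: R * R] z ->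
    `|partial1of2 (fun (t : R) (z : R * R) => F (u z + t * u z)) t z| <= G z.
  rewrite /= in_itv/= => /andP[t1 t2] _; rewrite dE.
  have [->|u0] := eqVneq (u z) 0.
    by rewrite mul0r normr0 H3.
  have T : 0 < 1 + t by lra.
  have s0 : u z + t * u z != 0.
    rewrite -[X in X + _]mul1r -mulrDl mulf_neq0//.
    by rewrite gt_eqF.
  rewrite normrM; apply: (@le_trans _ _ (`|u z| * (C * (`|u z + t * u z| * expR (4 * pi * (u z + t * u z) ^+ 2))))).
    by rewrite ler_wpM2l// HC.
  have n2 : `|u z + t * u z| <= 2 * `|u z|.
    rewrite -[X in `|X + _|]mul1r -mulrDl normrM ler_wpM2r//.
    by rewrite ger0_norm; lra.
  have q2 : (u z + t * u z) ^+ 2 <= 4 * u z ^+ 2.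
    rewrite -[leLHS]real_normK ?num_real// -[u z ^+ 2]real_normK ?num_real//.
    have -> : 4 * `|u z| ^+ 2 = (2 * `|u z|) ^+ 2 by rewrite exprMn -natrX.
    by rewrite lerXn2r// nnegrE// mulr_ge0.
  have p4 : 0 <= 4 * pi :> R by rewrite mulr_ge0// pi_ge0.
  have e4 : expR (4 * pi * (u z + t * u z) ^+ 2) <= expR (4 * pi * 4 * u z ^+ 2).
    by rewrite ler_expR -[leRHS]mulrA ler_wpM2l.
  apply: (@le_trans _ _ (`|u z| * (C * ((2 * `|u z|) * expR (4 * pi * 4 * u z ^+ 2))))).
    by rewrite ler_wpM2l// ler_wpM2l// ler_pM ?expR_ge0.
  have ue : u z ^+ 2 = `|u z| * `|u z| by rewrite -expr2 real_normK// num_real.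
  rewrite /G ue; have := expR_ge0 (4 * pi * 4 * (`|u z| * `|u z|)).
  have := mulr_ge0 (normr_ge0 (u z)) (normr_ge0 (u z)).
  move: (expR _) => E; move: `|u z| => a a0 E0.
  have -> : a * (C * (2 * a * E)) = (C * 2) * (a * a * E) by ring.
  apply: ler_wpM2r; first exact: mulr_ge0.
  by apply: ler_wpM2l => //; rewrite ler_nat.
have D1 := derivable_under_integral measurableT h0 H1 H2 H3 iG H4.
have D2 := differentiation_under_integral measurableT h0 H1 H2 H3 iG H4.
have dPhi : is_derive (0 : R) 1 Phi (\int[leb2]_z (u z * f (u z))).
  apply: (DeriveDef D1); rewrite -derive1E D2.
  by apply: eq_Rintegral => z _; rewrite dE mul0r addr0.
rewrite /dJ_diag (_ : (fun t => _) = fun t => 2^-1 * ((1 + t) ^+ 2 * B) - Phi t); last first.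
  by apply/funext => t; exact: Je.
rewrite derive1E.
have dP : is_derive (0 : R) 1 (fun t : R => 2^-1 * ((1 + t) ^+ 2 * B)) B.
  have d1 : is_derive (0 : R) 1 (fun t : R => 1 + t) 1.
    by have := is_deriveD (is_derive_cst (1 : R) (0 : R) 1) (is_derive_id (0 : R) 1); rewrite add0r.
  have := is_deriveZ (2^-1 * B) (is_deriveM d1 d1).
  rewrite /GRing.scale/= addr0 !mulr1.
  have -> : (2^-1 * B) * (1 + 1) = B by rewrite -mulrA mulrC -mulrA (_ : (1 + 1) / 2 = 1) ?mulr1//; lra.
  congr is_derive; apply/funext => t.
  by change ((2^-1 * B) * ((1 + t) * (1 + t)) = 2^-1 * ((1 + t) ^+ 2 * B)); ring.
by rewrite (@derive_val _ _ _ _ _ _ _ (is_deriveB dP dPhi)).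
Qed.

End functional.

(** * Dilations, and splitting of J over the two signs *)

Section competitors.
Context {R : realType}.
Notation mu := (@lebesgue_measure R).
Notation leb2 := (@leb2 R).
Implicit Types (u v w g : R * R -> R).
Variables (V0 theta : R) (f : R -> R).
Hypothesis adm : admissible theta f.

(* J'(u)u = energy + potential u, so J(u) = nehari_energy u when J'(u)u = 0. *)
Definition potential u := V0 * \int[leb2]_z (u z ^+ 2) - \int[leb2]_z (u z * f (u z)).
Definition nehari_energy u :=
  \int[leb2]_z (2^-1 * (u z * f (u z)) - primitive f (u z)).

Lemma nehari_energyE u g1 g2 : sob u g1 g2 -> nehari_energy u =
  2^-1 * \int[leb2]_z (u z * f (u z)) - \int[leb2]_z primitive f (u z).
Proof.
move=> su; have i1 := h_integrable adm su; have i2 := F_integrable adm su.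
by rewrite /nehari_energy RintegralB// ?RintegralZl//; exact: integrableZ_real.
Qed.

Lemma J_potential u g1 g2 : sob u g1 g2 ->
  J V0 f u = (2^-1 * (energy g1 g2 + potential u) + nehari_energy u)%:E.
Proof.
move=> su; rewrite (J_sob V0 adm su) (nehari_energyE su) /potential.
by congr EFin; ring.
Qed.

Lemma dJ_potential u g1 g2 : sob u g1 g2 ->
  dJ_diag V0 f u = energy g1 g2 + potential u.
Proof. by move=> su; rewrite (dJ_sob V0 adm su) /potential addrA. Qed.

Lemma nehari_energy_ge0 u : 0 <= nehari_energy u.
Proof. by apply: Rintegral_ge0 => z _; exact: (K_ge0 adm _). Qed.

Lemma nonzero_potential u g1 g2 : sob u g1 g2 -> potential u != 0 -> nonzero_ae u.
Proof.
move=> su /eqP b0 u0; apply: b0; have [lu _ _ _ _] := su.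
have e0 : \int[leb2]_z (0 : R) = 0 by rewrite Rintegral_cst// mul0r.
rewrite /potential (_ : \int[leb2]_z (u z ^+ 2) = 0); last first.
  rewrite -[RHS]e0; apply: ae_eq_Rintegral => //.
    by apply: measurable_funX; exact: lu.1.
  by apply: ae_sub u0 => z -> _; rewrite expr0n.
rewrite (_ : \int[leb2]_z (u z * f (u z)) = 0) ?mulr0 ?subrr//.
rewrite -[RHS]e0; apply: ae_eq_Rintegral => //.
  exact: integrable_measurable (h_integrable adm su).
by apply: ae_sub u0 => z -> _; rewrite mul0r.
Qed.

Lemma ge0_Rintegral_aff (k s t : R) (G : R * R -> R) : 0 < k ->
  leb2.-integrable setT (EFin \o G) -> (forall z, 0 <= G z) ->
  \int[leb2]_z G (k * z.1 + s, k * z.2 + t) = k ^- 2 * \int[leb2]_z G z.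
Proof.
move=> k0 iG G0.
have := @ge0_integral_affine2 _ (fun z => (G z)%:E) k s t k0.
rewrite /Rintegral => ->.
- by rewrite (EFin_Rintegral measurableT iG) -EFinM.
- by apply/measurable_EFinP; exact: integrable_measurable iG.
- by move=> z; rewrite lee_fin.
Qed.

Lemma dilation u g1 g2 (k s t : R) : 0 < k -> sob u g1 g2 ->
  [/\ energy (fun z => k * aff k s t g1 z) (fun z => k * aff k s t g2 z) = energy g1 g2,
      potential (aff k s t u) = k ^- 2 * potential u &
      nehari_energy (aff k s t u) = k ^- 2 * nehari_energy u].
Proof.
move=> k0 su; have [lu l1 l2 _ _] := su; split.
- rewrite energyZ; [|exact: L2_aff..].
  rewrite /energy (@ge0_Rintegral_aff k s t (fun z => g1 z ^+ 2 + g2 z ^+ 2))//.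
  + by rewrite mulrA divff ?mul1r// expf_neq0// gt_eqF.
  + exact: energy_integrable.
  + by move=> z; rewrite addr_ge0 ?sqr_ge0.
- rewrite /potential (@ge0_Rintegral_aff k s t (fun z => u z ^+ 2))//.
  + rewrite (@ge0_Rintegral_aff k s t (fun z => u z * f (u z)))//.
    * by rewrite mulrBr mulrCA.
    * exact: (h_integrable adm su).
    * by move=> z; exact: (h_ge0 adm _).
  + exact: L2_integrable.
  + by move=> z; rewrite sqr_ge0.
- rewrite /nehari_energy (@ge0_Rintegral_aff k s t
    (fun z => 2^-1 * (u z * f (u z)) - primitive f (u z)))//.
  + apply: integrableB_real => //; last exact: (F_integrable adm su).
    by apply: integrableZ_real => //; exact: (h_integrable adm su).
  + by move=> z; exact: (K_ge0 adm _).
Qed.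

Definition gneg u g : R * R -> R := fun z => if u z < 0 then g z else 0.

Lemma negpE u : negp u = fun z => -1 * posp (fun z => -1 * u z) z.
Proof.
by apply/funext => z; rewrite /negp /posp !mulN1r oppr_max opprK oppr0.
Qed.

Lemma sob_neg u g1 g2 : sob u g1 g2 -> sob (negp u) (gneg u g1) (gneg u g2).
Proof.
move=> su; have := sobZ (-1) (sob_pos (sobZ (-1) su)); rewrite -negpE.
have E g : (fun z => -1 * gpos (fun z => -1 * u z) (fun z => -1 * g z) z) = gneg u g.
  apply/funext => z; rewrite /gpos /gneg !mulN1r oppr_gt0.
  by case: ifPn; rewrite ?opprK ?oppr0.
by rewrite !E.
Qed.

Lemma posp_negp u : (fun z => posp u z + negp u z) = u.
Proof.
by apply/funext => z; rewrite /posp /negp addr_max_min addr0.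
Qed.

(** At each point one of the two parts vanishes, so every integral of a function of u is additive.
    For the Dirichlet integral, uniqueness of the gradient replaces it by the sum of [gpos] and
    [gneg], which settles the set {u = 0}. *)
Lemma J_split u : H1 u -> (J V0 f u = J V0 f (posp u) + J V0 f (negp u))%E.
Proof.
move=> /H1_sob[g1 [g2 su]].
have sp := sob_pos su; have sn := sob_neg su.
rewrite (J_potential su) (J_potential sp) (J_potential sn) -EFinD; congr EFin.
have [lu l1 l2 _ _] := su; have [lp p1 p2 _ _] := sp; have [ln n1 n2 _ _] := sn.
have ss := sobD sp sn; rewrite posp_negp in ss.
have [e1 e2] := sob_unique su ss.
have Ee : energy g1 g2 = energy (gpos u g1) (gpos u g2) + energy (gneg u g1) (gneg u g2).
  rewrite /energy -RintegralD//; [|exact: energy_integrable..].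
  apply: ae_eq_Rintegral => //.
  - exact: integrable_measurable (energy_integrable l1 l2).
  - apply: measurable_funD; [exact: integrable_measurable (energy_integrable p1 p2)|].
    exact: integrable_measurable (energy_integrable n1 n2).
  - apply: ae_sub2 e1 e2 => z -> -> _; rewrite /gpos /gneg.
    by case: (ltgtP (u z) 0) => _; rewrite ?addr0 ?add0r ?expr0n ?addr0 ?add0r.
have zz z : posp u z = u z /\ negp u z = 0 \/ posp u z = 0 /\ negp u z = u z.
  by rewrite /posp /negp; case: (leP 0 (u z)) => h; [left|right].
have Ep : potential u = potential (posp u) + potential (negp u).
  rewrite /potential.
  rewrite (_ : \int[leb2]_z (u z ^+ 2) = \int[leb2]_z (posp u z ^+ 2) + \int[leb2]_z (negp u z ^+ 2)).
    rewrite (_ : \int[leb2]_z (u z * f (u z)) = \int[leb2]_z (posp u z * f (posp u z)) + \int[leb2]_z (negp u z * f (negp u z))).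
      by rewrite mulrDr opprD addrACA.
    rewrite -RintegralD//; [|exact: (h_integrable adm sp)|exact: (h_integrable adm sn)].
    by apply: eq_Rintegral => z _; case: (zz z) => -[-> ->]; rewrite mul0r ?addr0 ?add0r.
  rewrite -RintegralD//; [|exact: L2_integrable..].
  by apply: eq_Rintegral => z _; case: (zz z) => -[-> ->]; rewrite expr0n ?addr0 ?add0r.
have Ek : nehari_energy u = nehari_energy (posp u) + nehari_energy (negp u).
  rewrite (nehari_energyE su) (nehari_energyE sp) (nehari_energyE sn).
  rewrite (_ : \int[leb2]_z (u z * f (u z)) = \int[leb2]_z (posp u z * f (posp u z)) + \int[leb2]_z (negp u z * f (negp u z))).
    rewrite (_ : \int[leb2]_z primitive f (u z) = \int[leb2]_z primitive f (posp u z) + \int[leb2]_z primitive f (negp u z)).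
      by rewrite mulrDr opprD addrACA.
    rewrite -RintegralD//; [|exact: (F_integrable adm sp)|exact: (F_integrable adm sn)].
    by apply: eq_Rintegral => z _; case: (zz z) => -[-> ->]; rewrite primitive0 ?addr0 ?add0r.
  rewrite -RintegralD//; [|exact: (h_integrable adm sp)|exact: (h_integrable adm sn)].
  by apply: eq_Rintegral => z _; case: (zz z) => -[-> ->]; rewrite mul0r ?addr0 ?add0r.
by rewrite Ee Ep Ek (addrACA (energy _ _)) mulrDr addrACA.
Qed.

End competitors.

(** * Upper bound for the nodal level *)

Section cutoff.
Context {R : realType}.
Notation mu := (@lebesgue_measure R).
Notation leb2 := (@leb2 R).
Implicit Types (u v w g : R * R -> R).

(* The factor [expR 2] normalises the bump to the value 1 at 0. *)
Definition kap (y : R) : R := expR 2 * (flat 0 (1 * y + 1) * flat 0 (-1 * y + 1)).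

Lemma smooth1_kap : smooth1 kap.
Proof. by apply: smooth1Z; apply: smooth1M; exact: smooth1_flat. Qed.

Lemma kap0 : kap 0 = 1.
Proof.
rewrite /kap !mulr0 add0r /flat ltr01 invr1 !expr0 !mul1r -!expRD.
by rewrite (_ : 2 + (-1 + -1) = 0) ?expR0//; lra.
Qed.

Lemma kap_ge0 y : 0 <= kap y.
Proof. by rewrite /kap !mulr_ge0 ?expR_ge0 ?flat_ge0. Qed.

Lemma kap_out y : 1 < `|y| -> kap y = 0.
Proof.
rewrite ltNge ler_norml negb_and -!ltNge => /orP[] h; rewrite /kap.
  by rewrite flat_le0 ?mul0r ?mulr0//; lra.
by rewrite (mulrC (flat _ _)) flat_le0 ?mul0r ?mulr0//; lra.
Qed.

Let kp (n : nat) (x : R) := kap (n.+1%:R^-1 * x).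

(** The cut-offs are [kap] dilated by n+1 in each variable: they tend to 1, while their derivatives
    carry a factor 1/(n+1) and disappear from the energy. The nonnegative multipliers [c], bounded
    by [M], preserve signs and give the domination used in [potential_nehari_cvg]. *)
Lemma cut_converges u g1 g2 : sob u g1 g2 ->
  exists (un h1 h2 c : nat -> R * R -> R) (M : R),
  [/\ forall n, sob (un n) (h1 n) (h2 n),
      forall n, exists N : R, forall z, ~ box N z -> un n z = 0,
      forall n z, un n z = c n z * u z /\ 0 <= c n z <= M,
      forall z, un ^~ z @ \oo --> u z &
      energy (h1 n) (h2 n) @[n --> \oo] --> energy g1 g2].
Proof.
move=> su; have [lu l1 l2 a1 a2] := su.
have [kap' sk' dk] := smooth1_derive smooth1_kap.
have ck := smooth1_continuous smooth1_kap.
have ck' := smooth1_continuous sk'.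
have kN := kap_out.
have [M M0 HM] := cs_bounded ck kN.
have [M' M'0 HM'] := cs_bounded ck' (cs_derive dk kN).
pose kp' (n : nat) (x : R) := n.+1%:R^-1 * kap' (n.+1%:R^-1 * x).
have dkp n (x : R) : is_derive x 1 (kp n) (kp' n x).
  have d1 : is_derive x 1 (fun x : R => n.+1%:R^-1 * x) n.+1%:R^-1.
    have := is_deriveZ (n.+1%:R^-1 : R) (is_derive_id x 1).
    by rewrite /GRing.scale/= mulr1.
  have := @is_derive1_comp _ kap (fun x => n.+1%:R^-1 * x) x _ _ (dk _) d1.
  by rewrite mulrC.
have csc n : continuous (fun x : R => n.+1%:R^-1 * x).
  by apply: contM; [exact: cont_cst|move=> x; exact: cvg_id].
have ckp n : continuous (kp n).
  by move=> x; apply: (continuous_comp (csc n x)); exact: ck.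
have ckp' n : continuous (kp' n).
  apply: contM; first exact: cont_cst.
  by move=> x; apply: (continuous_comp (csc n x)); exact: ck'.
have kM n x : `|kp n x| <= M by exact: HM.
have k'M n x : `|kp' n x| <= M'.
  rewrite /kp' normrM -[leRHS]mul1r; apply: ler_pM => //.
  by rewrite normfV normr_nat invf_le1 ?ltr0n// ler1n.
have mkp n := continuous_measurable_fun (ckp n).
have mkp' n := continuous_measurable_fun (ckp' n).
have c0 (x : R) : n.+1%:R^-1 * x @[n --> \oo] --> (0 : R).
  by rewrite -(mul0r x); exact: (cvgM (@cvg_harmonic R) (cvg_cst x)).
have ckp1 (x : R) : kp n x @[n --> \oo] --> (1 : R).
  rewrite -kap0; apply: (@continuous_cvg _ _ _ _ _ _ kap) => //; exact: ck.
have ckp0 (x : R) : kp' n x @[n --> \oo] --> (0 : R).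
  rewrite -(mul0r (kap' 0)); apply: cvgM; first exact: cvg_harmonic.
  by apply: (@continuous_cvg _ _ _ _ _ _ kap') => //; exact: ck'.
have mcut (al be : R -> R) v : measurable_fun setT al -> measurable_fun setT be ->
    measurable_fun setT v -> measurable_fun setT (cutf al be v).
  move=> mal mbe mv; apply: measurable_funM; first exact: measurable_fst_comp.
  by apply: measurable_funM => //; exact: measurable_snd_comp.
have Lcut (al be : R -> R) v (A B : R) : 0 <= A -> 0 <= B -> (forall x, `|al x| <= A) -> (forall x, `|be x| <= B) ->
    measurable_fun setT al -> measurable_fun setT be -> L2 v -> L2 (cutf al be v).
  move=> A0 B0 HA HB mal mbe lv.
  apply: (@L2_bounded_mul _ _ A) => //; last exact: measurable_fst_comp.
  by apply: (@L2_bounded_mul _ _ B) => //; exact: measurable_snd_comp.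
pose un n := cutf (kp n) (kp n) u.
pose h1 n z := cutf (kp' n) (kp n) u z + cutf (kp n) (kp n) g1 z.
pose h2 n z := cutf (kp n) (kp' n) u z + cutf (kp n) (kp n) g2 z.
pose c n (z : R * R) := kp n z.1 * kp n z.2.
have Lh1 n : L2 (h1 n) by apply: L2D; [exact: (Lcut _ _ _ M' M)|exact: (Lcut _ _ _ M M)].
have Lh2 n : L2 (h2 n) by apply: L2D; [exact: (Lcut _ _ _ M M')|exact: (Lcut _ _ _ M M)].
exists un, h1, h2, c, (M * M); split.
- move=> n; split => //; first exact: (Lcut _ _ _ M M).
    by apply: acl_cut1 => //; exact: dkp.
  by apply: acl_cut2 => //; exact: dkp.
- move=> n; exists n.+1%:R => z /box_out zN.
  have H (x : R) : n.+1%:R < `|x| -> kp n x = 0.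
    move=> xn; apply: kap_out; rewrite normrM normfV normr_nat mulrC.
    by rewrite ltr_pdivlMr ?ltr0n// mul1r.
  by case/orP: zN => /H e; rewrite /un /cutf e ?mul0r ?mulr0.
- move=> n z; rewrite /un /cutf /c mulrA; split => //.
  rewrite mulr_ge0 ?kap_ge0//= ler_pM ?kap_ge0//.
    by apply: le_trans (kM n z.1); exact: ler_norm.
  by apply: le_trans (kM n z.2); exact: ler_norm.
- move=> z; rewrite -[X in _ --> X]mul1r; apply: cvgM; first exact: ckp1.
  rewrite -[X in _ --> X]mul1r; apply: cvgM; first exact: ckp1.
  exact: cvg_cst.
- pose G z := 2 * ((M' * M * u z) ^+ 2 + (M * M * g1 z) ^+ 2) +
     2 * ((M * M' * u z) ^+ 2 + (M * M * g2 z) ^+ 2).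
  have iG : leb2.-integrable setT (EFin \o G).
    apply: integrableD_real => //; apply: integrableZ_real => //;
    by apply: integrableD_real => //; apply: L2_integrable; exact: L2Z.
  have [||||_ C] := @dominated_cvg_Rintegral _ _ _ leb2 setT
    (fun n z => h1 n z ^+ 2 + h2 n z ^+ 2) (fun z => g1 z ^+ 2 + g2 z ^+ 2) G measurableT.
  + by move=> n; exact: integrable_measurable (energy_integrable (Lh1 n) (Lh2 n)).
  + have cutc (a b : nat -> R -> R) (A B : R) v (z : R * R) :
        a n z.1 @[n --> \oo] --> A -> b n z.2 @[n --> \oo] --> B ->
        cutf (a n) (b n) v z @[n --> \oo] --> A * (B * v z).
      by move=> ca cb; apply: cvgM => //; apply: cvgM => //; exact: cvg_cst.
    move=> z _.
    have C1 : h1 n z @[n --> \oo] --> g1 z.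
      have := cvgD (cutc kp' kp 0 1 u z (ckp0 _) (ckp1 _)) (cutc kp kp 1 1 g1 z (ckp1 _) (ckp1 _)).
      rewrite mul0r add0r !mul1r => H; exact: H.
    have C2 : h2 n z @[n --> \oo] --> g2 z.
      have := cvgD (cutc kp kp' 1 0 u z (ckp1 _) (ckp0 _)) (cutc kp kp 1 1 g2 z (ckp1 _) (ckp1 _)).
      rewrite mul0r mulr0 add0r !mul1r => H; exact: H.
    exact: (cvgD (cvgM C1 C1) (cvgM C2 C2)).
  + exact: iG.
  + move=> n z _; rewrite ger0_norm ?addr_ge0 ?sqr_ge0//.
    have sq (a b : R) : (a + b) ^+ 2 <= 2 * (a ^+ 2 + b ^+ 2).
      by have := sqr_ge0 (a - b); rewrite !expr2; nra.
    have ab (al be : R -> R) (A B : R) v : 0 <= A -> 0 <= B -> (forall x, `|al x| <= A) ->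
        (forall x, `|be x| <= B) -> cutf al be v z ^+ 2 <= (A * B * v z) ^+ 2.
      move=> A0 B0 HA HB.
      rewrite -[leLHS]real_normK ?num_real// -[leRHS]real_normK ?num_real//.
      rewrite lerXn2r// ?nnegrE// /cutf !normrM mulrA ler_wpM2r// ler_pM//.
        exact: le_trans (HA _) (ler_norm _).
      exact: le_trans (HB _) (ler_norm _).
    by apply: lerD; apply: (le_trans (sq _ _)); rewrite ler_wpM2l//; apply: lerD; apply: ab.
  exact: C.
Qed.

End cutoff.

(** * The bound of the nodal level by two projected energies *)

Section chat_upper_bound.
Context {R : realType}.
Notation mu := (@lebesgue_measure R).
Notation leb2 := (@leb2 R).
Implicit Types (u v w g : R * R -> R).
Variables (V0 theta : R) (f : R -> R).
Hypothesis adm : admissible theta f.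

Lemma h_growth : exists2 C : R, 0 <= C &
  forall s, s * f s <= C * (s ^+ 2 * expR (4 * pi * s ^+ 2)).
Proof.
have [C C0 HC] := f_growth adm; exists C => // s.
have [->|s0] := eqVneq s 0; first by rewrite mul0r expr0n mul0r mulr0.
apply: (le_trans (ler_norm _)); rewrite normrM.
apply: (@le_trans _ _ (`|s| * (C * (`|s| * expR (4 * pi * s ^+ 2))))).
  by rewrite ler_wpM2l// HC.
by rewrite mulrCA (mulrA `|s|) -expr2 real_normK// num_real.
Qed.

(** Dominated convergence. The bound |un| <= M |u| puts M^2 into the exponent, which
    [trudinger_moser] allows since it holds for every exponent. *)
Lemma potential_nehari_cvg (un c : nat -> R * R -> R) (M : R) u g1 g2 :
  sob u g1 g2 -> (forall n, measurable_fun setT (un n)) ->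
  (forall n z, un n z = c n z * u z /\ 0 <= c n z <= M) ->
  (forall z, un ^~ z @ \oo --> u z) ->
  potential V0 f (un n) @[n --> \oo] --> potential V0 f u /\
  nehari_energy f (un n) @[n --> \oo] --> nehari_energy f u.
Proof.
move=> su mun unc cun; have [lu _ _ _ _] := su.
have [C C0 HC] := h_growth.
have p4 : 0 <= 4 * pi :> R by rewrite mulr_ge0// pi_ge0.
have unM n z : un n z ^+ 2 <= M ^+ 2 * u z ^+ 2.
  have [-> /andP[c0 cM]] := unc n z.
  rewrite exprMn ler_wpM2r ?sqr_ge0// lerXn2r// nnegrE.
  exact: le_trans cM.
pose G z := (C * M ^+ 2) * (u z ^+ 2 * expR (4 * pi * M ^+ 2 * u z ^+ 2)).
have iG : leb2.-integrable setT (EFin \o G).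
  by apply: integrableZ_real => //; exact: trudinger_moser su.
have hG n z : un n z * f (un n z) <= G z.
  apply: (le_trans (HC _)); rewrite /G -[leRHS]mulrA ler_wpM2l// [leRHS]mulrA.
  apply: ler_pM; [exact: sqr_ge0|exact: expR_ge0|exact: unM|].
  by rewrite ler_expR -[leRHS]mulrA; apply: ler_wpM2l.
have cvgc (k : R -> R) : continuous k -> forall z, k (un n z) @[n --> \oo] --> k (u z).
  by move=> ck z; apply: (@continuous_cvg _ _ _ _ _ _ k) => //; exact: ck.
have csq : continuous (fun s : R => s ^+ 2).
  by move=> s; exact: exprn_continuous.
have [||||_ C1] := @dominated_cvg_Rintegral _ _ _ leb2 setT
    (fun n z => un n z ^+ 2) (fun z => u z ^+ 2) (fun z => M ^+ 2 * u z ^+ 2) measurableT.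
- by move=> n; apply: measurable_funX; exact: mun.
- by move=> z _; exact: (cvgc _ csq).
- by apply: integrableZ_real => //; exact: L2_integrable.
- by move=> n z _; rewrite ger0_norm ?sqr_ge0.
have [||||_ C2] := @dominated_cvg_Rintegral _ _ _ leb2 setT
    (fun n z => un n z * f (un n z)) (fun z => u z * f (u z)) G measurableT.
- by move=> n; apply: (measurable_comp_real (continuous_h adm)); exact: mun.
- by move=> z _; exact: (cvgc _ (continuous_h adm)).
- exact: iG.
- by move=> n z _; rewrite ger0_norm// (h_ge0 adm).
have [||||_ C3] := @dominated_cvg_Rintegral _ _ _ leb2 setT
    (fun n z => 2^-1 * (un n z * f (un n z)) - primitive f (un n z))
    (fun z => 2^-1 * (u z * f (u z)) - primitive f (u z)) G measurableT.
- move=> n; apply: measurable_funB; last by apply: (measurable_comp_real (continuous_F adm)); exact: mun.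
  by apply: measurable_funM => //; apply: (measurable_comp_real (continuous_h adm)); exact: mun.
- move=> z _; apply: cvgB; last exact: (cvgc _ (continuous_F adm)).
  by apply: cvgM; [exact: cvg_cst|exact: (cvgc _ (continuous_h adm))].
- exact: iG.
- move=> n z _; rewrite ger0_norm ?(K_ge0 adm)//.
  apply: le_trans (hG n z).
  have := F_ge0 adm (un n z); have := h_ge0 adm (un n z); lra.
split; last exact: C3.
by apply: cvgB => //; apply: cvgM => //; exact: cvg_cst.
Qed.

(* The value of J on the Nehari set along the dilations of a function with
   Dirichlet integral E, potential b < 0 and Nehari energy K. *)
Definition projected_energy (E b K : R) := E * K / - b.

Lemma projected_energy_cvg (En bn Kn : nat -> R) (E b K : R) :
  En @ \oo --> E -> bn @ \oo --> b -> Kn @ \oo --> K -> b != 0 ->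
  projected_energy (En n) (bn n) (Kn n) @[n --> \oo] --> projected_energy E b K.
Proof.
move=> cE cb cK b0; apply: (cvgM (cvgM cE cK)).
by apply: cvgV; [rewrite oppr_eq0|exact: cvgN].
Qed.

Lemma nehari_dilate w g1 g2 : sob w g1 g2 -> 0 < energy g1 g2 ->
  potential V0 f w < 0 ->
  exists2 k : R, 0 < k & forall s t,
  [/\ dJ_diag V0 f (aff k s t w) = 0, nonzero_ae (aff k s t w) &
     J V0 f (aff k s t w) =
     (projected_energy (energy g1 g2) (potential V0 f w) (nehari_energy f w))%:E].
Proof.
(* The solution of E + k^-2 b = 0. *)
move=> sw E0 b0; pose k := Num.sqrt (- potential V0 f w / energy g1 g2).
have q0 : 0 < - potential V0 f w / energy g1 g2 by rewrite divr_gt0// oppr_gt0.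
have k0 : 0 < k by rewrite sqrtr_gt0.
have k2 : k ^- 2 = energy g1 g2 / - potential V0 f w.
  by rewrite /k sqr_sqrtr ?ltW// invf_div.
exists k => // s t.
have saf := sob_aff s t k0 sw.
have [e1 e2 e3] := dilation V0 adm s t k0 sw.
have z0 : energy g1 g2 + potential V0 f (aff k s t w) = 0.
  rewrite e2 k2 invrN mulrN mulNr -mulrA mulVf ?mulr1 ?subrr//.
  by rewrite lt_eqF.
split.
- by rewrite (dJ_potential V0 adm saf) e1.
- apply: (nonzero_potential (V0 := V0) adm saf).
  rewrite e2; apply: mulf_neq0; last by rewrite lt_eqF.
  by rewrite invr_eq0 expf_neq0// gt_eqF.
- rewrite (J_potential V0 adm saf) e1 z0 mulr0 add0r e3 k2 /projected_energy.
  by congr EFin; rewrite mulrAC.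
Qed.

Lemma chat_compact w gw1 gw2 v gv1 gv2 (N : R) :
  sob w gw1 gw2 -> sob v gv1 gv2 ->
  (forall z, 0 <= w z) -> (forall z, v z <= 0) ->
  (forall z, ~ box N z -> w z = 0) -> (forall z, ~ box N z -> v z = 0) ->
  0 < energy gw1 gw2 -> 0 < energy gv1 gv2 ->
  potential V0 f w < 0 -> potential V0 f v < 0 ->
  (chat V0 f <=
    (projected_energy (energy gw1 gw2) (potential V0 f w) (nehari_energy f w) +
     projected_energy (energy gv1 gv2) (potential V0 f v) (nehari_energy f v))%:E)%E.
Proof.
move=> sw sv w0 v0 wN vN Ew Ev bw bv.
have [k k0 Hk] := nehari_dilate sw Ew bw.
have [l l0 Hl] := nehari_dilate sv Ev bv.
(* Where [W] may be nonzero, |z.1| <= |N| / k, so that [l * z.1 + s] is at least |N| + 1 and [Z]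
   vanishes. Being disjointly supported, [W] and [Z] are the positive and the negative part of their
   sum. *)
pose s := `|N| + l * (`|N| / k) + 1.
pose W := aff k 0 0 w; pose Z := aff l s 0 v.
have WZ z : W z = 0 \/ Z z = 0.
  case: (ltP `|N| `|k * z.1|) => h1.
    left; apply: wN => -[/= + _]; rewrite in_itv/= -ler_norml addr0 => h2.
    by have := le_trans h2 (ler_norm N); rewrite leNgt h1.
  right; apply: vN => -[/= + _]; rewrite in_itv/= => /andP[_ h2].
  have h3 : - (`|N| / k) <= z.1.
    move: h1; rewrite ler_norml => /andP[h1 _].
    by rewrite -mulNr ler_pdivrMr// mulrC.
  have h4 : - (l * (`|N| / k)) <= l * z.1 by rewrite -mulrN ler_pM2l.
  by have := ler_norm N; move: h2; rewrite /s; lra.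
have sW := sob_aff 0 0 k0 sw; have sZ := sob_aff s 0 l0 sv.
have W0 z : 0 <= W z by exact: w0.
have Z0 z : Z z <= 0 by exact: v0.
pose y z := W z + Z z.
have pE : posp y = W.
  apply/funext => z; rewrite /posp /y; case: (WZ z) => e; rewrite e ?add0r ?addr0.
    by rewrite max_r.
  by rewrite max_l.
have nE : negp y = Z.
  apply/funext => z; rewrite /negp /y; case: (WZ z) => e; rewrite e ?add0r ?addr0.
    by rewrite min_l.
  by rewrite min_r.
have Hy : H1 y by exact: sob_H1 (sobD sW sZ).
have [dW nW JW] := Hk 0 0; have [dZ nZ JZ] := Hl s 0.
have yM : nodal_nehari V0 f y.
  rewrite /nodal_nehari /mkset pE nE.
  exact: (conj Hy (conj nW (conj nZ (conj dW dZ)))).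
have -> : (projected_energy (energy gw1 gw2) (potential V0 f w) (nehari_energy f w) +
     projected_energy (energy gv1 gv2) (potential V0 f v) (nehari_energy f v))%:E = J V0 f y.
  by rewrite (J_split V0 adm Hy) pE nE JW JZ EFinD.
by apply: ereal_inf_lbound; exists y.
Qed.

(** The strict signs of the energies and potentials persist for cut-offs with n large, where
    [chat_compact] applies; the projected energy is continuous in its arguments as long as b is
    nonzero. *)
Lemma chat_le w gw1 gw2 v gv1 gv2 :
  sob w gw1 gw2 -> sob v gv1 gv2 ->
  (forall z, 0 <= w z) -> (forall z, v z <= 0) ->
  0 < energy gw1 gw2 -> 0 < energy gv1 gv2 ->
  potential V0 f w < 0 -> potential V0 f v < 0 ->
  (chat V0 f <=
    (projected_energy (energy gw1 gw2) (potential V0 f w) (nehari_energy f w) +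
     projected_energy (energy gv1 gv2) (potential V0 f v) (nehari_energy f v))%:E)%E.
Proof.
move=> sw sv w0 v0 Ew Ev bw bv.
have [wn [hw1 [hw2 [cw [Mw [swn Nw cwn cvw Ecw]]]]]] := cut_converges sw.
have [vn [hv1 [hv2 [cv [Mv [svn Nv cvn cvv Ecv]]]]]] := cut_converges sv.
have mwn n : measurable_fun setT (wn n) by have [[]] := swn n.
have mvn n : measurable_fun setT (vn n) by have [[]] := svn n.
have [bcw kcw] := potential_nehari_cvg sw mwn cwn cvw.
have [bcv kcv] := potential_nehari_cvg sv mvn cvn cvv.
pose a n := projected_energy (energy (hw1 n) (hw2 n)) (potential V0 f (wn n)) (nehari_energy f (wn n)) +
   projected_energy (energy (hv1 n) (hv2 n)) (potential V0 f (vn n)) (nehari_energy f (vn n)).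
have ca : a n @[n --> \oo] --> projected_energy (energy gw1 gw2) (potential V0 f w) (nehari_energy f w) +
     projected_energy (energy gv1 gv2) (potential V0 f v) (nehari_energy f v).
  have nw : potential V0 f w != 0 by rewrite lt_eqF.
  have nv : potential V0 f v != 0 by rewrite lt_eqF.
  exact: (cvgD (projected_energy_cvg Ecw bcw kcw nw) (projected_energy_cvg Ecv bcv kcv nv)).
have Ha : \forall n \near \oo, (chat V0 f <= (a n)%:E)%E.
  near=> n.
  have [N1 HN1] := Nw n; have [N2 HN2] := Nv n.
  have boxS (N N' : R) z : N <= N' -> ~ box N' z -> ~ box N z.
    move=> NN' h [h1 h2]; apply: h; split; move: h1 h2 => /=; rewrite !in_itv/= -!ler_norml => h1 h2;
    exact: le_trans NN'.
  apply: (@chat_compact _ _ _ _ _ _ (Num.max N1 N2)).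
  - exact: swn.
  - exact: svn.
  - by move=> z; have [-> /andP[c0 _]] := cwn n z; rewrite mulr_ge0.
  - by move=> z; have [-> /andP[c0 _]] := cvn n z; rewrite mulr_ge0_le0.
  - by move=> z h; apply: HN1; apply: boxS h; rewrite le_max lexx.
  - by move=> z h; apply: HN2; apply: boxS h; rewrite le_max lexx orbT.
  - by near: n; move/cvgr_gt : Ecw; apply.
  - by near: n; move/cvgr_gt : Ecv; apply.
  - by near: n; move/cvgr_lt : bcw; apply.
  - by near: n; move/cvgr_lt : bcv; apply.
case: (chat V0 f) Ha => [r Ha|[N _ /(_ N (leqnn N))]|_]; last by rewrite leNye.
- rewrite lee_fin; apply: (cvgr_to_ge ca).
  by apply: filterS Ha => n; rewrite lee_fin.
- by rewrite /mkset; move: (a N) => r; rewrite leye_eq.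
Unshelve. all: by end_near. Qed.

End chat_upper_bound.

(** * Constancy of the support *)

Section indicator.
Context {R : realType}.
Notation mu := (@lebesgue_measure R).
Notation leb2 := (@leb2 R).
Implicit Types (u v w p g : R * R -> R).

Definition supp_ind w : R * R -> R := fun z => (0 < w z)%R%:R.

Lemma locint2_bounded w : measurable_fun setT w -> (forall z, `|w z| <= 1) -> locint2 w.
Proof.
move=> mw w1; split => // N.
apply: (@integrable_le _ _ _ leb2 (box N) w (fun=> 1)).
- exact: measurable_box.
- exact: measurable_funTS.
- exact: integrable_box1.
- by move=> z _.
Qed.

Lemma L2_compact_support (k : R * R -> R) (N : R) : continuous k ->
  (forall z, ~ box N z -> k z = 0) -> L2 k.
Proof.
move=> ck kN; have mk := continuous2_measurable ck.
have [B B0 HB] := continuous2_bounded ck kN.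
have l1 : locint2 (fun _ : R * R => (1 : R)).
  by apply: locint2_bounded => // z; rewrite normr1.
have H z : `|k z ^+ 2| <= B ^+ 2 by rewrite normrX lerXn2r// nnegrE.
have H' z : ~ box N z -> k z ^+ 2 = 0 by move=> /kN ->; rewrite expr0n.
apply: integrable_L2 => //.
have := locint2_bounded_mul l1 (measurable_funX 2 mk) H H'.
by apply: eq_integrable => // z _ /=; rewrite mul1r.
Qed.

(** The truncations min(w / e, 1) tend to the indicator of {w > 0}. Their derivative p / e on {w <=
    e} is bounded in L^2 of every box by assumption, and it vanishes where w = 0. It therefore lives
    on {0 < w <= e}, which shrinks to the empty set, and its pairing with a test function tends to
    0. *)
Lemma indicator_acl w p : L2 w -> L2 p -> (forall z, 0 <= w z) -> acl w p ->
  (forall z, w z = 0 -> p z = 0) ->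
  (forall M : R, exists (C e0 : R), [/\ 0 <= C, 0 < e0 & forall e, 0 < e -> e < e0 ->
     \int[leb2]_(z in box M) (if w z <= e then p z ^+ 2 else 0) <= C * e ^+ 2]) ->
  acl (supp_ind w) (fun=> 0).
Proof.
move=> lw lp w0 awp wp HC.
have mw := lw.1; have mp := lp.1.
have mI : measurable_fun setT (supp_ind w) by exact: measurable_above.
have I1 z : `|supp_ind w z| <= 1 by rewrite /supp_ind; case: ltP; rewrite ?normr0 ?normr1.
apply: weak_acl.
- exact: locint2_bounded.
- by apply: locint2_bounded => // z; rewrite normr0.
move=> al al' be N sal sbe dal alN beN.
have cal := smooth1_continuous sal; have cbe := smooth1_continuous sbe.
have cal' : continuous al'.
  have [al2 sal2 dal2] := smooth1_derive sal.
  rewrite (_ : al' = al2); first exact: smooth1_continuous.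
  apply/funext => x.
  by rewrite -(@derive_val _ _ _ _ _ _ _ (dal x)) (@derive_val _ _ _ _ _ _ _ (dal2 x)).
have al'N := cs_derive dal alN.
pose phi (z : R * R) := al z.1 * be z.2.
pose phi' (z : R * R) := al' z.1 * be z.2.
have cphi : continuous phi by exact: continuous_tensor.
have cphi' : continuous phi' by exact: continuous_tensor.
have phiN z : ~ box N z -> phi z = 0.
  by move=> /box_out/orP[/alN e|/beN e]; rewrite /phi e ?mul0r ?mulr0.
have phi'N z : ~ box N z -> phi' z = 0.
  by move=> /box_out/orP[/al'N e|/beN e]; rewrite /phi' e ?mul0r ?mulr0.
have dphi (x y : R) : is_derive x 1 (fun t => phi (t, y)) (phi' (x, y)).
  have := is_deriveZ (be y) (dal x); rewrite /GRing.scale/= mulrC.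
  by congr is_derive; apply/funext => t; rewrite /phi /= mulrC.
have mphi := continuous2_measurable cphi.
have mphi' := continuous2_measurable cphi'.
have l1 : locint2 (fun _ : R * R => (1 : R)).
  by apply: locint2_bounded => // z; rewrite normr1.
have [B B0 HB] := continuous2_bounded cphi phiN.
have [B' B'0 HB'] := continuous2_bounded cphi' phi'N.
have iphi' : leb2.-integrable setT (EFin \o (fun z => `|phi' z|)).
  have := integrable_norm (locint2_bounded_mul l1 mphi' HB' phi'N).
  by apply: eq_integrable => // z _ /=; rewrite mul1r.
have iphi2 : leb2.-integrable setT (EFin \o (fun z => phi z ^+ 2)).
  exact: (L2_integrable (L2_compact_support cphi phiN)).
pose ep (n : nat) : R := n.+1%:R^-1.
have ep0 n : 0 < ep n by rewrite invr_gt0 ltr0n.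
(* This is min(w / e, 1) with e = [ep n], written through a positive part so that [acl_pos] gives
   its derivative. *)
pose vn n z := (ep n)^-1 * (w z - posp (fun z => w z - ep n) z).
pose Gn n z := (ep n)^-1 * (p z - gpos (fun z => w z - ep n) p z).
have av n : acl (vn n) (Gn n).
  have b := acl_pos (aclD awp (acl_cst (- ep n))).
  have := aclZ (ep n)^-1 (aclD awp (aclZ (-1) b)).
  congr acl; apply/funext => z; rewrite mulN1r /vn /Gn; congr (_ * (_ - _)).
  by rewrite /gpos addr0.
have vnE n z : vn n z = if w z <= ep n then (ep n)^-1 * w z else 1.
  rewrite /vn /posp; case: leP => h.
    by rewrite max_r ?subr0// subr_le0.
  rewrite max_l ?subr_ge0 ?ltW//.
  by rewrite (_ : w z - (w z - ep n) = ep n) ?mulVf ?gt_eqF//; lra.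
have GnE n z : Gn n z = if w z <= ep n then (ep n)^-1 * p z else 0.
  rewrite /Gn /gpos subr_gt0; case: leP => h; first by rewrite subr0.
  by rewrite subrr mulr0.
have vn1 n z : 0 <= vn n z <= 1.
  rewrite vnE; case: ifPn => h; last by rewrite ler01 lexx.
  apply/andP; split; first by apply: mulr_ge0 => //; rewrite invr_ge0 ltW.
  by move: (ep0 n) h; move: (ep n) => e e0 h; rewrite ler_pdivrMl// mulr1.
have lvn n : L2 (vn n).
  apply: L2Z; apply: (L2_le lw).
    by apply: measurable_funB => //; apply: measurable_posp; exact: measurable_funB.
  move=> z; rewrite /posp; case: (leP 0 (w z - ep n)) => h.
    rewrite (_ : w z - (w z - ep n) = ep n); last by lra.
    rewrite !ger0_norm//; last by rewrite ltW.
    by rewrite -subr_ge0.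
  by rewrite subr0.
have lGn n : L2 (Gn n).
  apply: L2Z; apply: (L2_le lp).
    by apply: measurable_funB => //; apply: measurable_gpos => //; exact: measurable_funB.
  by move=> z; rewrite /gpos; case: ifPn => h; rewrite ?subrr ?normr0 ?subr0.
have lvn2 n := L2_locint2 (lvn n).
have lGn2 n := L2_locint2 (lGn n).
have parts n : \int[leb2]_z (vn n z * phi' z) = - \int[leb2]_z (Gn n z * phi z).
  have := acl_parts (lvn2 n) (lGn2 n) (av n) cphi cphi' dphi phiN.
  rewrite (EFin_Rintegral measurableT (locint2_bounded_mul (lvn2 n) mphi' HB' phi'N)).
  rewrite (EFin_Rintegral measurableT (locint2_bounded_mul (lGn2 n) mphi HB phiN)).
  by rewrite -EFinN => -[].
pose L := \int[leb2]_z (supp_ind w z * phi' z).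
have cep : ep n @[n --> \oo] --> (0 : R) by exact: cvg_harmonic.
have CL : \int[leb2]_z (vn n z * phi' z) @[n --> \oo] --> L.
  have [||||_ C] := @dominated_cvg_Rintegral _ _ _ leb2 setT
    (fun n z => vn n z * phi' z) (fun z => supp_ind w z * phi' z) (fun z => `|phi' z|) measurableT.
  - by move=> n; apply: measurable_funM => //; exact: (lvn n).1.
  - move=> z _; apply: cvgM; last exact: cvg_cst.
    rewrite /supp_ind; case: ltP => wz.
      apply: cvg_near_cst; near=> n; rewrite vnE leNgt.
      have h : ep n < w z by near: n; move/cvgr_lt : cep; apply.
      by rewrite h.
    apply: cvg_near_cst; apply: nearW => n.
    have w00 : w z = 0 by apply: le_anti; rewrite wz w0.
    by rewrite vnE w00 ltW// mulr0.
  - exact: iphi'.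
  - move=> n z _; rewrite normrM ler_piMl//.
    by have /andP[h1 h2] := vn1 n z; rewrite ger0_norm.
  exact: C.
have [C [e0 [C0 e00 HCe]]] := HC N.
pose sn n := \int[leb2]_z (if 0 < w z <= ep n then phi z ^+ 2 else 0).
have msn n : measurable_fun setT (fun z => if 0 < w z <= ep n then phi z ^+ 2 else 0).
  apply: measurable_fun_ifT => //; last exact: measurable_funX.
  by apply: measurable_and; [exact: measurable_fun_ltr|exact: measurable_fun_ler].
have sdom n z : `|if 0 < w z <= ep n then phi z ^+ 2 else 0| <= phi z ^+ 2.
  by case: ifPn => _; rewrite ?normr0 ?sqr_ge0// ger0_norm// sqr_ge0.
have isn n : leb2.-integrable setT (EFin \o (fun z => if 0 < w z <= ep n then phi z ^+ 2 else 0)).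
  apply: (@integrable_le _ _ _ leb2 setT _ (fun z => phi z ^+ 2)).
  - exact: measurableT.
  - exact: msn.
  - exact: iphi2.
  - by move=> z _; exact: sdom.
have Csn : sn n @[n --> \oo] --> (0 : R).
  have [||||_ ] := @dominated_cvg_Rintegral _ _ _ leb2 setT
    (fun n z => if 0 < w z <= ep n then phi z ^+ 2 else 0) (fun _ => 0) (fun z => phi z ^+ 2) measurableT.
  - exact: msn.
  - move=> z _; apply: cvg_near_cst; case: (ltP 0 (w z)) => wz; last exact: nearW.
    near=> n; rewrite /= leNgt.
    have h : ep n < w z by near: n; move/cvgr_lt : cep; apply.
    by rewrite h ?andbF.
  - exact: iphi2.
  - by move=> n z _; exact: sdom.
  by rewrite Rintegral_cst// mul0r.
(* Young's inequality a b <= de a^2 + b^2 / (4 de). The first term is bounded by [de * C] uniformly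
   in n, the second tends to 0 for fixed [de]; afterwards [de] is arbitrary. *)
have bound (de : R) : 0 < de -> \forall n \near \oo,
    `|\int[leb2]_z (vn n z * phi' z)| <= de * C + (4 * de)^-1 * sn n.
  move=> de0; near=> n; rewrite parts normrN.
  have iGp := locint2_bounded_mul (lGn2 n) mphi HB phiN.
  apply: (le_trans (le_normr_Rintegral measurableT iGp)).
  pose q z := if w z <= ep n then p z ^+ 2 else 0.
  have mq : measurable_fun setT q.
    by apply: measurable_fun_ifT => //; [exact: measurable_fun_ler|exact: measurable_funX].
  have iq : leb2.-integrable (box N) (EFin \o q).
    apply: (@integrable_le _ _ _ leb2 (box N) q (fun z => p z ^+ 2)).
    - exact: measurable_box.
    - exact: measurable_funTS.
    - by apply: integrableS (L2_integrable lp) => //; exact: measurable_box.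
    - by move=> z _; rewrite /q; case: ifPn; rewrite ?normr0 ?sqr_ge0// ger0_norm// sqr_ge0.
  have iq' : leb2.-integrable setT (EFin \o (q \_ (box N))).
    rewrite -restrict_EFin -integrable_mkcond; first exact: iq.
    exact: measurable_box.
  have Hq : \int[leb2]_z (q \_ (box N)) z <= C * ep n ^+ 2.
    rewrite -Rintegral_mkcond; apply: HCe => //.
    by near: n; move/cvgr_lt : cep; apply.
  apply: (@le_trans _ _ (\int[leb2]_z ((de * (ep n) ^- 2) * (q \_ (box N)) z +
     (4 * de)^-1 * (if 0 < w z <= ep n then phi z ^+ 2 else 0)))).
    apply: le_Rintegral => //.
    - exact: (integrable_norm iGp).
    - by apply: integrableD_real => //; apply: integrableZ_real.
    - move=> z _; rewrite normrM.
      have [zb|zb] := pselect (box N z); last first.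
        rewrite (phiN z zb) normr0 mulr0 addr_ge0//.
          by rewrite patchE memNset// mulr0.
        by apply: mulr_ge0; [rewrite invr_ge0 mulr_ge0// ltW|case: ifPn => // _; rewrite expr0n].
      rewrite patchE mem_set// /q GnE; case: (leP (w z) (ep n)) => wn; last first.
        by rewrite normr0 mul0r mulr0 andbF mulr0 addr0.
      rewrite andbT; case: (ltP 0 (w z)) => wz; last first.
        have w00 : w z = 0 by apply: le_anti; rewrite wz w0.
        by rewrite (wp z w00) mulr0 normr0 mul0r expr0n !mulr0 addr0.
      rewrite normrM normfV (ger0_norm (ltW (ep0 n))) -[p z ^+ 2]real_normK ?num_real//.
      rewrite -[phi z ^+ 2]real_normK ?num_real// -exprVn.
      move: (ep n)^-1 `|p z| `|phi z| => r a b.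
      rewrite -subr_ge0 [X in 0 <= X](_ : _ = de * (r * a - (2 * de)^-1 * b) ^+ 2).
        by rewrite mulr_ge0 ?sqr_ge0// ltW.
      by field; rewrite gt_eqF.
  rewrite RintegralD//; [|exact: integrableZ_real..].
  rewrite !RintegralZl// -/(sn n) lerD2r -mulrA ler_pM2l//.
  rewrite mulrC ler_pdivrMr ?exprn_gt0//.
have L0 : L = 0.
  apply: (@le_eps_eq _ _ _ C C0) => e e0'; rewrite subr0.
  have H1 : `|\int[leb2]_z (vn n z * phi' z)| @[n --> \oo] --> `|L| by exact: cvg_norm.
  have H2 : e * C + (4 * e)^-1 * sn n @[n --> \oo] --> C * e.
    have := cvgD (cvg_cst (e * C)) (cvgM (cvg_cst (4 * e)^-1) Csn).
    by rewrite mulr0 addr0 mulrC => H; exact: H.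
  exact: (ler_cvg_to H1 H2 (bound e e0')).
have iI : leb2.-integrable setT (EFin \o (fun z => supp_ind w z * phi' z)).
  exact: (locint2_bounded_mul (locint2_bounded mI I1) mphi' HB' phi'N).
have := EFin_Rintegral measurableT iI; rewrite -/L L0 => e.
transitivity (0 : \bar R); first exact: e.
under eq_integral do rewrite mul0r.
by rewrite integral0 oppe0.
Unshelve. all: by end_near. Qed.

Lemma ae_ex (P : R -> Prop) : {ae mu, forall x, P x} -> exists x, P x.
Proof.
move=> [N [mN N0 PN]]; apply: contrapT => /forallNP H.
have T : N = setT by apply/seteqP; split => // x _; apply: PN; exact: H.
have M : mu setT = +oo%E by rewrite -set_itvNyy lebesgue_measure_itv.
by move: N0; rewrite T [X in X = _ -> _]M.
Qed.

(** Horizontal lines show that w depends on y alone, almost everywhere; a single good vertical line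
    then shows that this function of y is almost everywhere constant. *)
Lemma acl_zero_constant w : measurable_fun setT w -> (forall z, 0 <= w z) ->
  acl w (fun=> 0) -> acl (swp w) (fun=> 0) -> exists d, {ae leb2, forall z, w z = d}.
Proof.
move=> mw w0 a1 a2.
have p0 x : primitive (fun _ : R => (0 : R)) x = 0.
  rewrite /primitive; case: ifPn => h; rewrite Rintegral_cst_itv ?mul0r ?oppr0//.
  by rewrite ltW// ltNge.
have line v : acl v (fun=> 0) -> {ae mu, forall y, exists c, {ae mu, forall x, v (x, y) = c}}.
  apply: ae_sub => y [_ _ [c Hc]]; exists c; apply: ae_sub Hc => x ->.
  by rewrite p0 addr0.
have H1 := line _ a1; have H2 := line _ a2.
(* the mean of [w] over the unit segment of a horizontal line selects measurably
   the constant value of [w] on that line *)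
pose k (z : R * R) : R := w z * \1_(`[0, 1]%classic : set R) z.1.
have mk : measurable_fun setT k.
  apply: measurable_funM => //; apply: measurable_fst_comp.
  exact: measurable_indic.
have mkE : measurable_fun setT (EFin \o k) by exact/measurable_EFinP.
have k0 z : (0 <= (EFin \o k) z)%E by rewrite lee_fin mulr_ge0.
have mG := measurable_fun_fubini_tonelli_G (m1 := mu) _ mkE k0.
pose m (y : R) := fine (\int[mu]_x (EFin \o k) (x, y)).
have mm : measurable_fun setT m.
  exact: (measurableT_comp (@fine_measurable R setT measurableT) mG).
have L : {ae mu, forall y, {ae mu, forall x, w (x, y) = m y}}.
  apply: ae_sub H1 => y [c Hc].
  suff -> : m y = c by exact: Hc.
  have e : (\int[mu]_x (EFin \o k) (x, y) = \int[mu]_x (c * \1_(`[0, 1]%classic : set R) x)%:E)%E.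
    apply: ae_eq_integral => //.
    - exact: (measurableT_comp mkE (pair2_measurable y)).
    - apply/measurable_EFinP; apply: measurable_funM => //; exact: measurable_indic.
    - by apply: ae_sub Hc => x Hx _; rewrite /k /= Hx.
  rewrite /m e.
  transitivity (\int[mu]_(x in `[0, 1]) c); last first.
    by rewrite Rintegral_cst_itv// subr0 mulr1.
  rewrite [RHS]Rintegral_mkcond /Rintegral; congr fine; apply: eq_integral => x _.
  by rewrite patchE indicE; case: ifPn; rewrite ?mulr1 ?mulr0.
have E1 : {ae leb2, forall z, w z = m z.2}.
  by apply: (ae_eq_lines mw (measurable_snd_comp mm)).
have E2 := ae_lines (ae_swap E1).
have [x [[d Hd] Hx]] := ae_ex (ae_sub2 (fun x a b => conj a b) H2 E2).
have D : {ae mu, forall y, m y = d}.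
  by apply: ae_sub2 Hd Hx => y; rewrite /swp /= => -> ->.
exists d; apply: (ae_eq_lines mw) => //.
by apply: ae_sub2 L D => y Ly Dy; apply: ae_sub Ly => t ->.
Qed.

End indicator.

(** * Comparison argument for the positive part of a minimiser *)

Section minimiser.
Context {R : realType}.
Notation mu := (@lebesgue_measure R).
Notation leb2 := (@leb2 R).
Implicit Types (u v w p g : R * R -> R).
Variables (V0 theta : R) (f : R -> R).
Hypothesis adm : admissible theta f.

Lemma Rintegral_eq0_ae (G : R * R -> R) : leb2.-integrable setT (EFin \o G) ->
  (forall z, 0 <= G z) -> \int[leb2]_z G z = 0 -> {ae leb2, forall z, G z = 0}.
Proof.
move=> iG G0 e.
have mG : measurable_fun setT (EFin \o G) := measurable_int _ iG.
have H : (\int[leb2]_z `|(EFin \o G) z| = 0)%E.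
  transitivity (\int[leb2]_z (G z)%:E)%E.
    by apply: eq_integral => z _; rewrite /= ger0_norm.
  by rewrite (EFin_Rintegral measurableT iG) e.
have := (ae_eq_integral_abs leb2 measurableT mG).1 H.
by apply: ae_sub => z /(_ I)[].
Qed.

(** With zero energy the first derivative vanishes almost everywhere, and [gagliardo_nirenberg] then
    bounds the integral of u^2 by 0. *)
Lemma energy_gt0 u g1 g2 : sob u g1 g2 -> nonzero_ae u -> 0 < energy g1 g2.
Proof.
move=> su nu; have [lu l1 l2 a1 a2] := su.
rewrite lt_neqAle; apply/andP; split; last first.
  by apply: Rintegral_ge0 => z _; rewrite addr_ge0 ?sqr_ge0.
apply/eqP => e; apply: nu.
have H : {ae leb2, forall z, g1 z ^+ 2 + g2 z ^+ 2 = 0}.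
  apply: Rintegral_eq0_ae => //; first exact: energy_integrable.
  by move=> z; rewrite addr_ge0 ?sqr_ge0.
have z1 : (\int[leb2]_z `|g1 z|%:E = 0)%E.
  rewrite -(integral0 leb2 setT); apply: ae_eq_integral => //.
    by apply/measurable_EFinP; apply: measurableT_comp => //; exact: l1.1.
  apply: ae_sub H => z /eqP; rewrite paddr_eq0 ?sqr_ge0// => /andP[+ _] _.
  by rewrite sqrf_eq0 => /eqP ->; rewrite normr0.
have := gagliardo_nirenberg lu l1.1 l2.1 a1 a2.
rewrite [X in (_ <= X * _)%E]z1 mul0e => le0.
have e0 : (\int[leb2]_z (u z ^+ 2)%:E = 0)%E.
  by apply/eqP; rewrite eq_le le0 integral_ge0// => z _; rewrite lee_fin sqr_ge0.
have : {ae leb2, forall z, u z ^+ 2 = 0}.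
  apply: Rintegral_eq0_ae; first exact: L2_integrable.
    by move=> z; rewrite sqr_ge0.
  by rewrite /Rintegral e0.
by apply: ae_sub => z /eqP; rewrite sqrf_eq0 => /eqP.
Qed.

Lemma nehari_energy_gt0 u g1 g2 : sob u g1 g2 -> nonzero_ae u -> 0 < nehari_energy f u.
Proof.
move=> su nu; rewrite lt_neqAle (nehari_energy_ge0 adm) andbT.
apply/eqP => e; apply: nu.
have : {ae leb2, forall z, 2^-1 * (u z * f (u z)) - primitive f (u z) = 0}.
  apply: Rintegral_eq0_ae => //; last by move=> z; exact: (K_ge0 adm).
  apply: integrableB_real => //; last exact: (F_integrable adm su).
  by apply: integrableZ_real => //; exact: (h_integrable adm su).
apply: ae_sub => z Hz; apply/eqP; apply: contraT => s0.
by have := K_gt0 adm s0; rewrite Hz ltxx.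
Qed.

(** The bump is taken on the box enlarged by 1. On [box M] the arguments of its four [flat 0]
    factors are therefore at least 1, and each factor is at least exp(-1). *)
Lemma cutoff_function (M : R) : exists psi h1 h2, [/\ sob psi h1 h2,
  forall z, 0 <= psi z <= 1 & forall z, box M z -> expR (-1) ^+ 4 <= psi z :> R].
Proof.
pose al := cbump 0 (- (M + 1)) (M + 1) : R -> R.
have sal : smooth1 al by exact: smooth1_cbump.
have [al' sal' dal] := smooth1_derive sal.
have cal := smooth1_continuous sal; have cal' := smooth1_continuous sal'.
have alN x : M + 1 < `|x| -> al x = 0.
  move=> h; apply: cbump_out; apply/negP => /andP[h1 h2].
  by move: h; rewrite ltNge ler_norml !ltW.
have al'N := cs_derive dal alN.
have l2 (a b : R -> R) : continuous a -> continuous b ->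
    (forall x, M + 1 < `|x| -> a x = 0) -> (forall x, M + 1 < `|x| -> b x = 0) ->
    L2 (fun z : R * R => a z.1 * b z.2).
  move=> ca cb aN bN; apply: (@L2_compact_support _ _ (M + 1)).
    exact: continuous_tensor.
  by move=> z /box_out/orP[/aN e|/bN e]; rewrite e ?mul0r ?mulr0.
exists (fun z => al z.1 * al z.2), (fun z => al' z.1 * al z.2), (fun z => al z.1 * al' z.2).
have fl (t : R) : 1 <= t -> expR (-1) <= flat 0 t :> R.
  move=> t1; have t0 : 0 < t by exact: lt_le_trans t1.
  by rewrite /flat t0 expr0 mul1r ler_expR lerN2 invf_le1.
have al1 x : x \in `[- M, M] -> expR (-1) ^+ 2 <= al x.
  rewrite in_itv/= => /andP[h1 h2]; rewrite /al /cbump !mul1r expr2.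
  by apply: ler_pM; rewrite ?expR_ge0//; apply: fl; lra.
split.
- split; [exact: l2..| |].
    apply: aeW => y; have := acl1Z (al y) (acl1_C1 dal cal').
    by congr acl1; apply/funext => x; rewrite /= mulrC.
  by apply: aeW => y; exact: (acl1Z (al y) (acl1_C1 dal cal')).
- move=> z; rewrite mulr_ge0 ?cbump_ge0//=.
  by apply: mulr_ile1; rewrite ?cbump_ge0 ?cbump_le1.
- move=> [x y] [/= hx hy]; rewrite (_ : expR (-1) ^+ 4 = expR (-1) ^+ 2 * expR (-1) ^+ 2); last by rewrite -exprD.
  by apply: ler_pM; rewrite ?sqr_ge0//; exact: al1.
Qed.

(** * The competitor max(w, e psi) *)

Section competitor.
Variables (w p1 p2 psi h1 h2 : R * R -> R) (e : R).
Hypotheses (sw : sob w p1 p2) (spsi : sob psi h1 h2).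
Hypotheses (w0 : forall z, 0 <= w z) (psi01 : forall z, 0 <= psi z <= 1).
Hypotheses (e0 : 0 < e) (e1 : e <= 1).

Let below z := w z < e * psi z.
Definition competitor z := if below z then e * psi z else w z.
Definition competitor_grad p h z : R := if below z then e * h z else p z.

Lemma sob_competitor :
  sob competitor (competitor_grad p1 h1) (competitor_grad p2 h2).
Proof.
have := sobD sw (sob_pos (sobD (sobZ e spsi) (sobZ (-1) sw))).
have E p h : (fun z => p z + gpos (fun z => e * psi z + -1 * w z)
    (fun z => e * h z + -1 * p z) z) = competitor_grad p h.
  apply/funext => z; rewrite /gpos /competitor_grad /below !mulN1r subr_gt0.
  by case: ifPn => _; rewrite ?addr0// addrC subrK.
rewrite !E; congr sob; apply/funext => z; rewrite /posp /competitor /below.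
rewrite mulN1r; case: ltP => h; first by rewrite max_l ?subr_ge0 ?ltW// addrC subrK.
by rewrite max_r ?addr0// subr_le0.
Qed.

Lemma competitor_ge0 z : 0 <= competitor z.
Proof.
rewrite /competitor; case: ifP => // _.
by have /andP[h _] := psi01 z; rewrite mulr_ge0// ltW.
Qed.

Lemma measurable_below : measurable_fun setT below.
Proof.
have [lw _ _ _ _] := sw; have [lp _ _ _ _] := spsi.
apply: measurable_fun_ltr; first exact: lw.1.
by apply: measurable_funM => //; exact: lp.1.
Qed.

Lemma below_integrable :
  leb2.-integrable setT (EFin \o (fun z => if below z then p1 z ^+ 2 + p2 z ^+ 2 else 0)).
Proof.
have [lw l1 l2 _ _] := sw; have i := energy_integrable l1 l2.
apply: (@integrable_le _ _ _ leb2 setT _ (fun z => p1 z ^+ 2 + p2 z ^+ 2)) => //.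
  apply: measurable_fun_ifT => //; first exact: measurable_below.
  exact: integrable_measurable i.
move=> z _; have h : 0 <= p1 z ^+ 2 + p2 z ^+ 2 by rewrite addr_ge0 ?sqr_ge0.
by case: ifPn => _; rewrite ?normr0// ger0_norm.
Qed.

Lemma energy_competitor :
  energy (competitor_grad p1 h1) (competitor_grad p2 h2) <=
  energy p1 p2 + e ^+ 2 * energy h1 h2 -
  \int[leb2]_z (if below z then p1 z ^+ 2 + p2 z ^+ 2 else 0).
Proof.
have [_ l1 l2 _ _] := sw; have [_ k1 k2 _ _] := spsi.
have [_ m1 m2 _ _] := sob_competitor.
have i1 := energy_integrable l1 l2; have i2 := energy_integrable k1 k2.
have i3 := below_integrable.
have i2' := integrableZ_real (e ^+ 2) measurableT i2.
rewrite /energy -RintegralZl// -RintegralD// -RintegralB//; last exact: integrableD_real.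
apply: le_Rintegral => //.
- exact: energy_integrable m1 m2.
- by apply: integrableB_real => //; exact: integrableD_real.
- move=> z _; rewrite /competitor_grad; case: ifPn => _.
    by rewrite !exprMn -mulrDr addrAC subrr add0r.
  by rewrite subr0 lerDl mulr_ge0 ?sqr_ge0// addr_ge0 ?sqr_ge0.
Qed.

Lemma competitor_sqr z : competitor z ^+ 2 <= w z ^+ 2 + e ^+ 2 * psi z ^+ 2.
Proof.
rewrite /competitor; case: ifPn => _; first by rewrite exprMn lerDr sqr_ge0.
by rewrite lerDl mulr_ge0 ?sqr_ge0.
Qed.

Variable C : R.
Hypotheses (C0 : 0 <= C) (hC : forall s, 0 <= s -> s <= 1 -> s * f s <= C * s ^+ 2).

Lemma scaled_psi01 z : 0 <= e * psi z <= 1.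
Proof.
have /andP[a b] := psi01 z.
by apply/andP; split; [apply: mulr_ge0|apply: mulr_ile1] => //; exact: ltW.
Qed.

(** Where the competitor differs from w, 0 <= w < e psi <= 1, so w f(w) <= C e^2 psi^2, while the
    competitor's own term is nonnegative. *)
Lemma competitor_h z :
  w z * f (w z) - C * e ^+ 2 * psi z ^+ 2 <= competitor z * f (competitor z).
Proof.
have c0 : 0 <= C * e ^+ 2 * psi z ^+ 2.
  by apply: mulr_ge0; [apply: mulr_ge0 => //; exact: sqr_ge0|exact: sqr_ge0].
rewrite /competitor; case: ifPn => b; last by rewrite lerBlDr lerDl.
apply: (@le_trans _ _ 0); last exact: (h_ge0 adm).
have /andP[a1 a2] := scaled_psi01 z.
rewrite subr_le0; apply: (le_trans (hC (w0 z) (le_trans (ltW b) a2))).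
rewrite -mulrA; apply: ler_wpM2l => //; rewrite -exprMn lerXn2r ?nnegrE//.
exact: ltW.
Qed.

Lemma competitor_K z :
  2^-1 * (competitor z * f (competitor z)) - primitive f (competitor z) <=
  2^-1 * (w z * f (w z)) - primitive f (w z) + C * e ^+ 2 * psi z ^+ 2.
Proof.
have c0 : 0 <= C * e ^+ 2 * psi z ^+ 2.
  by apply: mulr_ge0; [apply: mulr_ge0 => //; exact: sqr_ge0|exact: sqr_ge0].
rewrite /competitor; case: ifPn => b; last by rewrite lerDl.
have /andP[a1 a2] := scaled_psi01 z.
have := hC a1 a2; rewrite exprMn mulrA => h.
have := K_ge0 adm (w z); have := F_ge0 adm (e * psi z); have := h_ge0 adm (e * psi z).
by move: h c0; lra.
Qed.

Lemma potential_competitor : 0 <= V0 ->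
  potential V0 f competitor <=
  potential V0 f w + e ^+ 2 * ((V0 + C) * \int[leb2]_z (psi z ^+ 2)).
Proof.
move=> V00.
have [lw _ _ _ _] := sw; have [lp _ _ _ _] := spsi.
have sc := sob_competitor; have [lc _ _ _ _] := sc.
have iw := L2_integrable lw; have ip := L2_integrable lp; have ic := L2_integrable lc.
have H1 : \int[leb2]_z (competitor z ^+ 2) <=
    \int[leb2]_z (w z ^+ 2) + e ^+ 2 * \int[leb2]_z (psi z ^+ 2).
  have ip' := integrableZ_real (e ^+ 2) measurableT ip.
  rewrite -RintegralZl// -RintegralD//; apply: le_Rintegral => //.
    exact: integrableD_real.
  by move=> z _; exact: competitor_sqr.
have H2 : \int[leb2]_z (w z * f (w z)) - C * e ^+ 2 * \int[leb2]_z (psi z ^+ 2) <=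
    \int[leb2]_z (competitor z * f (competitor z)).
  have ip' := integrableZ_real (C * e ^+ 2) measurableT ip.
  have ihw := h_integrable adm sw.
  rewrite -RintegralZl// -RintegralB//; apply: le_Rintegral => //.
  - exact: integrableB_real.
  - exact: (h_integrable adm sc).
  - by move=> z _; exact: competitor_h.
rewrite /potential; have H3 := ler_wpM2l V00 H1.
move: H2 H3; move: (\int[leb2]_z (competitor z * _)) (\int[leb2]_z (w z * _)) => a b.
move: (\int[leb2]_z (competitor z ^+ 2)) (\int[leb2]_z (w z ^+ 2)) (\int[leb2]_z (psi z ^+ 2)) => c d k H2 H3.
rewrite lerBlDr; apply: (le_trans H3).
rewrite (_ : V0 * d - b + _ + a = V0 * (d + e ^+ 2 * k) + (a - (b - C * e ^+ 2 * k))); last by ring.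
by rewrite lerDl subr_ge0.
Qed.

Lemma nehari_competitor : nehari_energy f competitor <=
  nehari_energy f w + e ^+ 2 * (C * \int[leb2]_z (psi z ^+ 2)).
Proof.
have [lp _ _ _ _] := spsi; have sc := sob_competitor.
have ip' := integrableZ_real (C * e ^+ 2) measurableT (L2_integrable lp).
have iK v g1 g2 : sob v g1 g2 -> leb2.-integrable setT
    (EFin \o (fun z => 2^-1 * (v z * f (v z)) - primitive f (v z))).
  move=> sv; apply: integrableB_real => //; last exact: (F_integrable adm sv).
  by apply: integrableZ_real => //; exact: (h_integrable adm sv).
have iw := iK _ _ _ sw.
rewrite (mulrA (e ^+ 2)) (mulrC (e ^+ 2)) -RintegralZl//; last exact: L2_integrable.
rewrite -RintegralD//; apply: le_Rintegral => //.
- exact: iK sc.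
- exact: integrableD_real.
- by move=> z _; exact: competitor_K.
Qed.

End competitor.

(* w minimises the projected energy E * K / - b; denominators are cleared. *)
Definition minimises w := forall v q1 q2, sob v q1 q2 -> (forall z, 0 <= v z) ->
  potential V0 f v < 0 ->
  nehari_energy f w * - potential V0 f v <= energy q1 q2 * nehari_energy f v.

(** With P the integral to be bounded, A the energy of w and K its Nehari energy, minimality against
    the competitor reads K (A - e^2 B) <= (A + e^2 D - P) (K + e^2 k). The products K A cancel and P
    K = O(e^2) is left. *)
Lemma small_gradient w p1 p2 psi h1 h2 : 0 <= V0 -> sob w p1 p2 -> sob psi h1 h2 ->
  (forall z, 0 <= w z) -> (forall z, 0 <= psi z <= 1) -> nonzero_ae w ->
  energy p1 p2 + potential V0 f w = 0 -> minimises w ->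
  exists C e0 : R, [/\ 0 <= C, 0 < e0 & forall e, 0 < e -> e < e0 ->
    \int[leb2]_z (if w z < e * psi z then p1 z ^+ 2 + p2 z ^+ 2 else 0) <= C * e ^+ 2].
Proof.
move=> V00 sw spsi w0 psi01 nw Ew Hmin.
have A0 := energy_gt0 sw nw; have K0 := nehari_energy_gt0 sw nw.
have [C1 C10 HC1] := h_growth adm.
pose C := C1 * expR (4 * pi).
have C0 : 0 <= C by rewrite mulr_ge0 ?expR_ge0.
have hC (s : R) : 0 <= s -> s <= 1 -> s * f s <= C * s ^+ 2.
  move=> s0 s1; apply: (le_trans (HC1 s)); rewrite /C -[leRHS]mulrA; apply: ler_wpM2l => //.
  rewrite mulrC; apply: ler_wpM2r; first exact: sqr_ge0.
  rewrite ler_expR ler_piMr ?mulr_ge0 ?pi_ge0//.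
  by rewrite expr2 mulr_ile1.
pose S := \int[leb2]_z (psi z ^+ 2).
have S0 : 0 <= S by apply: Rintegral_ge0 => z _; exact: sqr_ge0.
pose D := energy h1 h2.
have D0 : 0 <= D by apply: Rintegral_ge0 => z _; rewrite addr_ge0 ?sqr_ge0.
pose A := energy p1 p2; pose K := nehari_energy f w.
pose B := (V0 + C) * S; pose k := C * S.
have B0 : 0 <= B by rewrite mulr_ge0// addr_ge0.
have k0 : 0 <= k by rewrite mulr_ge0.
(* The first value collects the terms of order e^2, with e^4 bounded by e^2. The second ensures e <=
   1, as the quadratic bound on s f(s) requires, and e^2 B < A, so that the competitor has negative
   potential. *)
exists ((K * (B + D) + k * (A + D)) / K), (Num.min 1 (A / (B + 1))).
have AB : 0 < A / (B + 1) by rewrite divr_gt0// ltr_wpDl.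
split.
- apply: divr_ge0; last exact: ltW.
  by apply: addr_ge0; apply: mulr_ge0 => //; [exact: ltW|exact: addr_ge0|apply: addr_ge0 => //; exact: ltW].
- by rewrite lt_min ltr01.
move=> e e0; rewrite lt_min => /andP[e1 eA].
have e1' := ltW e1.
have sc := sob_competitor e sw spsi.
have H1 := energy_competitor e sw spsi.
have H2 := potential_competitor sw spsi w0 psi01 e0 e1' C0 hC V00.
have H3 := nehari_competitor sw spsi psi01 e0 e1' C0 hC.
rewrite -/A -/D in H1; rewrite -/S -/B in H2; rewrite -/S -/k -/K in H3.
have pw : potential V0 f w = - A by apply/eqP; rewrite -addr_eq0 addrC Ew.
have eB : e ^+ 2 * B < A.
  move: eA; rewrite ltr_pdivlMr ?ltr_wpDl// => eA; apply: le_lt_trans eA.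
  rewrite expr2 -mulrA ler_pM2l//; apply: (@le_trans _ _ B); last by rewrite lerDl.
  by rewrite ler_piMl.
have pc : potential V0 f (competitor w psi e) < 0.
  by apply: (le_lt_trans H2); rewrite pw addrC subr_lt0.
have c0 z : 0 <= competitor w psi e z by exact: competitor_ge0.
have := Hmin _ _ _ sc c0 pc; rewrite -/K.
have E0 : 0 <= energy (competitor_grad w psi e p1 h1) (competitor_grad w psi e p2 h2).
  by apply: Rintegral_ge0 => z _; rewrite addr_ge0 ?sqr_ge0.
have P0 : 0 <= \int[leb2]_z (if w z < e * psi z then p1 z ^+ 2 + p2 z ^+ 2 else 0).
  by apply: Rintegral_ge0 => z _; case: ifP => // _; rewrite addr_ge0 ?sqr_ge0.
rewrite pw in H2.
move: H1 H2 H3 E0 P0 A0 K0 eB; rewrite -/A -/K.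
move: (\int[leb2]_z _) => P.
move: (energy (competitor_grad _ _ _ _ _) _) (nehari_energy f (competitor _ _ _)) (potential V0 f (competitor _ _ _)).
move=> E' K' b' H1 H2 H3 E0 P0 A0 K0 eB H.
clear -H1 H2 H3 E0 P0 A0 K0 eB H e0 e1 B0 k0 D0.
clearbody A K B k D.
rewrite mulrAC ler_pdivlMr//.
have L1 : K * (A - e ^+ 2 * B) <= K * - b' by apply: ler_wpM2l; [exact: ltW|lra].
have L2 : E' * K' <= (A + e ^+ 2 * D - P) * (K + e ^+ 2 * k).
  apply: (@le_trans _ _ (E' * (K + e ^+ 2 * k))); first exact: ler_wpM2l.
  by apply: ler_wpM2r => //; apply: addr_ge0; [exact: ltW|rewrite mulr_ge0 ?sqr_ge0].
have e2 : e ^+ 2 <= 1 by rewrite expr2 mulr_ile1 ?ltW.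
have L3 := le_trans (le_trans L1 H) L2.
have q0 : 0 <= e ^+ 2 by exact: sqr_ge0.
move: (e ^+ 2) q0 e2 L3 => q q0 q1 L3.
have M1 : 0 <= P * (q * k) by rewrite !mulr_ge0.
have M2 : q * (q * (D * k)) <= q * (D * k).
  by apply: ler_piMl => //; rewrite !mulr_ge0.
nra.
Qed.

Lemma box_small_gradient w p1 p2 (M : R) : 0 <= V0 -> sob w p1 p2 ->
  (forall z, 0 <= w z) -> nonzero_ae w ->
  energy p1 p2 + potential V0 f w = 0 -> minimises w ->
  exists C e0 : R, [/\ 0 <= C, 0 < e0 & forall e, 0 < e -> e < e0 ->
    \int[leb2]_(z in box M) (if w z <= e then p1 z ^+ 2 + p2 z ^+ 2 else 0) <= C * e ^+ 2].
Proof.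
move=> V00 sw w0 nw Ew Hmin.
have [psi [h1 [h2 [spsi psi01 psiM]]]] := cutoff_function M.
have [C [e0 [C0 e00 HC]]] := small_gradient V00 sw spsi w0 psi01 nw Ew Hmin.
(* On the box [r * psi] is at least 2, so w <= e implies w < (e r) psi, including the points where
   both w and the gradient bound must be strict. *)
pose r := 2 / expR (-1) ^+ 4 : R.
have x0 : 0 < expR (-1) ^+ 4 :> R by rewrite exprn_gt0 ?expR_gt0.
have r0 : 0 < r by rewrite divr_gt0.
exists (C * r ^+ 2), (e0 / r); split => [||e ep].
- by rewrite mulr_ge0 ?sqr_ge0.
- by rewrite divr_gt0.
rewrite ltr_pdivlMr// => er.
rewrite -mulrA -exprMn mulrC (mulrC r).
have := HC _ (mulr_gt0 ep r0) er; rewrite (mulrC C); apply: le_trans.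
rewrite Rintegral_mkcond; have [_ l1 l2 _ _] := sw; have [[mw _] _ _ _ _] := sw.
apply: le_Rintegral => //.
- have mb := @measurable_box R M.
  apply: (@integrable_le _ _ _ leb2 setT _ (fun z => p1 z ^+ 2 + p2 z ^+ 2)) => //.
  + apply: (measurable_restrictT _ _).1 => //.
    apply: measurable_funTS; apply: measurable_fun_ifT => //; first exact: measurable_fun_ler.
    exact: integrable_measurable (energy_integrable l1 l2).
  + exact: energy_integrable.
  + move=> z _; have h : 0 <= p1 z ^+ 2 + p2 z ^+ 2 by rewrite addr_ge0 ?sqr_ge0.
    rewrite patchE; case: ifPn => _; rewrite ?normr0//.
    by case: ifPn => _; rewrite ?normr0// ger0_norm.
- exact: below_integrable sw spsi.
- move=> z _; have h : 0 <= p1 z ^+ 2 + p2 z ^+ 2 by rewrite addr_ge0 ?sqr_ge0.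
  rewrite patchE; case: ifPn => [|_]; last by case: ifP.
  rewrite inE => zb; case: ifPn => [we|_]; last by case: ifP.
  have -> // : w z < e * r * psi z.
  apply: (le_lt_trans we); rewrite -mulrA ltr_pMr//.
  apply: (@lt_le_trans _ _ (r * expR (-1) ^+ 4)); last by rewrite ler_pM2l// psiM.
  by rewrite /r -mulrA mulVf ?mulr1 ?ltr1n// gt_eqF.
Qed.

(** [box_small_gradient] supplies the quadratic bound of [indicator_acl] for each derivative
    separately. For the vertical one it is carried over by exchanging coordinates, under which the
    box is invariant. *)
Lemma support_constant w p1 p2 : 0 <= V0 -> sob w p1 p2 ->
  (forall z, 0 <= w z) -> (forall z, w z = 0 -> p1 z = 0 /\ p2 z = 0) -> nonzero_ae w ->
  energy p1 p2 + potential V0 f w = 0 -> minimises w ->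
  exists d, {ae leb2, forall z, supp_ind w z = d}.
Proof.
move=> V00 sw w0 wp nw Ew Hmin; have [lw l1 l2 a1 a2] := sw.
have iE := energy_integrable l1 l2.
have mb (M : R) := @measurable_box R M.
have ilev (k : R * R -> R) (M e : R) : measurable_fun setT k ->
    (forall z, 0 <= k z <= p1 z ^+ 2 + p2 z ^+ 2) ->
    leb2.-integrable (box M) (EFin \o (fun z => if w z <= e then k z else 0)).
  move=> mk kE.
  apply: (@integrable_le _ _ _ leb2 (box M) _ (fun z => p1 z ^+ 2 + p2 z ^+ 2)).
  - exact: mb.
  - apply: measurable_funTS; apply: measurable_fun_ifT => //.
    by apply: measurable_fun_ler => //; exact: lw.1.
  - by apply: integrableS iE => //; exact: mb.
  - move=> z _; have /andP[h1 h2] := kE z.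
    by case: ifPn => _; [rewrite ger0_norm|rewrite normr0; exact: le_trans h2].
have bnd (k : R * R -> R) (M : R) : measurable_fun setT k ->
    (forall z, 0 <= k z <= p1 z ^+ 2 + p2 z ^+ 2) ->
    exists C e0 : R, [/\ 0 <= C, 0 < e0 & forall e, 0 < e -> e < e0 ->
    \int[leb2]_(z in box M) (if w z <= e then k z else 0) <= C * e ^+ 2].
  move=> mk kE; have [C [e0 [C0 e00 HC]]] := box_small_gradient M V00 sw w0 nw Ew Hmin.
  exists C, e0; split => // e ep ee0; apply: le_trans (HC e ep ee0).
  apply: le_Rintegral.
  - exact: mb.
  - exact: ilev.
  - apply: ilev; first exact: integrable_measurable iE.
    by move=> z; rewrite lexx andbT addr_ge0 ?sqr_ge0.
  - by move=> z _; have /andP[h1 h2] := kE z; case: ifP.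
have k1 z : 0 <= p1 z ^+ 2 <= p1 z ^+ 2 + p2 z ^+ 2 by rewrite sqr_ge0 lerDl sqr_ge0.
have k2 z : 0 <= p2 z ^+ 2 <= p1 z ^+ 2 + p2 z ^+ 2 by rewrite sqr_ge0 lerDr sqr_ge0.
apply: acl_zero_constant.
- exact: measurable_above lw.1.
- by move=> z; rewrite /supp_ind.
- apply: (indicator_acl lw l1 w0 a1).
    by move=> z /wp[].
  by move=> M; apply: bnd k1; apply: measurable_funX; exact: l1.1.
apply: (indicator_acl (L2_swp lw) (L2_swp l2) _ a2).
- by move=> z; exact: w0.
- by move=> z /wp[].
move=> M; have [||C [e0 [C0 e00 HC]]] := bnd (fun z => p2 z ^+ 2) M.
- by apply: measurable_funX; exact: l2.1.
- exact: k2.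
exists C, e0; split => // e ep ee0; have := HC e ep ee0.
rewrite Rintegral_mkcond [X in _ -> X <= _]Rintegral_mkcond.
pose G := (fun z => if w z <= e then p2 z ^+ 2 else 0) \_ (box M).
have mG : measurable_fun setT G.
  apply: (measurable_restrictT _ (mb M)).1; apply: measurable_funTS.
  apply: measurable_fun_ifT => //; first by apply: measurable_fun_ler => //; exact: lw.1.
  by apply: measurable_funX; exact: l2.1.
apply: le_trans; rewrite /Rintegral.
have := @ge0_integral_swap R (fun z => (G z)%:E).
move=> /(_ _ _)/esym; rewrite -/G => ->.
- rewrite le_eqVlt; apply/orP; left; apply/eqP; congr fine; apply: eq_integral => z _.
  congr EFin; rewrite /G !patchE; have -> // : (z \in box M) = ((z.2, z.1) \in box M).
  by apply/idP/idP; rewrite !inE => -[].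
- exact/measurable_EFinP.
- by move=> z; rewrite lee_fin /G patchE; case: ifP => // _; case: ifP => // _; exact: sqr_ge0.
Qed.

Lemma chat_not_attained u : 0 <= V0 -> nodal_nehari V0 f u -> J V0 f u != chat V0 f.
Proof.
move=> V00 [H1u [np [nn [dp dn]]]]; apply/eqP => Jc.
have [g1 [g2 su]] := H1_sob H1u.
have sp := sob_pos su; have sn := sob_neg su.
have Ep := energy_gt0 sp np; have En := energy_gt0 sn nn.
have pp : energy (gpos u g1) (gpos u g2) + potential V0 f (posp u) = 0.
  exact: etrans (esym (dJ_potential V0 adm sp)) dp.
have pn : energy (gneg u g1) (gneg u g2) + potential V0 f (negp u) = 0.
  exact: etrans (esym (dJ_potential V0 adm sn)) dn.
have Ju : J V0 f u = (nehari_energy f (posp u) + nehari_energy f (negp u))%:E.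
  rewrite (J_split V0 adm H1u) (J_potential V0 adm sp) (J_potential V0 adm sn).
  rewrite -EFinD; congr EFin; move: pp pn.
  move: (energy _ _ + _) (energy _ _ + _) (nehari_energy _ _) (nehari_energy _ _) => a b c d -> ->.
  by rewrite mulr0 !add0r.
have p0 z : 0 <= posp u z by rewrite /posp le_max lexx orbT.
have n0 z : negp u z <= 0 by rewrite /negp ge_min lexx orbT.
have bn : potential V0 f (negp u) = - energy (gneg u g1) (gneg u g2).
  by apply/eqP; rewrite -addr_eq0 addrC pn.
(* A competitor v is paired with the unchanged negative part of u in [chat_le]; the projected energy
   of that part equals its Nehari energy and drops out of both sides. *)
have Hmin : minimises (posp u).
  move=> v q1 q2 sv v0 pv.
  have Ev : 0 < energy q1 q2.
    by apply: (energy_gt0 sv); apply: (nonzero_potential (V0 := V0) adm sv); rewrite lt_eqF.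
  have bn0 : potential V0 f (negp u) < 0 by rewrite bn oppr_lt0.
  have := chat_le adm sv sn v0 n0 Ev En pv bn0.
  rewrite -Jc Ju lee_fin /projected_energy bn opprK.
  move: (energy (gneg _ _) _) (energy q1 q2) En => a b a0.
  move: (nehari_energy f (posp u)) (nehari_energy f (negp u)) (nehari_energy f v) => c d e.
  move: (potential V0 f v) pv => k k0.
  by rewrite [X in _ <= _ + X]mulrAC divff ?gt_eqF// mul1r lerD2r ler_pdivlMr// oppr_gt0.
have gp z : posp u z = 0 -> gpos u g1 z = 0 /\ gpos u g2 z = 0.
  rewrite /posp /gpos; case: ifPn => // uz; rewrite max_l ?ltW// => e.
  by rewrite e ltxx in uz.
have [d Hd] := support_constant V00 sp p0 gp np pp Hmin.
(* If d = 0 the positive part of u vanishes almost everywhere; otherwise u > 0 almost everywhere and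
   the negative part does. *)
have [d0|d0] := eqVneq d 0.
  apply: np; apply: ae_sub Hd => z; rewrite d0 /supp_ind => /eqP.
  by case: ltP => [_|h _]; [rewrite oner_eq0|apply: le_anti; rewrite h p0].
apply: nn; apply: ae_sub Hd => z; rewrite /supp_ind => e.
have : 0 < posp u z by move: e; case: ltP => // _ e; rewrite -e eqxx in d0.
by rewrite /posp /negp lt_max ltxx orbF => h; rewrite min_r ?ltW.
Qed.

End minimiser.

Theorem theorem1p2 (R : realType) (V0 : R) (f : R -> R) (theta p Cp : R) :
  0 < V0 ->
  (* f is C^1 *)
  (forall s : R, derivable f s 1) -> continuous (derive1 f) ->
  (* (f1) *)
  (exists C : R, 0 < C /\ forall s : R, `|f s| <= C * expR (4 * pi * s ^+ 2)) ->
  (* (f2) *)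
  (fun s => f s / s) x @[x --> 0^'] --> 0 ->
  (* (f3) *)
  2 < theta ->
  (forall s : R, s != 0 -> 0 < theta * primitive f s <= s * f s) ->
  (* (f4) *)
  (forall a b : R, 0 < a -> a < b -> f a / `|a| < f b / `|b|) ->
  (* (f5) *)
  2 < p -> 0 < Cp ->
  (forall s : R, s != 0 -> Cp * powR `|s| (p - 1) <= Num.sg s * f s) ->
  (* C_p > [chi_p 2 theta/(theta - 2)]^((p-2)/2) *)
  powR (fine (chi_p V0 p) * (2 * theta / (theta - 2))) ((p - 2) / 2) < Cp ->
  (* the least nodal energy level c^ is not attained on M *)
  ~ (exists u : R * R -> R, nodal_nehari V0 f u /\ J V0 f u = chat V0 f).
Proof.
move=> V00 df _ f1 f2 th f3 _ _ _ _ _ [u [uM uc]].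
have adm : admissible theta f.
  split => // s; apply: differentiable_continuous; exact/derivable1_diffP.
by have := chat_not_attained adm (ltW V00) uM; rewrite uc eqxx.
Qed.
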